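(* Let $p\ge 2$, $\alpha=p-1$ and $\theta\ge 0$, let $k_0=\min\{j\in\mathbb{N}: j\ge p-1\}$, and assume $k_0=p-1$ (i.e. $p$ is an integer). Suppose $\sigma_*<\mu_{\alpha,\theta}$. Then: (i) $TMC(\sigma,\alpha,\theta)$ is attained for $\sigma_*<\sigma<\mu_{\alpha,\theta}$. (ii) The function $\nu:(\sigma_*,\mu_{\alpha,\theta})\to\mathbb{R}$ given by $\nu(\sigma)=\frac{(p-1)!}{\sigma^{p-1}}TMC(\sigma,\alpha,\theta)$ is strictly increasing. Moreover, with $TMC(0,\alpha,\theta)=0$, $$TMC(\sigma,\alpha,\theta)=\frac{\sigma^{p-1}}{(p-1)!}\ \text{ for } \sigma\in[0,\sigma_*],\qquad TMC(\sigma,\alpha,\theta)>\frac{\sigma^{p-1}}{(p-1)!}\ \text{ for } \sigma\in(\sigma_*,\mu_{\alpha,\theta}),$$ and in particular $$\sigma_*=\inf\left\{\sigma\in(0,\mu_{\alpha,\theta})\;:\;TMC(\sigma,\alpha,\theta)>\frac{\sigma^{p-1}}{(p-1)!}\right\}.$$ (iii) If $p>2$, then $\sigma_*=0$ and thus $TMC(\sigma,\alpha,\theta)$ is attained for every $\sigma\in(0,\mu_{\alpha,\theta})$.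
   Context: For real $\theta\ge 0$ let $\omega_\theta=\frac{2\pi^{(\theta+1)/2}}{\Gamma((\theta+1)/2)}$ and $\int_0^\infty f(r)\,\mathrm{d}\lambda_\theta=\omega_\theta\int_0^\infty f(r)r^\theta\,\mathrm{d}r$. For $1\le q<\infty$, $L^q_\theta$ is the space of measurable $u$ on $(0,\infty)$ with $\|u\|_{L^q_\theta}=\left(\int_0^\infty |u|^q\,\mathrm{d}\lambda_\theta\right)^{1/q}<\infty$ (similarly with $\alpha$ in place of $\theta$). $X^{1,p}_\infty=X^{1,p}_\infty(\alpha,\theta)$ is the set of all locally absolutely continuous functions $u$ on $(0,\infty)$ with $\lim_{r\to\infty}u(r)=0$, $u\in L^p_\theta$ and $u'\in L^p_\alpha$, with norm $\|u\|=\left(\|u\|^p_{L^p_\theta}+\|u'\|^p_{L^p_\alpha}\right)^{1/p}$. $\mu_{\alpha,\theta}=(\theta+1)\omega_\alpha^{1/\alpha}$. For $t\ge 0$, $\varphi_p(t)=\sum_{j\in\mathbb{N},\, j\ge p-1}\frac{t^j}{j!}$. For $0\le\sigma\le\mu_{\alpha,\theta}$, $$TMC(\sigma,\alpha,\theta)=\sup\left\{\int_0^\infty\varphi_p\left(\sigma|u|^{\frac{p}{p-1}}\right)\mathrm{d}\lambda_\theta\;:\; u\in X^{1,p}_\infty(\alpha,\theta),\ \|u\|\le 1\right\}.$$ ''$TMC(\sigma,\alpha,\theta)$ is attained'' means that there is $u\in X^{1,p}_\infty(\alpha,\theta)$ with $\|u\|\le1$ and $\int_0^\infty\varphi_p(\sigma|u|^{\frac{p}{p-1}})\,\mathrm{d}\lambda_\theta=TMC(\sigma,\alpha,\theta)$.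 The value $\sigma_*=\sigma_*(\alpha,\theta)$ is defined by $$\sigma_*=\inf\{\sigma\in(0,\mu_{\alpha,\theta})\;:\;TMC(\sigma,\alpha,\theta)\text{ is attained}\}$$ if $TMC(\sigma,\alpha,\theta)$ is attained for some $\sigma\in(0,\mu_{\alpha,\theta})$, and $\sigma_*=\infty$ otherwise. *)

(* Defs.v *)
From HB Require Import structures.
From mathcomp Require Import all_boot all_order all_algebra.
From mathcomp Require Import all_classical all_reals all_analysis.
Set Implicit Arguments.
Unset Strict Implicit.
Unset Printing Implicit Defensive.
Import Order.TTheory GRing.Theory Num.Theory.
Import numFieldNormedType.Exports.
Local Open Scope classical_set_scope.
Local Open Scope ring_scope.

(* Functions on (0, oo) are represented by functions R -> R of which only the
   values on `]0, +oo[ matter: no definition below looks at the others. *)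

Section TrudingerMoser.
Context {R : realType}.
Implicit Types (p q alpha theta sigma s t : R) (u f : R -> R).

(* Euler's integral, meaningful for 0 < s. *)
Definition Gamma s : R :=
  \int[lebesgue_measure]_(t in `]0, +oo[) (t `^ (s - 1) * expR (- t)).

Definition omega theta : R :=
  2 * pi `^ ((theta + 1) / 2) / Gamma ((theta + 1) / 2).

(* The integral of f over (0, oo) with respect to lambda_theta; it is only
   used for f nonnegative, and may then be +oo. *)
Definition int_lambda theta f : \bar R :=
  ((omega theta)%:E *
   \int[lebesgue_measure]_(r in `]0%R, +oo[) (f r * r `^ theta)%:E)%E.

Definition Lnorm_lambda q theta u : \bar R :=
  (int_lambda theta (fun r => (`|u r| `^ q)%R) `^ q^-1%R)%E.

Definition L_lambda q theta : set (R -> R) :=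
  [set u : R -> R | measurable_fun (`]0, +oo[ : set R) u /\
                   (Lnorm_lambda q theta u < +oo)%E].

(* Empty open intervals (l i = r i) are allowed, they contribute nothing. *)
Definition abs_continuous_on (a b : R) u : Prop :=
  forall e : R, 0 < e -> exists2 d : R, 0 < d &
    forall (n : nat) (l r : 'I_n -> R),
      (forall i, a <= l i /\ l i <= r i /\ r i <= b) ->
      trivIset setT (fun i => `]l i, r i[%classic) ->
      \sum_(i < n) (r i - l i) < d ->
      \sum_(i < n) `|u (r i) - u (l i)| < e.

Definition loc_abs_continuous u : Prop :=
  forall a b : R, 0 < a -> a <= b -> abs_continuous_on a b u.

(* derive1 u is the pointwise derivative. For u locally absolutely continuous it
   exists almost everywhere on (0, oo), and takes the value 0 where the limit
   of the difference quotients does not exist. *)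
Definition X1p p alpha theta : set (R -> R) :=
  [set u | [/\ loc_abs_continuous u,
               u r @[r --> +oo] --> 0,
               L_lambda p theta u &
               L_lambda p alpha (derive1 u)]].

Definition Xnorm p alpha theta u : \bar R :=
  ((Lnorm_lambda p theta u `^ p + Lnorm_lambda p alpha (derive1 u) `^ p)
     `^ p^-1%R)%E.

Definition mu alpha theta : R := (theta + 1) * omega alpha `^ alpha^-1.

Definition phi p t : R :=
  \big[+%R/0]_(0 <= j <oo | p - 1 <= j%:R) (t ^+ j / j`!%:R).

Definition TM_functional p theta sigma u : \bar R :=
  int_lambda theta (fun r => phi p (sigma * `|u r| `^ (p / (p - 1)))).

Definition TMC p alpha theta sigma : \bar R :=
  ereal_sup [set TM_functional p theta sigma u |
             u in [set u | X1p p alpha theta u /\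
                           (Xnorm p alpha theta u <= 1)%E]].

Definition TMC_attained p alpha theta sigma : Prop :=
  exists u, [/\ X1p p alpha theta u,
                (Xnorm p alpha theta u <= 1)%E &
                TM_functional p theta sigma u = TMC p alpha theta sigma].

(* The infimum of the empty set is +oo, which covers the second case of the
   definition. *)
Definition sigma_star p alpha theta : \bar R :=
  ereal_inf [set sigma%:E | sigma in
    [set sigma | 0 < sigma < mu alpha theta /\
                 TMC_attained p alpha theta sigma]].

(* k stands for p - 1, in the factorial. *)
Definition nu p alpha theta (k : nat) sigma : R :=
  k`!%:R / sigma `^ (p - 1) * fine (TMC p alpha theta sigma).

End TrudingerMoser.

(* Main.v *)
(* Let k = p - 1, q = p/(p - 1), let J and D be the p-th powers of the norms of u
   and u', so that the unit ball is J + D <= 1, and let the excess be the integral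
   of psi(sigma |u|^q), where phi_p(t) = t^k/k! + psi(t). Then the functional is
   (sigma^k/k!) J + excess.
   On the ball, Hoelder's inequality bounds |u|^q by a multiple of ln(1/r) near 0;
   for sigma < mu this dominates the exponential by an integrable power of 1/r.
   At infinity u is uniformly small, and psi(sigma |u|^q) is a small multiple of
   |u|^p. Hence along a maximizing sequence the excess passes to the limit and
   only J may drop; a dilation preserves D, multiplies J and the excess by the
   same factor, and so restores J without decreasing the functional. Since
   vanishing sequences give at most sigma^k/k!, the supremum is attained as soon
   as it is greater than sigma^k/k!. Spreading functions with J -> 1 show that it
   is never smaller. Conversely psi(l t) >= l^(k+1) psi(t) for l >= 1, so that a
   maximizer at sigma makes TMC(tau)/tau^k larger at every tau > sigma.
   If p > 2, functions with D = tau and J = 1 - tau have an excess of order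
   tau^(1/(p-1)), which exceeds the loss of order tau in the leading term. *)
Require Import Defs.
From HB Require Import structures.
From mathcomp Require Import all_boot all_order all_algebra.
From mathcomp Require Import all_classical all_reals all_analysis.
From mathcomp Require Import measurable_realfun ring lra.
Import Order.TTheory GRing.Theory Num.Theory.
Import numFieldNormedType.Exports.
Local Open Scope classical_set_scope.
Local Open Scope ring_scope.
Set Implicit Arguments.
Unset Strict Implicit.
Unset Printing Implicit Defensive.

(** * Absolutely continuous functions *)

Section AbsoluteContinuity.
Context {R : realType}.
Implicit Types (a b e d : R) (u : R -> R) (x : R * R) (s t : seq (R * R)).

(** Absolute continuity is given in its epsilon-delta form and [derive1] is a pointwise derivative,
    so [|u b - u a| <= \int |u'|] has to be earned: [u] is a difference of two nondecreasing
    functions whose Stieltjes measures have Lebesgue densities, and these densities give [u'] almost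
    everywhere. Pointwise convergence of a maximizing sequence says nothing about derivatives.
    Difference quotients do converge, and their energy is at most that of the derivative, with
    constant exactly 1. Fatou's lemma, first in the index of the sequence and then in the step [h],
    gives [D <= 1 - a] for the limit, where [a] is the limit of the [J]. With a larger constant the
    dilated limit could leave the ball. The choice [alpha = p - 1] makes [D] invariant under
    dilations. At [sigma_star] itself nothing is known about attainment, so the formula up to and
    including [sigma_star] rests on another fact: the strict inequality [TMC(s) > s^k / k!] persists
    at some smaller value of [s]. *)

Definition in_segment a b x := [&& a <= x.1, x.1 <= x.2 & x.2 <= b].

Definition nonoverlap x y := (x.2 <= y.1) || (y.2 <= x.1).

Lemma nonoverlapC x y : nonoverlap x y = nonoverlap y x.
Proof. by rewrite /nonoverlap orbC. Qed.

(** Sequences of pairs are easier to concatenate and refine than indexed families. [nonoverlap]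
    compares endpoints, so for degenerate segments it is stricter than disjointness of the open
    intervals, and the passage is harmless. *)
Lemma abs_continuous_on_seq a b u e : abs_continuous_on a b u -> 0 < e ->
  exists2 d, 0 < d & forall s, all (in_segment a b) s ->
    pairwise nonoverlap s -> \sum_(x <- s) (x.2 - x.1) < d ->
    \sum_(x <- s) `|u x.2 - u x.1| < e.
Proof.
move=> ac e0; have [d d0 H] := ac e e0; exists d => // s sab dis.
rewrite !(big_nth (0, 0)) !big_mkord; apply: H => [i|].
  by have /(_ i (ltn_ord i))/and3P[-> -> ->] := all_nthP (0, 0) sab.
apply/trivIsetP => i j _ _ ij; rewrite -subset0 => z [] /=.
rewrite !in_itv/= => /andP[zi1 zi2] /andP[zj1 zj2].
suff : nonoverlap (nth (0, 0) s i) (nth (0, 0) s j).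
  by case/orP => h; lra.
have {}ij : (i : nat) != j by [].
have dis' k l : (k < l)%N -> (l < size s)%N ->
    nonoverlap (nth (0, 0) s k) (nth (0, 0) s l).
  by move=> kl ls; apply: (pairwiseP (0, 0) dis); rewrite ?inE// (ltn_trans kl).
by case: ltngtP ij => // h _; [|rewrite nonoverlapC]; apply: dis'.
Qed.

(** The list [p] omits the left endpoint [l], as the partitions in [variation] do. *)
Definition pieces (l : R) (p : seq R) := zip (belast l p) p.

Lemma pieces_all l r p : path <%R l p -> last l p = r ->
  all (in_segment l r) (pieces l p).
Proof.
elim: p l => [//|y p ih] l /= /andP[ly yp] pr.
have yr : y <= r.
  rewrite -pr; elim: p y yp {ih ly pr} => //= z p ih y /andP[yz zp].
  exact: le_trans (ltW yz) (ih _ zp).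
rewrite /in_segment /= lexx (ltW ly) yr/=; apply: sub_all (ih _ yp pr) => x.
by move=> /and3P[h1 -> ->]; rewrite andbT (le_trans (ltW ly)).
Qed.

Lemma pieces_nonoverlap l p : path <%R l p -> pairwise nonoverlap (pieces l p).
Proof.
elim: p l => [//|y p ih] l /= /andP[ly yp]; rewrite (ih _ yp) andbT.
by apply: sub_all (pieces_all yp erefl) => x /and3P[yx _ _]; rewrite /nonoverlap yx.
Qed.

Lemma pieces_length l p : \sum_(x <- pieces l p) (x.2 - x.1) = last l p - l.
Proof.
elim: p l => [|y p ih] l /=; first by rewrite big_nil subrr.
by rewrite big_cons/= ih; lra.
Qed.

Lemma variation_pieces a b u p :
  variation a b u p = \sum_(x <- pieces a p) `|u x.2 - u x.1|.
Proof.
rewrite /variation (big_nth (0, 0)) size_zip size_belast minnn.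
apply: eq_big_nat => i /andP[_ ip] /=.
rewrite nth_zip ?size_belast//= (set_nth_default b 0) //.
have -> // : nth 0 (belast a p) i = nth b (a :: p) i.
rewrite lastI nth_rcons size_belast ip; apply: set_nth_default.
by rewrite size_belast.
Qed.

(* The induction replaces one segment at a time by the pieces of a subdivision
   of it, which does not change the total length. *)
Lemma total_variation_seq a b u d e : (forall s, all (in_segment a b) s ->
    pairwise nonoverlap s -> \sum_(x <- s) (x.2 - x.1) < d ->
    \sum_(x <- s) `|u x.2 - u x.1| < e) ->
  forall s, all (in_segment a b) s ->
    pairwise nonoverlap s -> \sum_(x <- s) (x.2 - x.1) < d ->
    (\sum_(x <- s) total_variation x.1 x.2 u <= e%:E)%E.
Proof.
move=> H s; suff: forall t, all (in_segment a b) (s ++ t) ->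
    pairwise nonoverlap (s ++ t) -> \sum_(x <- s ++ t) (x.2 - x.1) < d ->
    (\sum_(x <- s) total_variation x.1 x.2 u +
     (\sum_(x <- t) `|u x.2 - u x.1|)%:E <= e%:E)%E.
  by move=> /(_ [::]); rewrite cats0 big_nil adde0.
elim: s => [|x s ih] t.
  by rewrite big_nil add0e/= => t1 t2 t3; rewrite lee_fin; exact/ltW/H.
rewrite cat_cons/= => /andP[xab stab] /andP[xst stn] std.
(* Finiteness allows the other terms to be moved to the right, so that the supremum defining the
   total variation over [x] can be bounded one subdivision at a time. *)
have fin : (\sum_(x <- s) total_variation x.1 x.2 u +
     (\sum_(x <- t) `|u x.2 - u x.1|)%:E)%E \is a fin_num.
  have := ih t stab stn; rewrite big_cons in std.
  have x12 : 0 <= x.2 - x.1 by rewrite subr_ge0; case/and3P: xab.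
  have std' : \sum_(j <- (s ++ t)) (j.2 - j.1) < d by lra.
  move=> /(_ std') ste; rewrite ge0_fin_numE; first exact: le_lt_trans ste (ltry e).
  rewrite adde_ge0 ?lee_fin ?sumr_ge0// big_seq sume_ge0// => y ys.
  apply: total_variation_ge0; move: stab; rewrite all_cat => /andP[+ _].
  by move=> /allP/(_ _ ys)/and3P[].
rewrite big_cons -addeA -leeBrDr//.
apply: ge_ereal_sup => _ [_ [p [px1 /eqP px2] <-] <-].
have := ih (pieces x.1 p ++ t).
rewrite !big_cat/= -(variation_pieces x.1 x.2).
have perm : perm_eq (s ++ pieces x.1 p ++ t) (pieces x.1 p ++ s ++ t).
  by rewrite perm_catCA.
have pal := pieces_all px1 px2.
rewrite (perm_all _ perm) all_cat stab andbT => /(_ _)/wrap[].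
  apply: sub_all pal => y /and3P[y1 y2 y3].
  case/and3P: xab => x1 x2 x3; rewrite /in_segment y2 (le_trans x1)//=.
  exact: le_trans y3 x3.
have key y z : y \in pieces x.1 p -> z \in s ++ t -> nonoverlap y z.
  move=> yp zst; have := allP pal _ yp => /and3P[y1 y2 y3].
  have := allP xst _ zst; rewrite /nonoverlap => /orP[] h.
    by rewrite (le_trans y3 h).
  by rewrite (le_trans h y1) orbT.
rewrite !pairwise_cat allrel_catr pieces_nonoverlap//=.
move: stn; rewrite pairwise_cat => /and3P[-> -> ->]; rewrite !andbT => /(_ _)/wrap[].
  apply/andP; split; apply/allrelP => y z yp zst.
    by rewrite nonoverlapC; apply: key => //; rewrite mem_cat yp.
  by apply: key => //; rewrite mem_cat zst orbT.
move: std; rewrite big_cons big_cat/= => std.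
rewrite (pieces_length x.1 p) px2 addrCA => /(_ std).
by rewrite EFinD addeCA leeBrDr.
Qed.

End AbsoluteContinuity.

(** * Stieltjes measures of absolutely continuous monotone functions *)

Section AbsContStieltjes.
Context {R : realType}.
Variable H : cumulative R R.

Local Notation mu := (@lebesgue_measure R).
Let muH : set (measurableTypeR R) -> \bar R := lebesgue_stieltjes_measure H.

Hypothesis acH : forall e, 0 < e -> exists2 d, 0 < d &
  forall s : seq (R * R), all (fun x => x.1 <= x.2) s -> pairwise nonoverlap s ->
    \sum_(x <- s) (x.2 - x.1) < d -> \sum_(x <- s) (H x.2 - H x.1) <= e.

Lemma lebesgue_stieltjes_measure_itvoc (f : cumulative R R) (x y : R) : x <= y ->
  lebesgue_stieltjes_measure f `]x, y]%classic = (f y - f x)%:E.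
Proof.
move=> xy; rewrite /lebesgue_stieltjes_measure/= /measure_extension/=.
by rewrite measurable_mu_extE//= ?wlength_itv_bnd//; exact: is_ocitv.
Qed.

Lemma nonoverlap_itvoc (x y : R * R) : x.1 < x.2 -> y.1 < y.2 ->
  `]x.1, x.2] `&` `]y.1, y.2] = set0 :> set R -> nonoverlap x y.
Proof.
move=> x12 y12 xy; rewrite /nonoverlap; apply: contraPT xy.
rewrite negb_or -!ltNge => /andP[h1 h2]; apply/eqP/set0P.
exists (Num.min x.2 y.2); split => /=; rewrite in_itv/= ge_min lt_min ?lexx ?orbT.
  by rewrite x12 h2.
by rewrite y12 h1.
Qed.

(** The intervals of a cover may overlap, whereas the hypothesis speaks of nonoverlapping ones. The
    decomposition of the union in the ring generated by half-open intervals replaces them by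
    disjoint ones with the same union. *)
Lemma muH_finite_union e d (F : nat -> set R) n :
  (forall s : seq (R * R), all (fun x => x.1 <= x.2) s -> pairwise nonoverlap s ->
    \sum_(x <- s) (x.2 - x.1) < d -> \sum_(x <- s) (H x.2 - H x.1) <= e) ->
  (forall i, ocitv (F i)) -> 0 <= e ->
  (mu (\big[setU/set0]_(i < n) F i) < d%:E)%E ->
  (muH (\big[setU/set0]_(i < n) F i) <= e%:E)%E.
Proof.
move=> acs ocF e0; set U := \big[setU/set0]_(i < n) F i.
have [->|/set0P U0] := eqVneq U set0; first by rewrite /muH !measure0 lee_fin.
have mU : measurable (U : set (SetRing.type (ocitv_type R))).
  by apply: bigsetU_measurable => i _; apply: sub_gen_smallest; exact: ocF.
set D := SetRing.decomp (U : set (SetRing.type (ocitv_type R))).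
have finD : finite_set D by exact: SetRing.decomp_finite_set.
have Dn0 : forall X, D X -> X !=set0.
  exact: (@SetRing.all_decomp_neq0 _ (ocitv_type R) U U0).
have DE (X : set R) : exists x : R * R, D X -> x.1 < x.2 /\ X = `]x.1, x.2]%classic.
  have [DX|] := pselect (D X); last by move=> nDX; exists (0, 0).
  have /ocitvP[X0|[x x12 ->]] := SetRing.decomp_measurable mU (mem_set DX); last by exists x.
  by have := Dn0 _ DX; rewrite X0 => -[].
have [g gE] := choice DE.
pose s := [seq g X | X <- finmap.enum_fset (fset_set D)].
(* Stated for every [f], because it is needed both for the identity (lengths) and for [H]. *)
have muE (f : cumulative R R) : lebesgue_stieltjes_measure f U =
    (\sum_(x <- s) (f x.2 - f x.1))%:E.
  rewrite [in LHS](_ : U = \bigcup_(X in D) X); last first.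
    exact/esym/(SetRing.cover_decomp (U : set (SetRing.type (ocitv_type R)))).
  rewrite measure_fin_bigcup//; last 2 first.
    exact: SetRing.decomp_triv.
    by move=> X /gE[_ ->]; exact: measurable_itv.
  rewrite fsbig_finite//= /s big_map -sumEFin; apply: eq_big_seq => X.
  rewrite in_fset_set// inE => /gE[/ltW gX {1}->].
  by rewrite lebesgue_stieltjes_measure_itvoc.
rewrite /lebesgue_measure muE lte_fin => sd; rewrite /muH muE lee_fin.
apply: acs => //.
  apply/allP => _ /mapP[X + ->]; rewrite in_fset_set// inE => /gE[+ _].
  exact: ltW.
rewrite pairwise_map; have := finmap.fset_uniq (fset_set D).
rewrite uniq_pairwise.
apply: (sub_in_pairwise (P := mem (finmap.enum_fset (fset_set D)))); last exact/allP.
move=> X Y /=; rewrite !in_fset_set// !inE => DX DY XY.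
have [gX XE] := gE _ DX; have [gY YE] := gE _ DY.
apply: nonoverlap_itvoc => //; rewrite -XE -YE.
have /trivIsetP := @SetRing.decomp_triv _ (ocitv_type R) U.
exact.
Qed.

(** A null set has a countable cover by half-open intervals of total length below [d]. Each finite
    part of the cover has [muH] at most [e], and continuity from below carries this bound to the
    whole cover. *)
Lemma muH_dominated : muH `<< mu.
Proof.
apply/null_content_dominatesP => A mA A0.
apply/eqP; rewrite eq_le measure_ge0 andbT; apply/lee_addgt0Pr => e e0; rewrite add0e.
have [d d0 acs] := acH e0.
have : (mu A < d%:E)%E.
  by have -> : mu A = 0%E by exact: A0.
rewrite [X in (X < _)%E -> _]/lebesgue_measure /lebesgue_stieltjes_measure.
rewrite /measure_extension /mu_ext => /ereal_inf_lt[_ [F [ocF AF] <-] Fd].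
have mF i : measurable (F i : set R).
  by apply: sub_gen_smallest; exact: ocF.
have mUF n : measurable (\big[setU/set0]_(i < n) F i : set R).
  exact: bigsetU_measurable.
apply: (@le_trans _ _ (muH (\bigcup_i F i))).
  by apply: le_measure => //; rewrite inE//; exact: bigcupT_measurable.
rewrite -bigcup_bigsetU_bigcup.
have cv : muH \o (fun n => \big[setU/set0]_(i < n.+1) F i) @ \oo -->
    muH (\bigcup_n \big[setU/set0]_(i < n.+1) F i).
  apply: nondecreasing_cvg_mu => [n||]; first exact: mUF.
    by apply: bigcupT_measurable => n; exact: mUF.
  by move=> m n mn; apply/subsetPset/subset_bigsetU.
rewrite -(cvg_lim _ cv)//; apply: lime_le; first by apply/cvg_ex; eexists; exact: cv.
apply: nearW => n /=; apply: muH_finite_union acs _ (ltW e0) _ => //.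
apply: le_lt_trans Fd.
apply: (le_trans (Boole_inequality (@lebesgue_measure R) (fun i _ => mF i))).
rewrite -(big_mkord xpredT (fun i => mu (F i))).
rewrite (eq_bigr (fun i => wlength idfun (F i))).
  by apply: nneseries_lim_ge => i _ _; exact: measure_ge0.
move=> i _; rewrite /lebesgue_measure /lebesgue_stieltjes_measure.
by rewrite /measure_extension/= measurable_mu_extE//; exact: ocF.
Qed.

(** This is the Radon-Nikodym theorem; restriction to []a, b]] makes the Stieltjes measure finite
    and hence its density integrable. *)
Lemma cumulative_density (a b : R) : a <= b -> exists g : R -> R,
  mu.-integrable setT (EFin \o g) /\
  forall x, a <= x <= b -> H x - H a = \int[mu]_(t in `]a, x]) g t.
Proof.
move=> ab; have mab : measurable (`]a, b] : set (measurableTypeR R)).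
  exact: measurable_itv.
have muHab : (lebesgue_stieltjes_measure H (`]a, b]%classic : set (measurableTypeR R)) < +oo)%E.
  by rewrite lebesgue_stieltjes_measure_itvoc// ltry.
pose nu : {finite_measure set (measurableTypeR R) -> \bar R} := mfrestr mab muHab.
have numu : nu `<< @lebesgue_measure R.
  apply/null_content_dominatesP => A mA A0; rewrite /nu/= /mfrestr /mrestr.
  apply/eqP; rewrite eq_le measure_ge0 andbT.
  have /null_content_dominatesP/(_ A mA A0) <- := muH_dominated.
  by apply: le_measure; rewrite ?inE//; exact: measurableI.
have fi := Radon_Nikodym_SigmaFinite.f_integrable numu.
have ff := Radon_Nikodym_SigmaFinite.f_fin_num numu.
exists (fine \o Radon_Nikodym_SigmaFinite.f nu (@lebesgue_measure R)).
split.
  by apply: eq_integrable fi => // x _ /=; rewrite fineK.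
move=> x /andP[ax xb].
have := @Radon_Nikodym_SigmaFinite.f_integral _ _ _ _ _ numu _ (measurable_itv `]a, x]).
rewrite /nu/= /mfrestr /mrestr setIidl; last first.
  by apply: subset_itvl; rewrite bnd_simp.
rewrite lebesgue_stieltjes_measure_itvoc// => E.
rewrite /Rintegral; under eq_integral do rewrite /= fineK//.
by rewrite -E.
Qed.

End AbsContStieltjes.

(** * Densities of absolutely continuous functions *)

Section AbsContDerivative.
Context {R : realType}.
Implicit Types (a b e d : R) (u : R -> R).

Local Notation mu := (@lebesgue_measure R).

Lemma nondecreasing_density (H : R -> R) a b : {homo H : x y / x <= y} ->
  (forall e, 0 < e -> exists2 d, 0 < d &
    forall s : seq (R * R), all (fun x => x.1 <= x.2) s -> pairwise nonoverlap s ->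
    \sum_(x <- s) (x.2 - x.1) < d -> \sum_(x <- s) (H x.2 - H x.1) <= e) ->
  a <= b -> exists g : R -> R,
  mu.-integrable setT (EFin \o g) /\
  forall x, a <= x <= b -> H x - H a = \int[mu]_(t in `]a, x]) g t.
Proof.
move=> ndH acH ab.
(* A single segment in [acH] gives the right continuity that a [cumulative] function requires. *)
have rcH : forall x : R, H y @[y --> x^'+] --> H x.
  move=> x; apply/cvgrPdist_le => e e0; have [d d0 acs] := acH e e0.
  near=> y; have xy : x < y by near: y; exact: nbhs_right_gt.
  have := acs [:: (x, y)]; rewrite !big_cons !big_nil/= !addr0 andbT (ltW xy)//.
  move=> /(_ isT isT); rewrite distrC ger0_norm ?subr_ge0 ?ndH ?(ltW xy)//.
  by apply; rewrite ltrBlDl; near: y; apply: nbhs_right_lt; rewrite ltrDl.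
have [c cE] : exists c : cumulative R R, (c : R -> R) = H.
  by exists (HB.pack_for (cumulative R R) H (isCumulative.Build R _ R H ndH rcH)).
rewrite -cE; apply: cumulative_density => // e e0.
by rewrite cE; exact: acH.
Unshelve. all: by end_near. Qed.

(** Composition with this projection onto [[a, b]] extends a function by constants, which turns
    estimates on [[a, b]] into estimates on the whole line, where a [cumulative] function lives. *)
Definition clamp a b x := Num.max a (Num.min b x).

Lemma clamp_homo a b : {homo clamp a b : x y / x <= y}.
Proof. by move=> x y xy; rewrite /clamp; case: (leP b x) => ?; case: (leP b y) => ?;
  case: (leP a b) => ?; case: (leP a x) => ?; case: (leP a y) => ?; lra. Qed.

Lemma clamp_bounds a b x : a <= b -> a <= clamp a b x <= b.
Proof. by move=> ab; rewrite /clamp; case: (leP b x) => ?;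
  case: (leP a b) => ?; case: (leP a x) => ?; lra. Qed.

Lemma clamp_lip a b x y : a <= b -> x <= y -> clamp a b y - clamp a b x <= y - x.
Proof. by move=> ab xy; rewrite /clamp; case: (leP b x) => ?; case: (leP b y) => ?;
  case: (leP a b) => ?; case: (leP a x) => ?; case: (leP a y) => ?; lra. Qed.

Lemma clamp_id a b x : a <= x <= b -> clamp a b x = x.
Proof. by move=> axb; rewrite /clamp; case: (leP b x) => ?;
  case: (leP a b) => ?; case: (leP a x) => ?; lra. Qed.

Lemma clamp_seq a b d (s : seq (R * R)) : a <= b ->
  all (fun x => x.1 <= x.2) s -> pairwise nonoverlap s ->
  \sum_(x <- s) (x.2 - x.1) < d ->
  let s' := [seq (clamp a b x.1, clamp a b x.2) | x <- s] in
  [/\ all (in_segment a b) s', pairwise nonoverlap s' &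
      \sum_(x <- s') (x.2 - x.1) < d].
Proof.
move=> ab s12 sno sd s'; split.
- apply/allP => _ /mapP[x xs ->]; rewrite /in_segment/=.
  have /andP[-> _] := clamp_bounds x.1 ab; have /andP[_ ->] := clamp_bounds x.2 ab.
  by rewrite clamp_homo//; exact: (allP s12).
- rewrite pairwise_map; apply: sub_pairwise sno => x y.
  by rewrite /nonoverlap/= => /orP[]/(@clamp_homo a b) -> //; rewrite orbT.
- apply: le_lt_trans sd; rewrite big_map big_seq [leRHS]big_seq.
  by apply: ler_sum => x xs; apply: clamp_lip => //; exact: (allP s12).
Qed.

(** With [d] taken for the tolerance 1, every step of length [d / 2] has total variation at most 1,
    and finitely many steps reach [b]. *)
Lemma ac_total_variation_fin a b u : a <= b -> abs_continuous_on a b u ->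
  total_variation a b u \is a fin_num.
Proof.
move=> ab ac; have [d d0 acs] := abs_continuous_on_seq ac ltr01.
have tvs := total_variation_seq acs.
have d20 : 0 < d / 2 by lra.
suff H (n : nat) : (total_variation a (Num.min b (a + n%:R * (d / 2)))%R u <= n%:R%:E)%E.
  have [n nd] : exists n : nat, b <= a + n%:R * (d / 2).
    exists (Num.truncn ((b - a) / (d / 2))).+1.
    rewrite -lerBlDl -ler_pdivrMr//; exact/ltW/truncnS_gt.
  rewrite ge0_fin_numE ?total_variation_ge0//.
  by have := H n; rewrite min_l// => /le_lt_trans; apply; rewrite ltry.
elim: n => [|n ih].
  by rewrite mul0r addr0 min_r// total_variationxx.
set x := Num.min b (a + n%:R * (d / 2)) in ih *.
set y := Num.min b _.
have nd : 0 <= n%:R * (d / 2) by rewrite mulr_ge0// ltW.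
have ax : a <= x by rewrite /x; case: (leP b (a + n%:R * (d / 2))) => ?; lra.
have yE : y = Num.min b (a + n%:R * (d / 2) + d / 2).
  by rewrite /y -natr1 mulrDl mul1r addrA.
have xy : x <= y by rewrite yE /x; case: (leP b (a + n%:R * (d / 2))) => ?; case: (leP b (a + n%:R * (d / 2) + d / 2)) => ?; lra.
have yx : y - x < d by rewrite yE /x; case: (leP b (a + n%:R * (d / 2))) => ?; case: (leP b (a + n%:R * (d / 2) + d / 2)) => ?; lra.
have yb : y <= b by rewrite yE; case: (leP b (a + n%:R * (d / 2) + d / 2)) => ?; lra.
rewrite (total_variationD _ ax xy) -natr1 EFinD leeD//.
have := tvs [:: (x, y)]; rewrite !big_cons !big_nil /= adde0 addr0; apply => //.
by rewrite /in_segment/= ax xy yb.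
Qed.

(** Jordan decomposition: with [V] the variation counted from [a], both [V] and [V - u] are
    nondecreasing and inherit absolute continuity. *)
Lemma ac_difference_density a b u : a <= b -> abs_continuous_on a b u ->
  exists g1 g2 : R -> R, [/\ mu.-integrable setT (EFin \o g1),
  mu.-integrable setT (EFin \o g2) &
  forall x, a <= x <= b ->
   u x - u a = \int[mu]_(t in `]a, x]) g1 t - \int[mu]_(t in `]a, x]) g2 t].
Proof.
move=> ab ac; pose V x := fine (total_variation a x u).
have finV := ac_total_variation_fin ab ac.
have finVxy x y : a <= x -> x <= y -> y <= b -> total_variation x y u \is a fin_num.
  move=> ax xy yb; move: finV; rewrite (total_variationD u ax (le_trans xy yb)).
  rewrite (total_variationD u xy yb) !fin_numD.
  by move=> /and3P[_ /[swap] _].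
have VB x y : a <= x -> x <= y -> y <= b -> total_variation x y u = (V y - V x)%:E.
  move=> ax xy yb; rewrite /V (total_variationD u ax xy) fineD ?finVxy//.
    by rewrite addrAC subrr add0r fineK// finVxy.
  exact: le_trans yb.
pose H1 x := V (clamp a b x); pose H2 x := V (clamp a b x) - u (clamp a b x).
have key x y : x <= y -> `|u (clamp a b y) - u (clamp a b x)| <= H1 y - H1 x.
  move=> xy; rewrite /H1 -lee_fin.
  have /andP[h1 h2] := clamp_bounds x ab; have /andP[h3 h4] := clamp_bounds y ab.
  by rewrite -VB// ?clamp_homo//; apply: total_variation_ge; exact: clamp_homo.
have nd1 : {homo H1 : x y / x <= y}.
  by move=> x y /key; rewrite -subr_ge0; apply: le_trans.
have nd2 : {homo H2 : x y / x <= y}.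
  by move=> x y /key/ler_normlW; rewrite /H2 /H1; lra.
have ac1 e : 0 < e -> exists2 d, 0 < d &
    forall s : seq (R * R), all (fun x => x.1 <= x.2) s -> pairwise nonoverlap s ->
    \sum_(x <- s) (x.2 - x.1) < d -> \sum_(x <- s) (H1 x.2 - H1 x.1) <= e.
  move=> e0; have [d d0 acs] := abs_continuous_on_seq ac e0; exists d => // s s1 s2 s3.
  have [t1 t2 t3] := clamp_seq ab s1 s2 s3.
  have := total_variation_seq acs t1 t2 t3.
  rewrite big_map -lee_fin -sumEFin; apply: le_trans.
  rewrite big_seq [leRHS]big_seq; apply: lee_sum => x xs.
  have /andP[h1 h2] := clamp_bounds x.1 ab; have /andP[h3 h4] := clamp_bounds x.2 ab.
  by rewrite /= VB// clamp_homo//; exact: (allP s1).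
have ac2 e : 0 < e -> exists2 d, 0 < d &
    forall s : seq (R * R), all (fun x => x.1 <= x.2) s -> pairwise nonoverlap s ->
    \sum_(x <- s) (x.2 - x.1) < d -> \sum_(x <- s) (H2 x.2 - H2 x.1) <= e.
  (* Increments of [V - u] are at most twice those of [V], since [|u y - u x| <= V y - V x]; hence
     [e / 2]. *)
  move=> e0; have [d d0 acs] := ac1 (e / 2) (divr_gt0 e0 (ltr0Sn _ _)).
  exists d => // s s1 s2 s3; have := acs s s1 s2 s3.
  suff : \sum_(x <- s) (H2 x.2 - H2 x.1) <= 2 * \sum_(x <- s) (H1 x.2 - H1 x.1) by lra.
  rewrite mulr_sumr big_seq [leRHS]big_seq; apply: ler_sum => x xs.
  have := key _ _ (allP s1 _ xs); rewrite ler_norml => /andP[].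
  by rewrite /H2 /H1; lra.
have [g1 [ig1 E1]] := nondecreasing_density nd1 ac1 ab.
have [g2 [ig2 E2]] := nondecreasing_density nd2 ac2 ab.
exists g1, g2; split => // x axb; rewrite -E1// -E2// /H1 /H2 !clamp_id ?lexx//.
by lra.
Qed.

End AbsContDerivative.

Section FundamentalInequality.
Context {R : realType}.
Implicit Types (a b : R) (u : R -> R).

Local Notation mu := (@lebesgue_measure R).

(** Up to a constant, [u] is the indefinite integral of [g1 - g2], so by Lebesgue differentiation
    [derive1 u] equals [g1 - g2] almost everywhere. *)
Lemma ac_le_integral_derive1 a b u : a < b -> abs_continuous_on a b u ->
  measurable_fun `]a, b[ (derive1 u) ->
  (`|u b - u a|%:E <= \int[mu]_(x in `]a, b[) `|derive1 u x|%:E)%E.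
Proof.
move=> ab ac mu'; have [g1 [g2 [ig1 ig2 uE]]] := ac_difference_density (ltW ab) ac.
have ig (g : R -> R) (A : set R) : mu.-integrable setT (EFin \o g) ->
    measurable A -> mu.-integrable A (EFin \o g).
  by move=> iG mA; apply: integrableS iG.
have ftc (g : R -> R) : mu.-integrable setT (EFin \o g) ->
    {ae mu, forall x, a < x ->
       is_derive x 1 (fun y => \int[mu]_(t in `]a, y]) g t) (g x)}.
  move=> iG.
  have := @FTC1 R g (BRight a) (fun y => ig _ _ iG (measurable_itv _))
    (open_integrable_locally openT iG).
  apply: (@filterS _ _ (ae_filter_ringOfSetsType mu)) => x H ax; have [d1 <-] := H ax.
  by rewrite derive1E; exact: derivableP.
have aeE : {ae mu, forall x, `]a, b[%classic x -> derive1 u x = g1 x - g2 x}.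
  move: (ftc _ ig1) (ftc _ ig2); apply: (@filterS2 _ _ (ae_filter_ringOfSetsType mu)) => x H1 H2 /=.
  rewrite in_itv/= => /andP[ax xb].
  rewrite derive1E; apply: derive_val; have {}H1 := H1 ax; have {}H2 := H2 ax.
  have := is_deriveD (is_derive_cst (u a) x 1) (is_deriveB H1 H2).
  rewrite add0r; apply: near_eq_is_derive.
  near=> y; have /andP[ay yb] : a <= y <= b.
    by apply/andP; split; apply/ltW; near: y; [exact: lt_nbhsr|exact: lt_nbhsl].
  by rewrite !fctE /= -uE ?ay//; lra.
have mg (g : R -> R) : mu.-integrable setT (EFin \o g) ->
    measurable_fun setT g.
  by move=> /integrableP[/measurable_EFinP].
rewrite -abse_EFin.
have -> : ((u b - u a)%:E = \int[mu]_(x in `]a, b]) (g1 x - g2 x)%:E)%E.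
  rewrite uE ?(ltW ab) ?lexx//; rewrite /Rintegral.
  under [RHS]eq_integral do rewrite EFinB.
  have i1 := ig _ _ ig1 (measurable_itv `]a, b]).
  have i2 := ig _ _ ig2 (measurable_itv `]a, b]).
  by rewrite integralB_EFin// EFinB !fineK//; exact: integrable_fin_num.
have m12 : measurable_fun setT (fun x => g1 x - g2 x).
  by apply: measurable_funB; exact: mg.
apply: (le_trans (le_abse_integral mu (measurable_itv `]a, b]) _)).
  by apply/measurable_EFinP; exact: measurable_funTS.
rewrite -integral_itv_bndo_bndc; last first.
  apply: measurableT_comp => //; apply/measurable_EFinP; exact: measurable_funTS.
rewrite le_eqVlt; apply/orP; left; apply/eqP.
apply: ae_eq_integral => //.
- apply: measurableT_comp => //; apply/measurable_EFinP; exact: measurable_funTS.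
- by apply/measurable_EFinP; exact: measurableT_comp.
- by apply: (@filterS _ _ (ae_filter_ringOfSetsType mu)) aeE => x H xab; rewrite H.
Unshelve. all: by end_near. Qed.

End FundamentalInequality.

(** * Measurability of the derivative *)

Section DerivativeMeasurable.
Context {R : realType}.
Implicit Types (u : R -> R).

Definition slope u (h x : R) : R := (u (x + h) - u x) / h.

Lemma derivable_slope u x : derivable u x 1 <-> cvg (slope u h x @[h --> 0^']).
Proof.
rewrite /derivable (_ : (fun h => _) = (fun h => slope u h x)); first by [].
by apply/funext => h; rewrite /slope/= [h%:A]mulr1 (addrC h) [RHS]mulrC.
Qed.

Lemma derive1_slope u x : derive1 u x = lim (slope u h x @[h --> 0^']).
Proof.
rewrite /derive1 (_ : (fun h => _) = (fun h => slope u h x)); first by [].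
by apply/funext => h; rewrite /slope/= (addrC h) [RHS]mulrC.
Qed.

Lemma derivable_cauchy_slope u x : derivable u x 1 <->
  forall k : nat, exists m : nat, forall h h' : R,
    0 < `|h| < m.+1%:R^-1 -> 0 < `|h'| < m.+1%:R^-1 ->
    `|slope u h x - slope u h' x| <= k.+1%:R^-1.
Proof.
rewrite derivable_slope; split.
  move=> /cvg_ex[l /cvgrPdist_lt cl] k.
  have k0 : 0 < (2 * k.+1%:R)^-1 :> R by rewrite invr_gt0 mulr_gt0.
  have [/= d d0 dl] := cl _ k0.
  have [m md] : exists m : nat, m.+1%:R^-1 < d.
    by near \oo => m; exists m; near: m; exact: near_infty_natSinv_lt (PosNum d0).
  have H h : 0 < `|h| < m.+1%:R^-1 -> `|l - slope u h x| < (2 * k.+1%:R)^-1.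
    move=> /andP[h0 hm]; apply: dl; last by rewrite -normr_gt0.
    by rewrite /ball_/= sub0r normrN (lt_trans hm).
  exists m => h h' /H h1 /H h2.
  rewrite (_ : _ - _ = (l - slope u h' x) - (l - slope u h x)); last by lra.
  rewrite (le_trans (ler_normB _ _))//.
  rewrite (_ : k.+1%:R^-1 = (2 * k.+1%:R)^-1 + (2 * k.+1%:R)^-1); last first.
    by rewrite invfM -mulrDl -[2^-1]mul1r -splitr mul1r.
  by rewrite lerD// ltW.
move=> H; apply/cauchy_cvgP/cauchy_exP => _/posnumP[e].
have [k ke] : exists k : nat, k.+1%:R^-1 < e%:num.
  by near \oo => k; exists k; near: k; exact: near_infty_natSinv_lt.
have [m mk] := H k.
have m0 : 0 < (2 * m.+1%:R)^-1 :> R by rewrite invr_gt0 mulr_gt0.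
(* Any slope with an admissible step can serve as the centre of the ball; half the radius is such a
   step. *)
exists (slope u (2 * m.+1%:R)^-1 x).
exists m.+1%:R^-1 => /=; first by rewrite invr_gt0.
move=> h; rewrite /ball_/= sub0r normrN => hm h0.
rewrite /ball/=; apply: le_lt_trans ke; apply: mk.
  rewrite gtr0_norm// m0 invfM gtr_pMl ?invr_gt0//.
  by rewrite invf_lt1// ltr1n.
by rewrite normr_gt0 h0.
Unshelve. all: by end_near. Qed.

(** The [lim] of a filter that does not converge is the default point, which is 0 in [R]. *)
Lemma derive1_nderivable u x : ~ derivable u x 1 -> derive1 u x = 0.
Proof.
rewrite derivable_slope derive1_slope => H.
by rewrite /lim /lim_in /= xgetPN// => y /= xy; apply: H; apply/cvg_ex; exists y.
Qed.

Lemma derivable_slope_seq u x : derivable u x 1 ->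
  slope u n.+1%:R^-1 x @[n --> \oo] --> derive1 u x.
Proof.
rewrite derivable_slope derive1_slope => H.
have : (fun n : nat => n.+1%:R^-1 : R) @ \oo --> (0 : R)^'.
  move=> A [e /= e0 eA]; rewrite nbhs_simpl/=; near=> n; apply: eA => /=; last by rewrite invr_eq0.
  rewrite sub0r normrN ger0_norm//.
  by near: n; exact: near_infty_natSinv_lt (PosNum e0).
by move=> h; exact: (cvg_comp _ _ h H).
Unshelve. all: by end_near. Qed.

(** For fixed [k] and [m] the intersection over [hh] is uncountable, but closed because slopes are
    continuous in [x]; so the set [S] of derivability is Borel. On [S] the derivative is a limit of
    slopes, off [S] it is 0. *)
Lemma continuous_measurable_derive1T u : continuous u ->
  measurable_fun setT (derive1 u).
Proof.
move=> cu; pose S := [set x | derivable u x 1].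
have cslope h : continuous (slope u h).
  move=> x; apply: cvgM; last exact: cvg_cst.
  apply: cvgB; last exact: cu.
  apply: (@continuous_comp _ _ _ (fun x => x + h)); last exact: cu.
  by apply: cvgD; [exact: cvg_id|exact: cvg_cst].
have mS : measurable S.
  rewrite (_ : S = \bigcap_k \bigcup_m
     \bigcap_(hh in [set hh : R * R |
        0 < `|hh.1| < m.+1%:R^-1 /\ 0 < `|hh.2| < m.+1%:R^-1])
       [set x | `|slope u hh.1 x - slope u hh.2 x| <= k.+1%:R^-1]).
    apply: bigcapT_measurable => k; apply: bigcupT_measurable => m.
    apply: closed_measurable; apply: closed_bigI => hh _.
    have cc : continuous (fun x => `|slope u hh.1 x - slope u hh.2 x|).
      by move=> x; apply: cvg_norm; apply: cvgB; exact: cslope.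
    by move/continuous_closedP : cc => /(_ _ (@closed_le R k.+1%:R^-1)).
  apply/seteqP; split => x.
    move=> /derivable_cauchy_slope H k _; have [m Hm] := H k.
    by exists m => // -[h h'] /= [h1 h2]; exact: Hm.
  move=> H; apply/derivable_cauchy_slope => k; have [m _ Hm] := H k I.
  by exists m => h h' h1 h2; exact: (Hm (h, h') (conj h1 h2)).
apply: (@measurable_fun_cvg _ _ _ _
    (fun n x => if x \in S then slope u n.+1%:R^-1 x else 0)).
  move=> n; apply: measurable_fun_ifT => //.
    apply: (measurable_fun_bool true); rewrite setTI (_ : _ @^-1` _ = S)//.
    by apply/seteqP; split => y /=; [exact: set_mem|exact: mem_set].
  exact: continuous_measurable_fun.
move=> x _; case: (pselect (S x)) => Sx.
  by rewrite (mem_set Sx); exact: derivable_slope_seq.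
by rewrite memNset// derive1_nderivable//; exact: cvg_cst.
Qed.

Lemma continuous_measurable_derive1 u :
  (forall x, 0 < x -> {for x, continuous u}) ->
  measurable_fun (`]0, +oo[ : set R) (derive1 u).
Proof.
move=> cu.
have -> : `]0, +oo[%classic = \bigcup_n `]n.+1%:R^-1, +oo[%classic :> set R.
  apply/seteqP; split => x /=; rewrite in_itv/= andbT.
    move=> x0; near \oo => n; exists n => //=; rewrite in_itv/= andbT.
    by near: n; exact: near_infty_natSinv_lt (PosNum x0).
  by move=> [n _] /=; rewrite in_itv/= andbT; apply: lt_trans; rewrite invr_gt0.
apply/measurable_fun_bigcup => // n.
set c : R := n.+1%:R^-1; have c0 : 0 < c by rewrite invr_gt0.
(* Continuous on the whole line, and equal to [u] near every point of []c, +oo[]. *)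
pose v (x : R) := u (Num.max x c).
have cv : continuous v.
  move=> x; apply: (@continuous_comp _ _ _ (fun x => Num.max x c)).
    by apply: (@continuous_max _ _ id (cst c)); [exact: cvg_id|exact: cst_continuous].
  by apply: cu; rewrite lt_max c0 orbT.
apply: (@eq_measurable_fun _ _ _ _ _ (derive1 v)); last first.
  by apply: measurable_funTS; exact: continuous_measurable_derive1T.
move=> x; rewrite inE/= in_itv/= andbT => cx.
rewrite !derive1E; apply: near_eq_derive.
near=> y; rewrite /v max_l//; apply: ltW.
by near: y; exact: lt_nbhsr.
Unshelve. all: by end_near. Qed.

End DerivativeMeasurable.

(** * Weighted integrals on the half-line *)

Section PowerIntegrals.
Context {R : realType}.
Implicit Types (a b g s theta x t : R).

Local Notation mu := (@lebesgue_measure R).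

Lemma integral_derive_gt0 (F f : R -> R) a b : 0 < a -> a < b ->
  (forall x, 0 < x -> is_derive x 1 F (f x)) ->
  (forall x, 0 < x -> {for x, continuous f}) ->
  (\int[mu]_(x in `]a, b[) (f x)%:E = (F b - F a)%:E)%E.
Proof.
move=> a0 ab dF cf.
have cF x : 0 < x -> {for x, continuous F}.
  move=> /dF[d _]; exact/differentiable_continuous/derivable1_diffP.
rewrite EFinB -(@continuous_FTC2 _ f F)//.
- rewrite [RHS]integral_itv_bndoo//; apply/measurable_EFinP.
  apply: open_continuous_measurable_fun => // x.
  by rewrite inE/= in_itv/= => /andP[ax _]; apply: cf; exact: lt_trans ax.
- apply: continuous_in_subspaceT => x; rewrite inE/= in_itv/= => /andP[ax _].
  by apply: cf; exact: lt_le_trans ax.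
- split.
  + by move=> x; rewrite in_itv/= => /andP[ax _]; have [] := dF x (lt_trans a0 ax).
  + exact/cvg_at_right_filter/cF.
  + by apply/cvg_at_left_filter/cF; exact: lt_trans ab.
- move=> x; rewrite in_itv/= => /andP[ax _]; rewrite derive1E.
  by have [_ ->] := dF x (lt_trans a0 ax).
Qed.

Lemma ge0_le_integral_EFin (D : set R) (f g : R -> R) : measurable D ->
  measurable_fun D f -> measurable_fun D g ->
  (forall x, D x -> 0 <= f x <= g x) ->
  (\int[mu]_(x in D) (f x)%:E <= \int[mu]_(x in D) (g x)%:E)%E.
Proof.
move=> mD mf mg fg; apply: ge0_le_integral => //.
- by move=> x /fg/andP[? _]; rewrite lee_fin.
- exact/measurable_EFinP.
- exact/measurable_EFinP.
- by move=> x /fg/andP[_ ?]; rewrite lee_fin.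
Qed.

Lemma powR_continuous_gt0 s x : 0 < x -> {for x, continuous (fun y : R => y `^ s)}.
Proof.
move=> x0; have [d _] := is_derive1_powR s x0.
exact/differentiable_continuous/derivable1_diffP.
Qed.

Lemma integral_powR_lty g b : -1 < g -> 0 < b ->
  (\int[mu]_(x in `]0%R, b[) (x `^ g)%:E < +oo)%E.
Proof.
move=> g1 b0; have g10 : 0 < g + 1 by lra.
pose F (n : nat) := `]b / n.+2%:R, b[%classic : set R.
have FU : `]0, b[%classic = \bigcup_n F n.
  apply/seteqP; split => x /=; rewrite /F ?in_itv/=.
    move=> /andP[x0 xb]; near \oo => n; exists n => //=; rewrite in_itv/= xb andbT.
    rewrite ltr_pdivrMr// mulrC -ltr_pdivrMr//.
    rewrite (@lt_le_trans _ _ n%:R)//; last by rewrite ler_nat !leqW.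
    by near: n; exact: nbhs_infty_gtr.
  move=> [n _] /=; rewrite in_itv/= => /andP[+ ->]; rewrite andbT; apply: lt_trans.
  by rewrite divr_gt0.
rewrite FU.
have cv : (\int[mu]_(x in F n) (x `^ g)%:E @[n --> \oo] -->
    \int[mu]_(x in \bigcup_n F n) (x `^ g)%:E)%E.
  apply: ge0_nondecreasing_set_cvg_integral => //.
  - move=> m n mn; apply/subsetPset/subset_itv; rewrite ?bnd_simp//.
    by rewrite ler_pM2l// lef_pV2 ?posrE// ler_nat !ltnS.
  - by move=> n; exact: measurable_itv.
  - move=> n; apply/measurable_EFinP; apply: measurable_funTS.
    exact: measurable_powR.
  - by move=> n x _; rewrite lee_fin powR_ge0.
rewrite -(cvg_lim _ cv)//.
apply: (@le_lt_trans _ _ (b `^ (g + 1) / (g + 1))%:E); last exact: ltry.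
apply: lime_le; first by apply/cvg_ex; eexists; exact: cv.
apply: nearW => n.
have bn0 : 0 < b / n.+2%:R by rewrite divr_gt0.
have dF x : 0 < x -> is_derive x 1 (fun x => x `^ (g + 1) / (g + 1)) (x `^ g).
  move=> x0; have := is_derive1_powR (g + 1) x0.
  rewrite addrK => d1.
  have -> : x `^ g = (g + 1)^-1 *: ((g + 1) * x `^ g).
    by rewrite /GRing.scale/= mulKf// gt_eqF.
  have -> : (fun x => x `^ (g + 1) / (g + 1)) = (g + 1)^-1 \*: (fun x => x `^ (g + 1)).
    by apply/funext => y; rewrite /= mulrC.
  exact: is_deriveZ.
have bnb : b / n.+2%:R < b by rewrite ltr_pdivrMr// ltr_pMr// ltr1n.
have := @integral_derive_gt0 _ _ _ _ bn0 bnb dF (@powR_continuous_gt0 g).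
by rewrite /F => ->; rewrite lee_fin gerBl divr_ge0 ?powR_ge0// ltW.
Unshelve. all: by end_near. Qed.

(** Below 1 the power alone is integrable; above 1 the integrand is at most a multiple of the
    exponential density of rate [2^-1]. *)
Lemma Gamma_integral_lty s : 0 < s ->
  (\int[mu]_(t in `]0%R, +oo[) (t `^ (s - 1) * expR (- t))%:E < +oo)%E.
Proof.
move=> s0.
have ms (D : set R) : measurable_fun D (fun t => (t `^ (s - 1) * expR (- t))%:E).
  apply/measurable_EFinP; apply: measurable_funTS; apply: measurable_funM.
    exact: measurable_powR.
  by apply: measurableT_comp => //; exact: measurableT_comp.
have ge0 t : (0 <= (t `^ (s - 1) * expR (- t))%:E)%E.
  by rewrite lee_fin mulr_ge0 ?powR_ge0 ?expR_ge0.
have -> : `]0, +oo[%classic = `]0, 1[%classic `|` `[1, +oo[%classic :> set R.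
  by rewrite -itv_bndbnd_setU// bnd_simp.
rewrite ge0_integral_setU//; last first.
  apply/disj_setPS => t [] /=; rewrite !in_itv/= => /andP[_ t1].
  by rewrite andbT leNgt t1.
  exact: ms.
apply: lte_add_pinfty.
  apply: (@le_lt_trans _ _ (\int[mu]_(t in `]0%R, 1%R[) (t `^ (s - 1))%:E)%E).
    apply: ge0_le_integral_EFin => //.
    - exact/measurable_EFinP.
    - by apply: measurable_funTS; exact: measurable_powR.
    - move=> t; rewrite /= in_itv/= => /andP[t0 _]; rewrite -lee_fin ge0/=.
      by rewrite ler_piMr ?powR_ge0// expR_le1 oppr_le0 ltW.
  by apply: integral_powR_lty => //; lra.
pose n := (Num.truncn s).+1.
(* One term of the series of [expR (t / 2)] gives [t ^+ n.+1 <= C * expR (t / 2)], and [n] exceeds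
   [s]. *)
pose C : R := 2 ^+ n.+1 * n.+1`!%:R.
have C0 : 0 < C by rewrite mulr_gt0 ?exprn_gt0 ?ltr0n ?fact_gt0.
have C20 : 0 <= C * 2 by apply: mulr_ge0 => //; exact: ltW.
have r0 : 0 <= 2^-1 :> R by [].
apply: (@le_lt_trans _ _ (\int[mu]_(t in `[1%R, +oo[)
    (C * 2 * exponential_pdf 2^-1 t)%:E)%E).
  apply: ge0_le_integral_EFin => //.
  - exact/measurable_EFinP.
  - apply: measurable_funTS; apply: measurable_funM => //.
    exact: measurable_exponential_pdf.
  - move=> t; rewrite /= in_itv/= andbT => t1; have t0 : 0 <= t by lra.
    rewrite -lee_fin ge0 exponential_pdfE//=.
    have -> : C * 2 * (2^-1 * expR (- 2^-1 * t)) = C * expR (t / 2) * expR (- t).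
      rewrite -[RHS]mulrA -expRD (_ : t / 2 + - t = - 2^-1 * t); last by lra.
      by field.
    rewrite ler_wpM2r ?expR_ge0//.
    apply: (@le_trans _ _ (t ^+ n.+1)).
      rewrite -powR_mulrn//; apply: ler_powR => //.
      rewrite -addn1 natrD; have := truncnS_gt s; rewrite -/n; lra.
    have t2 : 0 <= t / 2 by lra.
    have := expR_ge1Dxn n t2; rewrite expr_div_n => h.
    rewrite -ler_pdivrMl// /C invfM mulrC mulrA.
    by apply: le_trans h; rewrite lerDr.
under eq_integral do rewrite EFinM.
rewrite ge0_integralZl//.
- apply: lte_mul_pinfty; [exact: C20|by []|].
  apply: (@le_lt_trans _ _ (\int[mu]_t (exponential_pdf 2^-1 t)%:E)%E).
    apply: ge0_subset_integral => //.
      by apply/measurable_EFinP; exact: measurable_exponential_pdf.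
    by move=> t _; rewrite lee_fin exponential_pdf_ge0.
  by rewrite integral_exponential_pdf ?ltry.
- by apply/measurable_EFinP; apply: measurable_funTS; exact: measurable_exponential_pdf.
- by move=> t _; rewrite lee_fin exponential_pdf_ge0.
Qed.

Lemma Gamma_gt0 s : 0 < s -> 0 < Gamma s.
Proof.
move=> s0; rewrite /Gamma /Rintegral fine_gt0// Gamma_integral_lty// andbT.
have ms (D : set R) : measurable_fun D (fun t => (t `^ (s - 1) * expR (- t))%:E).
  apply/measurable_EFinP; apply: measurable_funTS; apply: measurable_funM.
    exact: measurable_powR.
  by apply: measurableT_comp => //; exact: measurableT_comp.
have ge0 t : (0 <= (t `^ (s - 1) * expR (- t))%:E)%E.
  by rewrite lee_fin mulr_ge0 ?powR_ge0 ?expR_ge0.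
rewrite lt_neqAle integral_ge0 ?andbT//; apply/negP => /eqP I0.
have : (\int[mu]_(t in `]0%R, +oo[) `|(t `^ (s - 1) * expR (- t))%:E| = 0)%E.
  by under eq_integral do rewrite gee0_abs//; rewrite -I0.
move=> /ae_eq_integral_abs => /(_ (measurable_itv _) (ms _))[N [mN N0 sub]].
have : (mu `]0%R, +oo[ <= mu N)%E.
  apply: le_measure; rewrite ?inE// => t t0; apply: sub => /= /(_ t0).
  by move: t0; rewrite /= in_itv/= andbT => t0 [] /eqP; rewrite mulf_eq0 !gt_eqF ?powR_gt0 ?expR_gt0.
by rewrite N0 lebesgue_measure_itv/= ltry.
Qed.

Lemma omega_gt0 theta : 0 <= theta -> 0 < omega theta.
Proof.
move=> t0; have s0 : 0 < (theta + 1) / 2 by rewrite divr_gt0// ltr_pwDr.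
by rewrite /omega divr_gt0 ?Gamma_gt0// mulr_gt0// powR_gt0// pi_gt0.
Qed.

End PowerIntegrals.

(** * Change of scale and integration against [lambda_theta] *)

Section WeightedIntegral.
Context {R : realType}.
Implicit Types (l : R) (f : R -> R).

Local Notation mu := (@lebesgue_measure R).

(** Lebesgue measure is [l] times its image under [r |-> l * r], since the two agree on half-open
    intervals. *)
Lemma integral_dilation l f : 0 < l -> measurable_fun (`]0, +oo[ : set R) f ->
  (forall r, 0 < r -> 0 <= f r) ->
  (\int[mu]_(r in `]0%R, +oo[) (f r)%:E =
   l%:E * \int[mu]_(r in `]0%R, +oo[) (f (l * r))%:E)%E.
Proof.
move=> l0 mf f0.
have mphi : measurable_fun setT (fun r : measurableTypeR R => l * r : measurableTypeR R).
  by apply: measurable_funM => //; exact: measurable_cst.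
have lb : (0 <= l)%R by exact: ltW.
pose pf := measure_function_pushforward__canonical__measure_function_Measure mu mphi.
pose m := mscale (NngNum lb) pf.
have mE (D : set (measurableTypeR R)) : measurable D -> mu D = m D.
  apply: lebesgue_measure_unique => X [[x y] _ <-] /=.
  rewrite /m /mscale/= /pushforward.
  have -> : (fun r : R => l * r) @^-1` `]x, y]%classic = `](x / l), (y / l)]%classic :> set R.
    by apply/seteqP; split => r /=; rewrite !in_itv/= ltr_pdivrMr// ler_pdivlMr// mulrC.
  rewrite !lebesgue_measure_itv/= !lte_fin ltr_pM2r ?invr_gt0//.
  case: ifPn => _; last by rewrite mule0.
  by rewrite -!EFinB -EFinM mulrBr ![l * _]mulrC !divfK ?gt_eqF.
have mEf : measurable_fun (`]0, +oo[ : set (measurableTypeR R)) (EFin \o f).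
  by apply/measurable_EFinP.
rewrite (eq_measure_integral m) => [|D mD _]; last exact: mE.
rewrite ge0_integral_mscale//=; last by move=> r; rewrite in_itv/= andbT => r0; rewrite lee_fin f0.
congr (_ * _)%E.
rewrite (ge0_integral_pushforward mphi mu _ mEf)//; last first.
  by move=> r; rewrite inE/= in_itv/= andbT => r0; rewrite lee_fin f0.
congr (integral _ _ _); apply/seteqP; split => r /=; rewrite !in_itv/= !andbT pmulr_rgt0//.
Qed.

End WeightedIntegral.

Section IntLambda.
Context {R : realType}.
Variable theta : R.
Hypothesis theta0 : 0 <= theta.
Implicit Types (a c l r : R) (f g h : R -> R).

Local Notation mu := (@lebesgue_measure R).

Definition nnmeasurable f :=
  measurable_fun (`]0, +oo[ : set R) f /\ forall r, 0 < r -> 0 <= f r.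

Lemma weight_ge0 r : 0 <= omega theta * r `^ theta.
Proof. by rewrite mulr_ge0 ?powR_ge0 ?ltW ?omega_gt0. Qed.

Lemma weight_gt0 r : 0 < r -> 0 < omega theta * r `^ theta.
Proof. by move=> r0; rewrite mulr_gt0 ?powR_gt0 ?omega_gt0. Qed.

Lemma measurable_weight (D : set R) : measurable_fun D (fun r => omega theta * r `^ theta).
Proof. by apply: measurable_funTS; apply: measurable_funM => //; exact: measurable_powR. Qed.

Lemma nnmeasurableD f g : nnmeasurable f -> nnmeasurable g ->
  nnmeasurable (fun r => f r + g r).
Proof.
by move=> [mf f0] [mg g0]; split; [exact: measurable_funD|move=> r r0; rewrite addr_ge0 ?f0 ?g0].
Qed.

Lemma nnmeasurableZ c f : 0 <= c -> nnmeasurable f -> nnmeasurable (fun r => c * f r).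
Proof.
by move=> c0 [mf f0]; split; [exact: measurable_funM|move=> r r0; rewrite mulr_ge0 ?f0].
Qed.

Lemma nnmeasurable_patch c f : nnmeasurable f ->
  nnmeasurable (fun r => if r < c then f r else 0).
Proof.
move=> [mf f0]; split; last by move=> r r0; case: ifPn => // _; exact: f0.
apply: measurable_fun_if => //.
- by apply: measurable_funTS; apply: measurable_fun_ltr.
- by apply: measurable_funS mf => // r [].
Qed.

Lemma nnmeasurable_weight f : nnmeasurable f ->
  nnmeasurable (fun r => f r * (omega theta * r `^ theta)).
Proof.
move=> [mf f0]; split; first by apply: measurable_funM => //; exact: measurable_weight.
by move=> r r0; rewrite mulr_ge0 ?f0 ?weight_ge0.
Qed.

Lemma nnmeasurable_EFin f : nnmeasurable f ->
  measurable_fun (`]0, +oo[ : set (measurableTypeR R)) (EFin \o f) /\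
  forall r, `]0%R, +oo[%classic r -> (0 <= (f r)%:E)%E.
Proof.
move=> [mf f0]; split; first exact/measurable_EFinP.
by move=> r; rewrite /= in_itv/= andbT lee_fin; exact: f0.
Qed.

Lemma int_lambdaE f : nnmeasurable f -> int_lambda theta f =
  (\int[mu]_(r in `]0%R, +oo[) (f r * (omega theta * r `^ theta))%:E)%E.
Proof.
move=> nf; have nfw : nnmeasurable (fun r => f r * r `^ theta).
  case: nf => mf f0; split.
    by apply: measurable_funM => //; apply: measurable_funTS; exact: measurable_powR.
  by move=> r r0; rewrite mulr_ge0 ?f0 ?powR_ge0.
have [m0 g0] := nnmeasurable_EFin nfw.
rewrite /int_lambda -ge0_integralZl//; last by rewrite lee_fin ltW// omega_gt0.
by apply: eq_integral => r _; rewrite -EFinM mulrCA.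
Qed.

Lemma int_lambda_ge0 f : (forall r, 0 < r -> 0 <= f r) -> (0 <= int_lambda theta f)%E.
Proof.
move=> f0; rewrite /int_lambda; apply: mule_ge0.
  by rewrite lee_fin ltW// omega_gt0.
by apply: integral_ge0 => r; rewrite /= in_itv/= andbT => r0; rewrite lee_fin mulr_ge0 ?f0 ?powR_ge0.
Qed.

Lemma eq_int_lambda f g : (forall r, 0 < r -> f r = g r) ->
  int_lambda theta f = int_lambda theta g.
Proof.
move=> fg; rewrite /int_lambda; congr (_ * _)%E; apply: eq_integral => r.
by rewrite inE/= in_itv/= andbT => /fg ->.
Qed.

Lemma le_int_lambda f g : nnmeasurable f -> nnmeasurable g ->
  (forall r, 0 < r -> f r <= g r) -> (int_lambda theta f <= int_lambda theta g)%E.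
Proof.
move=> nf ng fg; rewrite !int_lambdaE//.
have [mf f0] := nnmeasurable_weight nf; have [mg g0] := nnmeasurable_weight ng.
apply: ge0_le_integral_EFin => // r; rewrite /= in_itv/= andbT => r0.
by rewrite f0//= ler_wpM2r ?weight_ge0 ?fg.
Qed.

Lemma int_lambdaD f g : nnmeasurable f -> nnmeasurable g ->
  int_lambda theta (fun r => f r + g r) = (int_lambda theta f + int_lambda theta g)%E.
Proof.
move=> nf ng; rewrite !int_lambdaE//; last exact: nnmeasurableD.
have [mf f0] := nnmeasurable_EFin (nnmeasurable_weight nf).
have [mg g0] := nnmeasurable_EFin (nnmeasurable_weight ng).
rewrite -ge0_integralD//.
by apply: eq_integral => r _; rewrite mulrDl EFinD.
Qed.

Lemma int_lambdaZ c f : 0 <= c -> nnmeasurable f ->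
  int_lambda theta (fun r => c * f r) = (c%:E * int_lambda theta f)%E.
Proof.
move=> c0 nf; rewrite !int_lambdaE//; last exact: nnmeasurableZ.
have [mf f0] := nnmeasurable_EFin (nnmeasurable_weight nf).
rewrite -ge0_integralZl//.
by apply: eq_integral => r _; rewrite -mulrA EFinM.
Qed.

(** Fatou's lemma with the lower limit replaced by eventual bounds [a + e], so that no convergence
    of the integrals is presupposed. *)
Lemma int_lambda_fatou (f_ : nat -> R -> R) f a :
  (forall n, nnmeasurable (f_ n)) ->
  (forall r, 0 < r -> f_ n r @[n --> \oo] --> f r) ->
  (forall e, 0 < e -> \forall n \near \oo, (int_lambda theta (f_ n) <= (a + e)%:E)%E) ->
  nnmeasurable f /\ (int_lambda theta f <= a%:E)%E.
Proof.
move=> nf_ cvf bnd.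
have nf : nnmeasurable f.
  split.
    apply: (@measurable_fun_cvg _ _ _ _ f_); first by move=> n; have [] := nf_ n.
    by move=> r; rewrite /= in_itv/= andbT => /cvf.
  move=> r r0; rewrite -(cvg_lim _ (cvf r r0))//; apply: limr_ge; first by apply/cvg_ex; exists (f r); exact: cvf.
  by apply: nearW => n; have [_ ->] := nf_ n.
split => //; apply/lee_addgt0Pr => e e0; rewrite -EFinD.
have cvw r : `]0%R, +oo[%classic r ->
    (f_ n r * (omega theta * r `^ theta))%:E @[n --> \oo] --> (f r * (omega theta * r `^ theta))%:E.
  rewrite /= in_itv/= andbT => r0; apply: cvg_EFin; first exact: nearW.
  by apply: cvgMl; exact: cvf.
rewrite int_lambdaE//.
have m_ n := nnmeasurable_EFin (nnmeasurable_weight (nf_ n)).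
rewrite (_ : (\int[mu]_(r in `]0%R, +oo[) (f r * (omega theta * r `^ theta))%:E =
  \int[mu]_(r in `]0%R, +oo[)
    limn_einf (fun n => (f_ n r * (omega theta * r `^ theta))%:E))%E); last first.
  apply: eq_integral => r; rewrite inE => /cvw rE.
  by rewrite is_cvg_limn_einfE; [exact/esym/cvg_lim|apply/cvg_ex; eexists; exact: rE].
apply: (le_trans (@fatou _ _ _ mu _ (measurable_itv _)
  (fun n r => (f_ n r * (omega theta * r `^ theta))%:E) (fun n => (m_ n).1) (fun n => (m_ n).2))).
have [N _ HN] := bnd e e0.
rewrite limn_einf_lim.
apply: lime_le; first exact: is_cvg_einfs.
exists N => // n Nn; apply: (@le_trans _ _ (int_lambda theta (f_ n))); last exact: HN.
apply: ereal_inf_lbound; exists n => //=.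
by rewrite int_lambdaE.
Qed.

Lemma int_lambda_dominated (f_ : nat -> R -> R) f h :
  (forall n, nnmeasurable (f_ n)) -> nnmeasurable h ->
  (forall r, 0 < r -> f_ n r @[n --> \oo] --> f r) ->
  (forall n r, 0 < r -> f_ n r <= h r) ->
  (int_lambda theta h < +oo)%E ->
  int_lambda theta (f_ n) @[n --> \oo] --> int_lambda theta f.
Proof.
move=> nf_ nh cvf fh hoo.
have nf : nnmeasurable f.
  split.
    apply: (@measurable_fun_cvg _ _ _ _ f_); first by move=> n; have [] := nf_ n.
    by move=> r; rewrite /= in_itv/= andbT => /cvf.
  move=> r r0; rewrite -(cvg_lim _ (cvf r r0))//; apply: limr_ge; first by apply/cvg_ex; exists (f r); exact: cvf.
  by apply: nearW => n; have [_ ->] := nf_ n.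
have m_ n := nnmeasurable_EFin (nnmeasurable_weight (nf_ n)).
have [mh h0] := nnmeasurable_EFin (nnmeasurable_weight nh).
rewrite int_lambdaE//; under eq_fun do rewrite int_lambdaE//.
apply: (@dominated_cvg _ _ _ mu _ _
  (fun n r => (f_ n r * (omega theta * r `^ theta))%:E) _
  (fun r => (h r * (omega theta * r `^ theta))%:E)) => //.
- by move=> n; have [] := m_ n.
- move=> r; rewrite /= in_itv/= andbT => r0; apply: cvg_EFin; first exact: nearW.
  by apply: cvgMl; exact: cvf.
- apply/integrableP; split => //.
  move: hoo; rewrite int_lambdaE//; congr (_ < _)%E; apply: eq_integral => r.
  by rewrite inE => /h0 ?; rewrite gee0_abs.
- move=> n r rA; rewrite gee0_abs; last by have [_ ->] := m_ n.
  rewrite lee_fin ler_wpM2r ?weight_ge0// fh//.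
  by move: rA; rewrite /= in_itv/= andbT.
Qed.

Lemma nnmeasurable_dilation l f : 0 < l -> nnmeasurable f ->
  nnmeasurable (fun r => f (l * r)).
Proof.
move=> l0 nf; split; last by move=> r r0; have [_ ->//] := nf; rewrite mulr_gt0.
apply: (@measurable_comp _ _ _ _ _ _ (`]0, +oo[ : set R) f (`]0, +oo[ : set R) (fun r => l * r)).
- exact: measurable_itv.
- move=> _ [r + <-]; rewrite /= !in_itv/= !andbT => r0; exact: mulr_gt0.
- by have [] := nf.
- exact: measurable_funM.
Qed.

Lemma int_lambda_dilation l f : 0 < l -> nnmeasurable f ->
  int_lambda theta (fun r => f (l * r)) = ((l `^ (- (theta + 1)))%:E * int_lambda theta f)%E.
Proof.
move=> l0 nf.
have nfl := nnmeasurable_dilation l0 nf.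
rewrite !int_lambdaE//.
have [mf f0] := nnmeasurable_weight nf.
rewrite (integral_dilation l0 mf f0) muleA -EFinM.
have [mfl fl0] := nnmeasurable_EFin (nnmeasurable_dilation l0 (nnmeasurable_weight nf)).
rewrite -ge0_integralZl//; last by rewrite lee_fin mulr_ge0 ?powR_ge0 ?ltW.
apply: eq_integral => r; rewrite inE/= in_itv/= andbT => r0.
rewrite -EFinM; congr EFin; rewrite powRM ?ltW// powRN powRD; last by apply/implyP => _; rewrite gt_eqF.
rewrite powRr1 ?ltW//; field.
by rewrite !gt_eqF// powR_gt0.
Qed.

(** Only zero sets matter: a nonnegative function of integral 0 vanishes almost everywhere, and the
    weight is positive. *)
Lemma int_lambda_eq0 f g : nnmeasurable f -> nnmeasurable g ->
  (forall r, 0 < r -> f r = 0 -> g r = 0) ->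
  int_lambda theta f = 0%E -> int_lambda theta g = 0%E.
Proof.
move=> nf ng fg; rewrite !int_lambdaE// => f0.
have [mf f0'] := nnmeasurable_EFin (nnmeasurable_weight nf).
have [mg g0'] := nnmeasurable_EFin (nnmeasurable_weight ng).
have : (\int[mu]_(r in `]0%R, +oo[) `|(f r * (omega theta * r `^ theta))%:E| = 0)%E.
  by rewrite -f0; apply: eq_integral => r; rewrite inE => /f0' ?; rewrite gee0_abs.
move=> /ae_eq_integral_abs-/(_ (measurable_itv _) mf) ae0.
have : (\int[mu]_(r in `]0%R, +oo[) `|(g r * (omega theta * r `^ theta))%:E| = 0)%E.
  apply/ae_eq_integral_abs => //.
  apply: (@filterS _ _ (ae_filter_ringOfSetsType mu)) ae0 => r /= + rA.
  move=> /(_ rA) [] /eqP; move: rA; rewrite in_itv/= andbT => r0.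
  by rewrite mulf_eq0 (gt_eqF (weight_gt0 r0)) orbF => /eqP/fg ->//; rewrite mul0r.
by move=> <-; apply: eq_integral => r; rewrite inE => /g0' ?; rewrite gee0_abs.
Qed.

End IntLambda.

(** * Logarithmic estimates and difference quotients *)

Section Energy.
Context {R : realType}.
Implicit Types (p q alpha theta c r s : R) (u : R -> R).

Local Notation mu := (@lebesgue_measure R).

Definition energy p theta u := int_lambda theta (fun r => `|u r| `^ p).

Lemma nnmeasurable_powR p u : measurable_fun (`]0, +oo[ : set R) u ->
  nnmeasurable (fun r => `|u r| `^ p).
Proof.
move=> mu'; split; last by move=> r _; exact: powR_ge0.
apply: (@measurableT_comp _ _ _ _ _ _ (fun x : R => x `^ p)).
  exact: measurable_powR.
exact: measurableT_comp.
Qed.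

Lemma energy_ge0 p theta u : 0 <= theta -> (0 <= energy p theta u)%E.
Proof. by move=> t0; apply: int_lambda_ge0 => // r _; exact: powR_ge0. Qed.

Lemma Lnorm_lambda_poweR p theta u : 0 < p -> 0 <= theta ->
  (Lnorm_lambda p theta u `^ p)%E = energy p theta u.
Proof.
move=> p0 t0; rewrite /Lnorm_lambda -poweRrM mulVf ?gt_eqF// poweRe1//.
exact: energy_ge0.
Qed.

Definition unit_ball p alpha theta u :=
  X1p p alpha theta u /\ (Xnorm p alpha theta u <= 1)%E.

(** Raising to the power [p] removes the roots from the norm; the bound on the sum also yields the
    finiteness of the two norms in [X1p]. *)
Lemma unit_ballP p alpha theta u : 0 < p -> 0 <= alpha -> 0 <= theta ->
  unit_ball p alpha theta u <->
  [/\ loc_abs_continuous u, u r @[r --> +oo] --> 0,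
     measurable_fun (`]0, +oo[ : set R) u,
     measurable_fun (`]0, +oo[ : set R) (derive1 u) &
     (energy p theta u + energy p alpha (derive1 u) <= 1)%E].
Proof.
move=> p0 a0 t0; have pV : 0 < p^-1 by rewrite invr_gt0.
have Jge := energy_ge0 p u t0; have Dge := energy_ge0 p (derive1 u) a0.
have JDge := adde_ge0 Jge Dge.
have fin f x : (Lnorm_lambda p x f < +oo)%E = (energy p x f < +oo)%E.
  rewrite /Lnorm_lambda -/(energy p x f).
  apply/idP/idP; last exact: poweR_lty.
  by apply: lty_poweRy; rewrite gt_eqF.
have normE : (Xnorm p alpha theta u <= 1)%E <->
    (energy p theta u + energy p alpha (derive1 u) <= 1)%E.
  have -> : Xnorm p alpha theta u =
      ((energy p theta u + energy p alpha (derive1 u)) `^ p^-1)%E.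
    by congr (_ `^ _)%E; congr (_ + _)%E; exact: Lnorm_lambda_poweR.
  set x := (_ + _)%E in JDge *; split => x1.
    have : ((x `^ p^-1) `^ p <= 1 `^ p)%E.
      apply: gt0_ler_poweR => //; first exact: ltW.
        by rewrite in_itv/= poweR_ge0 leey.
      by rewrite in_itv/= lee01 leey.
    by rewrite -poweRrM mulVf ?gt_eqF// poweRe1// poweR1r.
  rewrite -(poweR1r p^-1); apply: gt0_ler_poweR => //; first exact: ltW.
    by rewrite in_itv/= JDge leey.
  by rewrite in_itv/= lee01 leey.
split.
  by move=> [[h1 h2 [h3 _] [h4 _]] /normE h5].
move=> [h1 h2 h3 h4 h5]; split; last exact/normE.
split=> //; split=> //; rewrite fin; apply: le_lt_trans (ltry 1); apply: le_trans h5.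
  by apply: leeDl; exact: Dge.
by apply: leeDr; exact: Jge.
Qed.

Lemma loc_ac_continuous u x : loc_abs_continuous u -> 0 < x -> {for x, continuous u}.
Proof.
move=> ac x0; apply/cvgrPdist_lt => e e0.
have [x20 x2x] : 0 < x / 2 /\ x / 2 <= x + 1 by lra.
have [d d0 H] := ac (x / 2) (x + 1) x20 x2x e e0.
near=> y.
have [yx1 yx2] : x / 2 <= y /\ y <= x + 1.
  by split; apply/ltW; near: y; [apply: lt_nbhsr|apply: lt_nbhsl]; lra.
have dxy : `|x - y| < d by near: y; apply/nbhs_ballP; exists d.
case: (leP x y) => xy.
  have := H 1%N (fun=> x) (fun=> y); rewrite !big_ord1 => h; rewrite distrC; apply: h.
  - by move=> _; rewrite xy; split; [lra|split; lra].
  - by move=> i j; rewrite !ord1.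
  - by rewrite distrC ger0_norm ?subr_ge0// in dxy.
have := H 1%N (fun=> y) (fun=> x); rewrite !big_ord1; apply.
- by move=> _; split; [lra|split; lra].
- by move=> i j; rewrite !ord1.
- by rewrite gtr0_norm ?subr_gt0// in dxy.
Unshelve. all: by end_near. Qed.

Lemma integral_inv r s : 0 < r -> r < s ->
  (\int[mu]_(x in `]r, s[) (x^-1)%:E = (ln (s / r))%:E)%E.
Proof.
move=> r0 rs; rewrite (@integral_derive_gt0 _ (@ln R) (fun x => x^-1))//.
  by rewrite ln_div ?posrE// (lt_trans r0).
by move=> x x0; apply: cvgV => //; rewrite gt_eqF.
Qed.

(** Young's inequality for the factors [c |u'| x^(1/q)] and [c^-1 x^(-1/q)], where [p / q = p - 1]
    produces the weight. The parameter [c] stays free: [log_hoelder] optimizes it, while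
    [ac_sum_bound] keeps the same value on all intervals. *)
Lemma young_log_bound p q c r s (E : R) u : 1 < p -> p^-1 + q^-1 = 1 -> 0 < c ->
  0 < r -> r < s -> loc_abs_continuous u ->
  measurable_fun (`]0, +oo[ : set R) (derive1 u) ->
  (\int[mu]_(x in `]r, s[) (`|derive1 u x| `^ p * x `^ (p - 1))%:E <= E%:E)%E ->
  `|u s - u r| <= c `^ p / p * E + c `^ (- q) / q * ln (s / r).
Proof.
move=> p1 pq c0 r0 rs ac mu' bE; have p0 : 0 < p by lra.
have rsA : (`]r, s[ `<=` `]0, +oo[)%classic.
  by move=> x /=; rewrite !in_itv/= andbT => /andP[+ _]; exact: lt_trans.
have q0 : 0 < q.
  by have p11 : p^-1 < 1 by [rewrite invf_lt1]; rewrite -invr_gt0; lra.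
rewrite -lee_fin; apply: (le_trans (ac_le_integral_derive1 rs _ _)).
- exact: ac (ltW rs).
- exact: measurable_funS mu'.
have mD : measurable_fun (`]r, s[ : set R) (fun x => `|derive1 u x| `^ p * x `^ (p - 1)).
  apply: measurable_funM; last by apply: measurable_funTS; exact: measurable_powR.
  by apply: measurable_funS (nnmeasurable_powR p mu').1.
have mV : measurable_fun (`]r, s[ : set R) (fun x => x^-1 : R).
  apply: open_continuous_measurable_fun => // x.
  rewrite inE => /rsA; rewrite /= in_itv/= andbT => x0.
  by apply: cvgV => //; rewrite gt_eqF.
have e1 : 0 <= c `^ p / p by rewrite divr_ge0 ?powR_ge0 ?ltW.
have e2 : 0 <= c `^ (- q) / q by rewrite divr_ge0 ?powR_ge0 ?ltW.
apply: (@le_trans _ _ (\int[mu]_(x in `]r, s[)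
    (c `^ p / p * (`|derive1 u x| `^ p * x `^ (p - 1)) + c `^ (- q) / q * x^-1)%:E)%E).
  apply: ge0_le_integral_EFin => //.
  - by apply: measurableT_comp => //; exact: measurable_funS mu'.
  - by apply: measurable_funD; apply: measurable_funM.
  move=> x /rsA; rewrite /= in_itv/= andbT => x0; rewrite normr_ge0/=.
  have := @conjugate_powR R (c * `|derive1 u x| * x `^ q^-1) (c^-1 * (x `^ q^-1)^-1) p q.
  rewrite !mulr_ge0 ?invr_ge0 ?powR_ge0 ?(ltW c0)// => /(_ isT isT p0 q0 pq).
  rewrite (_ : _ * _ * _ * (_ * _) = `|derive1 u x|); last first.
    by field; rewrite !gt_eqF// powR_gt0.
  move=> /le_trans; apply; apply: lerD.
    rewrite !powRM ?mulr_ge0 ?powR_ge0 ?(ltW c0)// -powRrM.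
    rewrite (_ : q^-1 * p = p - 1); first by rewrite le_eqVlt; apply/orP; left; apply/eqP; field; rewrite gt_eqF.
    have -> : q^-1 = 1 - p^-1 by lra.
    by rewrite mulrBl mul1r mulVf ?gt_eqF.
  rewrite powRM ?invr_ge0 ?powR_ge0 ?(ltW c0)//.
  rewrite -(powR_inv1 (ltW c0)) -(powR_inv1 (powR_ge0 x q^-1)) -!powRrM !mulN1r.
  rewrite mulrN mulVf ?gt_eqF//.
  by rewrite powR_inv1 ?(ltW x0)// mulrAC lexx.
have nn x : `]r, s[%classic x -> (0 <= (`|derive1 u x| `^ p * x `^ (p - 1))%:E)%E.
  by move=> _; rewrite lee_fin mulr_ge0 ?powR_ge0.
have nv x : `]r, s[%classic x -> (0 <= (x^-1)%:E)%E.
  by move=> /rsA; rewrite /= in_itv/= andbT => x0; rewrite lee_fin invr_ge0 ltW.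
have mD' : measurable_fun (`]r, s[ : set (measurableTypeR R))
    (fun x => (`|derive1 u x| `^ p * x `^ (p - 1))%:E) by exact/measurable_EFinP.
have mV' : measurable_fun (`]r, s[ : set (measurableTypeR R)) (fun x => (x^-1)%:E).
  exact/measurable_EFinP.
under eq_integral do rewrite EFinD !(EFinM (_ / _)).
rewrite ge0_integralD//; last 4 first.
- by move=> x rx; rewrite mule_ge0 ?nn.
- exact: measurable_funeM.
- by move=> x rx; rewrite mule_ge0 ?nv.
- exact: measurable_funeM.
rewrite !ge0_integralZl// integral_inv// EFinD !(EFinM (_ / _)).
by apply: leeD => //; rewrite lee_wpmul2l.
Qed.

End Energy.

Section LocalBounds.
Context {R : realType}.
Implicit Types (e M r s x : R) (u : R -> R).

Local Notation mu := (@lebesgue_measure R).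

Lemma log_hoelder p q r s (E : R) u : 1 < p -> p^-1 + q^-1 = 1 -> 0 <= E ->
  0 < r -> r < s -> loc_abs_continuous u ->
  measurable_fun (`]0, +oo[ : set R) (derive1 u) ->
  (\int[mu]_(x in `]r, s[) (`|derive1 u x| `^ p * x `^ (p - 1))%:E <= E%:E)%E ->
  `|u s - u r| <= E `^ p^-1 * ln (s / r) `^ q^-1.
Proof.
move=> p1 pq E0 r0 rs ac mu' bE; have p0 : 0 < p by lra.
have q0 : 0 < q by have p11 : p^-1 < 1 by [rewrite invf_lt1]; rewrite -invr_gt0; lra.
set L := ln (s / r); have L0 : 0 < L by rewrite ln_gt0// ltr_pdivlMr// mul1r.
have key (e : R) : 0 < e -> E <= e -> `|u s - u r| <= e `^ p^-1 * L `^ q^-1.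
  move=> e0 Ee.
  have be : (\int[mu]_(x in `]r, s[) (`|derive1 u x| `^ p * x `^ (p - 1))%:E <= e%:E)%E.
    by apply: le_trans bE _; rewrite lee_fin.
  pose a := ln e; pose b := ln L.
  have eE : e = expR a by rewrite lnK.
  have LE : L = expR b by rewrite lnK.
  (* The optimal parameter [c = (L / e)^(1 / (p q))] makes [c^p e] and [c^(-q) L] both equal to
     [e^(1/p) L^(1/q)]. *)
  have := young_log_bound p1 pq (expR_gt0 ((b - a) / (p * q))) r0 rs ac mu' be.
  move/le_trans; apply; rewrite -/L eE LE -!expRM.
  rewrite -expRD le_eqVlt; apply/orP; left; apply/eqP.
  rewrite mulrAC (mulrAC (expR _) q^-1) -!expRD.
  have -> : (b - a) / (p * q) * p + a = a / p + b / q.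
    have -> : (b - a) / (p * q) * p = (b - a) / q by field; rewrite !gt_eqF.
    have -> : p^-1 = 1 - q^-1 by lra.
    by lra.
  have -> : (b - a) / (p * q) * - q + b = a / p + b / q.
    have -> : (b - a) / (p * q) * - q = (a - b) / p by field; rewrite !gt_eqF.
    have -> : q^-1 = 1 - p^-1 by lra.
    by lra.
  by rewrite -mulrDr pq mulr1.
(* For [E = 0] there is no optimal [c]. Every [e > 0] is allowed instead, and the [e] with
   [e^(1/p) L^(1/q) = d / 2] contradicts [d > 0]. *)
move: E0; rewrite le_eqVlt => /predU1P[E0|E0]; last exact: key.
rewrite -E0 powR0 ?invr_neq0 ?gt_eqF// mul0r leNgt; apply/negP => d0.
have Y0 : 0 < L `^ q^-1 by rewrite powR_gt0.
set d := `|u s - u r| in d0 key.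
have e0 : 0 < d / (2 * L `^ q^-1) by rewrite divr_gt0// mulr_gt0.
have := key ((d / (2 * L `^ q^-1)) `^ p) (powR_gt0 _ e0).
rewrite -E0 powR_ge0 -powRrM mulfV ?gt_eqF// powRr1 ?(ltW e0)// => /(_ isT).
have -> : d / (2 * L `^ q^-1) * L `^ q^-1 = d / 2 by field; rewrite gt_eqF.
by lra.
Qed.

Lemma energy_interval p (M : R) r s u : 0 <= p - 1 -> 0 < r ->
  measurable_fun (`]0, +oo[ : set R) (derive1 u) ->
  (energy p (p - 1) (derive1 u) <= M%:E)%E ->
  (\int[mu]_(x in `]r, s[) (`|derive1 u x| `^ p * x `^ (p - 1))%:E
     <= (M / omega (p - 1))%:E)%E.
Proof.
move=> p1 r0 mu' D1; have w0 := omega_gt0 p1.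
rewrite mulrC EFinM lee_pdivlMl//.
apply: le_trans D1; rewrite /energy /int_lambda; apply: lee_wpmul2l.
  by rewrite lee_fin ltW.
apply: ge0_subset_integral => //.
- apply/measurable_EFinP; apply: measurable_funM (nnmeasurable_powR p mu').1 _.
  by apply: measurable_funTS; exact: measurable_powR.
- by move=> x _; rewrite lee_fin mulr_ge0 ?powR_ge0.
- by move=> x /=; rewrite !in_itv/= andbT => /andP[+ _]; exact: lt_trans.
Qed.

End LocalBounds.

(** * Sums over disjoint intervals and energies of difference quotients *)

Section EnergyInequalities.
Context {R : realType}.
Implicit Types (c h M r x t : R) (u : R -> R).

Local Notation mu := (@lebesgue_measure R).

(** The first term sees only the energy bound [M], not the number of intervals; the estimate is thus
    uniform over all [u] of energy at most [M] and survives pointwise limits. *)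
Lemma ac_sum_bound p q c M u : 2 <= p -> p^-1 + q^-1 = 1 -> 0 < q -> 0 < c ->
  loc_abs_continuous u -> measurable_fun (`]0, +oo[ : set R) (derive1 u) ->
  (energy p (p - 1) (derive1 u) <= M%:E)%E ->
  forall (n : nat) (l r : 'I_n -> R), (forall i, 0 < l i /\ l i <= r i) ->
  trivIset setT (fun i => `]l i, r i[%classic) ->
  \sum_(i < n) `|u (r i) - u (l i)| <=
    c `^ p / p * (M / omega (p - 1)) + c `^ (- q) / q * \sum_(i < n) ln (r i / l i).
Proof.
move=> p2 pq q0 c0 ac mu' DM n l r lr dis.
have p0 : 0 < p by lra. have p10 : 0 <= p - 1 by lra.
pose F i := (`]l i, r i[%classic : set R).
pose f x := `|derive1 u x| `^ p * x `^ (p - 1).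
have nf : nnmeasurable f.
  split; last by move=> x _; rewrite mulr_ge0 ?powR_ge0.
  apply: measurable_funM (nnmeasurable_powR p mu').1 _.
  by apply: measurable_funTS; exact: measurable_powR.
have [mf f0] := nnmeasurable_EFin nf.
have FA i : F i `<=` `]0, +oo[.
  move=> x /=; rewrite !in_itv/= andbT => /andP[+ _]; apply: lt_trans; exact: (lr i).1.
have mF i : measurable (F i : set (measurableTypeR R)) by exact: measurable_itv.
have D_A : \big[setU/set0]_(i <- index_enum 'I_n) F i `<=` `]0, +oo[.
  by move=> x; rewrite -bigcup_seq => -[i _]; exact: FA.
have sumE : (\sum_(i < n) \int[mu]_(x in F i) (f x)%:E <= (M / omega (p - 1))%:E)%E.
  rewrite -(@ge0_integral_bigsetU _ _ _ mu _ F (EFin \o f))//.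
  - apply: le_trans (_ : \int[mu]_(x in `]0%R, +oo[) (f x)%:E <= _)%E.
      apply: ge0_subset_integral => //.
      by apply: bigsetU_measurable.
    rewrite mulrC EFinM lee_pdivlMl ?omega_gt0//.
  - exact: index_enum_uniq.
  - by move=> i j _ _; apply: dis.
  - exact: measurable_funS mf.
  - by move=> x /D_A; exact: f0.
have fin i : (\int[mu]_(x in F i) (f x)%:E)%E \is a fin_num.
  rewrite ge0_fin_numE; last by apply: integral_ge0 => x /FA; exact: f0.
  apply: le_lt_trans (ltry (M / omega (p - 1))); apply: le_trans sumE.
  rewrite (bigD1 i)//= leeDl// sume_ge0// => j _.
  by apply: integral_ge0 => x /FA; exact: f0.
apply: (@le_trans _ _ (\sum_(i < n) (c `^ p / p * fine (\int[mu]_(x in F i) (f x)%:E)%E +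
    c `^ (- q) / q * ln (r i / l i)))).
  apply: ler_sum => i _; have [li0 lri] := lr i.
  move: lri; rewrite le_eqVlt => /predU1P[lri|lri].
    have <- : l i = r i by [].
    rewrite subrr normr0 divff ?gt_eqF// ln1 mulr0 addr0.
    rewrite mulr_ge0 ?divr_ge0 ?powR_ge0 ?(ltW p0)// fine_ge0// integral_ge0// => x /FA.
    exact: f0.
  apply: young_log_bound => //; first by lra.
  by rewrite fineK.
rewrite big_split/= -!mulr_sumr lerD2r ler_wpM2l//.
  by rewrite divr_ge0 ?powR_ge0 ?ltW.
by rewrite -lee_fin -sumEFin; under eq_bigr do rewrite fineK//.
Qed.

(** Tonelli's theorem on the strip [0 < x < t < x + h], whose section at height [t] has length at
    most [h]. *)
Lemma shift_average_le (g : R -> R) h : 0 < h -> nnmeasurable g ->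
  measurable_fun (`]0, +oo[ : set (measurableTypeR R))
    (fun x => \int[mu]_(t in `]x, (x + h)%R[) (g t)%:E)%E /\
  (\int[mu]_(x in `]0%R, +oo[) \int[mu]_(t in `]x, (x + h)%R[) (g t)%:E <=
   h%:E * \int[mu]_(t in `]0%R, +oo[) (g t)%:E)%E.
Proof.
move=> h0 [mg g0]; pose G t := if 0 < t then g t else 0.
have mG : measurable_fun setT G.
  apply: measurable_fun_if => //.
    by apply: measurable_fun_ltr.
  apply: measurable_funS mg => //.
  by move=> t [_ /=]; rewrite in_itv/= andbT.
have G0 t : 0 <= G t by rewrite /G; case: ifPn => // /g0.
pose F (z : measurableTypeR R * measurableTypeR R) : R :=
  if [&& 0 < z.1, z.1 < z.2 & z.2 < z.1 + h] then G z.2 else 0.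
have mF : measurable_fun setT F.
  apply: measurable_fun_ifT => //; last exact: measurableT_comp.
  apply: measurable_and.
    by apply: measurable_fun_ltr; [exact: measurable_cst|exact: measurable_fst].
  apply: measurable_and.
    by apply: measurable_fun_ltr; [exact: measurable_fst|exact: measurable_snd].
  apply: measurable_fun_ltr; first exact: measurable_snd.
  by apply: measurable_funD; [exact: measurable_fst|exact: measurable_cst].
have F0 z : (0 <= (F z)%:E)%E by rewrite lee_fin /F; case: ifP.
have mFE : measurable_fun setT (EFin \o F) by exact/measurable_EFinP.
have FE x : 0 < x -> (\int[mu]_t (EFin \o F) (x, t) =
    \int[mu]_(t in `]x, (x + h)%R[) (g t)%:E)%E.
  move=> x0; rewrite [RHS]integral_mkcond; apply: eq_integral => t _.
  rewrite patchE /F/= x0/=; case: ifPn => [/andP[xt th]|xth].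
    by rewrite mem_set /G ?(lt_trans x0)//= in_itv/= xt th.
  by rewrite memNset//= in_itv/=; apply/negP.
split.
  have mI := measurable_fun_fubini_tonelli_F (m2 := mu) (EFin \o F) mFE F0.
  apply: (@eq_measurable_fun _ _ _ _ _ (fubini_F mu (EFin \o F))).
    by move=> x; rewrite inE/= in_itv/= andbT => x0; exact: FE.
  exact: measurable_funTS.
have := @fubini_tonelli _ _ _ _ R mu mu (EFin \o F) mFE F0.
have -> : (\int[mu]_x \int[mu]_t (EFin \o F) (x, t) =
    \int[mu]_(x in `]0%R, +oo[) \int[mu]_(t in `]x, (x + h)%R[) (g t)%:E)%E.
  rewrite [RHS]integral_mkcond; apply: eq_integral => x _.
  rewrite patchE; case: ifPn => [|].
    by rewrite inE/= in_itv/= andbT => x0; exact: FE.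
  rewrite notin_setE/= in_itv/= andbT => /negP/negbTE x0.
  by rewrite integral0_eq// => t _; rewrite /F/= x0.
move=> ->.
have step t : (\int[mu]_x (EFin \o F) (x, t) <= (h * G t)%:E)%E.
  apply: (@le_trans _ _ (\int[mu]_x (G t * \1_(`](t - h)%R, t[) x)%:E)%E).
    apply: ge0_le_integral_EFin => //.
    - by apply: measurableT_comp mF _; exact: pair2_measurable.
    - by apply: measurable_funM => //; exact: measurable_indic.
    move=> x _; rewrite -lee_fin F0/= /F/=; case: ifPn => [/and3P[x0 xt th]|_].
      by rewrite indicE mem_set ?mulr1//= in_itv/= xt andbT; lra.
    by rewrite mulr_ge0.
  under eq_integral do rewrite EFinM.
  rewrite ge0_integralZl//; last 2 first.
  - by apply/measurable_EFinP; exact: measurable_indic.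
  - by rewrite lee_fin.
  rewrite integral_indic// setIT [X in (_ * X)%E](_ : _ = h%:E).
    by rewrite -EFinM lee_fin mulrC.
  transitivity (mu `](t - h)%R, t[%classic) => //.
  rewrite lebesgue_measure_itv/= lte_fin ltrBlDr ltrDl h0.
  by rewrite -EFinB opprB addrC subrK.
apply: (@le_trans _ _ (\int[mu]_t (h * G t)%:E)%E).
  apply: ge0_le_integral => //.
  - by move=> t _; apply: integral_ge0 => x _; exact: F0.
  - exact: measurable_fun_fubini_tonelli_G.
  - by apply/measurable_EFinP; exact: measurable_funM.
under eq_integral do rewrite EFinM.
rewrite ge0_integralZl//; last 3 first.
- exact/measurable_EFinP.
- by move=> t _; rewrite lee_fin.
- by rewrite lee_fin ltW.
rewrite [X in (_ <= h%:E * X)%E]integral_mkcond le_eqVlt; apply/orP; left; apply/eqP.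
congr (_ * _)%E; apply: eq_integral => t _; rewrite patchE /G.
case: ifPn => t0; first by rewrite mem_set//= in_itv/= t0.
by rewrite memNset//= in_itv/= (negbTE t0).
Qed.

(* The averaging operator [g |-> h^-1 \int_x^(x+h) g] contracts [L^1], and
   [x^alpha |slope u h x|^p] is dominated by the average of
   [t^alpha |u' t|^p] because [ln ((x + h) / x) <= h / x]. *)
Lemma energy_slope_le p q h M u : 2 <= p -> p^-1 + q^-1 = 1 -> 0 < h ->
  loc_abs_continuous u -> measurable_fun (`]0, +oo[ : set R) (derive1 u) ->
  (energy p (p - 1) (derive1 u) <= M%:E)%E ->
  nnmeasurable (fun x => `|slope u h x| `^ p) /\
  (int_lambda (p - 1) (fun x => (`|slope u h x| `^ p)%R) <= M%:E)%E.
Proof.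
move=> p2 pq h0 ac mu' DM.
have p0 : 0 < p by lra. have p10 : 0 <= p - 1 by lra. have w0 := omega_gt0 p10.
have ns : nnmeasurable (fun x => `|slope u h x| `^ p).
  apply: nnmeasurable_powR; apply: open_continuous_measurable_fun => // x.
  rewrite inE/= in_itv/= andbT => x0; apply: cvgM; last exact: cvg_cst.
  apply: cvgB; last exact: (loc_ac_continuous ac).
  apply: (@continuous_comp _ _ _ (fun x => x + h)).
    by apply: cvgD; [exact: cvg_id|exact: cvg_cst].
  by apply: loc_ac_continuous ac _; rewrite addr_gt0.
split; first exact: ns.
pose g t := `|derive1 u t| `^ p * t `^ (p - 1).
have ng : nnmeasurable g.
  split; last by move=> x _; rewrite mulr_ge0 ?powR_ge0.
  apply: measurable_funM (nnmeasurable_powR p mu').1 _.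
  by apply: measurable_funTS; exact: measurable_powR.
have [mg g0] := nnmeasurable_EFin ng.
pose E x := (\int[mu]_(t in `]x, (x + h)%R[) (g t)%:E)%E.
have Efin x : 0 < x -> E x \is a fin_num.
  move=> x0; rewrite ge0_fin_numE; last first.
    by apply: integral_ge0 => t _; rewrite lee_fin mulr_ge0 ?powR_ge0.
  exact: le_lt_trans (energy_interval _ p10 x0 mu' DM) (ltry _).
have bound x : 0 < x -> `|slope u h x| `^ p * x `^ (p - 1) <= h^-1 * fine (E x).
  move=> x0; have xh : x < x + h by rewrite ltrDl.
  have E0 : 0 <= fine (E x).
    by apply: fine_ge0; apply: integral_ge0 => t _; rewrite lee_fin mulr_ge0 ?powR_ge0.
  have := @log_hoelder R p q x (x + h) (fine (E x)) u.
  rewrite fineK ?Efin// => /(_ _ pq E0 x0 xh ac mu' (lexx _))/wrap[]; first by lra.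
  have lnle : 0 <= ln ((x + h) / x) <= h / x.
    rewrite mulrDl divff ?gt_eqF// le_ln1Dx; last by rewrite (lt_trans _ (divr_gt0 h0 x0)).
    by rewrite andbT ln_ge0// lerDl divr_ge0 ?ltW.
  have qV : q^-1 = 1 - p^-1 by lra.
  have qp : q^-1 * p = p - 1 by rewrite qV mulrBl mul1r mulVf ?gt_eqF.
  move=> H; have : `|u (x + h) - u x| `^ p <= fine (E x) * (h / x) `^ (p - 1).
    apply: (@le_trans _ _ ((fine (E x) `^ p^-1 * ln ((x + h) / x) `^ q^-1) `^ p)).
      by apply: ge0_ler_powR; rewrite ?nnegrE ?mulr_ge0 ?powR_ge0 ?(ltW p0).
    rewrite powRM ?powR_ge0// -!powRrM mulVf ?gt_eqF// powRr1// qp.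
    apply: ler_wpM2l => //; case/andP: lnle => l0 l1.
    by apply: ge0_ler_powR; rewrite ?nnegrE ?divr_ge0 ?(ltW h0) ?(ltW x0).
  move=> {}H; rewrite /slope normrM normfV (gtr0_norm h0) powRM ?invr_ge0 ?(ltW h0)//.
  have xp : 0 < x `^ (p - 1) by rewrite powR_gt0.
  have hp : 0 < h `^ p by rewrite powR_gt0.
  rewrite mulrAC -powR_inv1 ?(ltW h0)// -powRrM mulN1r powRN ler_pdivrMr//.
  apply: le_trans (ler_wpM2r (ltW xp) H) _.
  have xV : 0 <= x^-1 by rewrite invr_ge0 ltW.
  rewrite (powRM _ (ltW h0) xV) -(powR_inv1 (ltW x0)) -(powRrM x) mulN1r powRN.
  rewrite -(mulr_powRB1 (ltW h0) p0) powR_inv1 ?(ltW h0)//.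
  rewrite le_eqVlt; apply/orP; left; apply/eqP; field.
  by rewrite !gt_eqF.
apply: le_trans DM; rewrite /energy /int_lambda lee_wpmul2l ?lee_fin ?(ltW w0)//.
have [mE avg] := shift_average_le h0 ng.
apply: (@le_trans _ _ (\int[mu]_(x in `]0%R, +oo[) (h^-1%:E * E x))%E).
  apply: ge0_le_integral => //.
  - by move=> x _; rewrite lee_fin mulr_ge0 ?powR_ge0.
  - apply/measurable_EFinP; apply: measurable_funM ns.1 _.
    by apply: measurable_funTS; exact: measurable_powR.
  - exact: measurable_funeM.
  - move=> x; rewrite /= in_itv/= andbT => x0.
    by rewrite -(fineK (Efin _ x0)) -EFinM lee_fin bound.
rewrite ge0_integralZl//; last 2 first.
- by move=> x _; apply: integral_ge0 => t _; rewrite lee_fin mulr_ge0 ?powR_ge0.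
- by rewrite lee_fin invr_ge0 ltW.
by rewrite lee_pdivrMl.
Qed.

End EnergyInequalities.

(** * The exponential series and the Trudinger-Moser functional *)

Section ExpTail.
Context {R : realType}.
Implicit Types (t x l : R) (m n k : nat).

(** For [k = p - 1], [exp_tail k] is [phi p] and [exp_tail k.+1] is the remainder [psi]. *)
Definition exp_tail m t : R := expR t - \sum_(0 <= j < m) exp_coeff t j.

Lemma exp_tail_cvg m t :
  \sum_(m <= j < n) exp_coeff t j @[n --> \oo] --> exp_tail m t.
Proof.
have H : (series (exp_coeff t) \- cst (\sum_(0 <= j < m) exp_coeff t j)) @ \oo --> exp_tail m t.
  by apply: cvgB; [exact: is_cvg_series_exp_coeff|exact: cvg_cst].
apply: cvg_trans H; apply: near_eq_cvg; near=> n.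
have mn : (m <= n)%N by near: n; exact: nbhs_infty_ge.
by rewrite /= /series/= (@big_cat_nat _ _ _ m)//=; lra.
Unshelve. all: by end_near. Qed.

Lemma exp_coeff_ge0 t n : 0 <= t -> 0 <= exp_coeff t n.
Proof. by move=> t0; rewrite /exp_coeff/= divr_ge0// exprn_ge0. Qed.

Lemma exp_tailS m t : exp_tail m t = t ^+ m / m`!%:R + exp_tail m.+1 t.
Proof. by rewrite /exp_tail big_nat_recr//= /exp_coeff/=; lra. Qed.

Lemma exp_tail_ge0 m t : 0 <= t -> 0 <= exp_tail m t.
Proof.
move=> t0; rewrite -(cvg_lim _ (@exp_tail_cvg m t))//; apply: limr_ge.
  by apply/cvg_ex; exists (exp_tail m t); exact: exp_tail_cvg.
by apply: nearW => n; apply: sumr_ge0 => j _; exact: exp_coeff_ge0.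
Qed.

Lemma exp_tail_ge m t : 0 <= t -> t ^+ m / m`!%:R <= exp_tail m t.
Proof. by move=> t0; rewrite exp_tailS lerDl exp_tail_ge0. Qed.

Lemma exp_tail_gt0 m t : 0 < t -> 0 < exp_tail m t.
Proof.
move=> t0; apply: lt_le_trans (exp_tail_ge m (ltW t0)).
by rewrite divr_gt0 ?exprn_gt0// ltr0n fact_gt0.
Qed.

Lemma exp_tail_le_expR m t : 0 <= t -> exp_tail m t <= expR t.
Proof.
move=> t0; rewrite /exp_tail gerBl sumr_ge0// => j _; exact: exp_coeff_ge0.
Qed.

Lemma exp_tail0 m : exp_tail m.+1 0 = 0.
Proof.
rewrite /exp_tail expR0 big_nat_recl//= big1 ?addr0; last first.
  by move=> i _; rewrite /exp_coeff/= expr0n mul0r.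
by rewrite /exp_coeff/= expr0 fact0 divr1 subrr.
Qed.

(** Every monomial of the tail has degree [j >= m], so it gains a factor [l^j >= l^m]. *)
Lemma exp_tail_scale m l t : 1 <= l -> 0 <= t ->
  l ^+ m * exp_tail m t <= exp_tail m (l * t).
Proof.
move=> l1 t0; have H : (fun n => l ^+ m * \sum_(m <= j < n) exp_coeff t j) @ \oo -->
    l ^+ m * exp_tail m t.
  by apply: cvgMr; exact: exp_tail_cvg.
apply: (ler_cvg_to H (@exp_tail_cvg m (l * t))); apply: nearW => n.
rewrite mulr_sumr big_nat [leRHS]big_nat; apply: ler_sum => j /andP[mj _].
rewrite /exp_coeff/= exprMn mulrA ler_wpM2r// ler_wpM2r ?exprn_ge0//.
exact: ler_weXn2l.
Qed.

(** Factor out [t ^+ m] and use [j! <= (j + m)!]. *)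
Lemma exp_tail_le m t : 0 <= t -> exp_tail m t <= t ^+ m * expR t.
Proof.
move=> t0; rewrite -(cvg_lim _ (@exp_tail_cvg m t))//; apply: limr_le.
  by apply/cvg_ex; exists (exp_tail m t); exact: exp_tail_cvg.
apply: nearW => n.
apply: (@le_trans _ _ (t ^+ m * \sum_(0 <= j < n - m) exp_coeff t j)); last first.
  apply: ler_wpM2l; first exact: exprn_ge0.
  have := exp_tail_ge0 (n - m) t0; rewrite /exp_tail; lra.
have [nm|mn] := leqP n m; first by rewrite big_geq// mulr_ge0 ?exprn_ge0// sumr_ge0// => j _; exact: exp_coeff_ge0.
rewrite -{1}(add0n m) big_addn mulr_sumr; apply: ler_sum => j _.
rewrite /exp_coeff/= addnC exprD mulrA ler_wpM2l ?mulr_ge0 ?exprn_ge0//.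
by rewrite lef_pV2 ?posrE ?ltr0n ?fact_gt0// ler_nat leq_fact// leq_addl.
Qed.

Lemma exp_tail_continuous m : continuous (exp_tail m).
Proof.
elim: m => [|m ih] t.
  have -> : exp_tail 0 = expR by apply/funext => x; rewrite /exp_tail big_geq// subr0.
  exact: continuous_expR.
have -> : exp_tail m.+1 = (fun t => exp_tail m t - t ^+ m / m`!%:R).
  by apply/funext => x; rewrite (exp_tailS m); lra.
apply: cvgB; first exact: ih.
by apply: cvgM; [exact: exprn_continuous|exact: cvg_cst].
Qed.

Lemma phi_exp_tail (p : R) k t : k%:R = p - 1 -> phi p t = exp_tail k t.
Proof.
move=> kp; rewrite /phi; apply/cvg_lim => //.
apply: cvg_trans (@exp_tail_cvg k t); apply: near_eq_cvg; near=> n.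
have kn : (k <= n)%N by near: n; exact: nbhs_infty_ge.
rewrite [RHS](@big_cat_nat _ _ _ k)//= [X in _ = X + _]big1_seq; last first.
  move=> j /andP[kj]; rewrite mem_index_iota => /andP[_ jk].
  by move: kj; rewrite -kp ler_nat leqNgt jk.
rewrite add0r big_nat_cond [RHS]big_nat_cond; apply: eq_bigl => j.
by rewrite -kp ler_nat; case: (k <= j)%N; rewrite ?andbF ?andbT.
Unshelve. all: by end_near. Qed.

End ExpTail.

(** * Uniform estimates on the unit ball *)

Section UniformBounds.
Context {R : realType}.
Variables (p theta : R).
Hypotheses (hp : 2 <= p) (htheta : 0 <= theta).
Implicit Types (e h r s x : R) (u : R -> R).

Local Notation mu := (@lebesgue_measure R).
Local Notation q := (p / (p - 1)).
Local Notation ball := (unit_ball p (p - 1) theta).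
Local Notation K := ((omega (p - 1))^-1 `^ p^-1).

Let p0 : 0 < p. Proof. exact: lt_le_trans hp. Qed.
Let p10 : 0 < p - 1. Proof. by rewrite subr_gt0; apply: lt_le_trans hp; rewrite ltr1n. Qed.
Let p1 : 1 < p. Proof. by rewrite -subr_gt0. Qed.
Let q0 : 0 < q. Proof. by rewrite divr_gt0. Qed.
Let pq : p^-1 + q^-1 = 1. Proof. by field; rewrite !gt_eqF. Qed.
Let wa : 0 < omega (p - 1). Proof. by apply: omega_gt0; exact: ltW. Qed.
Let K0 : 0 < K. Proof. by rewrite powR_gt0// invr_gt0. Qed.

Lemma ballP u : ball u <-> [/\ loc_abs_continuous u, u r @[r --> +oo] --> 0,
     measurable_fun (`]0, +oo[ : set R) u,
     measurable_fun (`]0, +oo[ : set R) (derive1 u) &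
     (energy p theta u + energy p (p - 1) (derive1 u) <= 1)%E].
Proof. by apply: unit_ballP => //; exact: ltW. Qed.

Lemma ball_energy u : ball u -> (energy p theta u <= 1)%E.
Proof.
move=> /ballP[_ _ _ _]; apply: le_trans; rewrite leeDl//.
by apply: energy_ge0; exact: ltW.
Qed.

Lemma ball_energy_derive1 u : ball u -> (energy p (p - 1) (derive1 u) <= 1)%E.
Proof.
by move=> /ballP[_ _ _ _]; apply: le_trans; rewrite leeDr// energy_ge0.
Qed.

(** [K] comes from dividing the factor [omega (p - 1)] out of an energy that is at most 1. *)
Lemma ball_modulus u r s : ball u -> 0 < r -> r < s ->
  `|u s - u r| <= K * ln (s / r) `^ q^-1.
Proof.
move=> bu r0 rs; have [ac _ _ mu' _] := (ballP u).1 bu.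
apply: log_hoelder => //.
  by rewrite invr_ge0 ltW.
have := energy_interval s (ltW p10) r0 mu' (ball_energy_derive1 bu).
by rewrite div1r.
Qed.

(** If [|u r| > e], the logarithmic modulus keeps [|u| >= e / 2] on []r, (1 + d) r[], and for
    [r >= 1] this interval carries an energy of at least [A * r]. Since the energy is at most 1, [r]
    is bounded. *)
Lemma ball_decay e : 0 < e -> exists2 r0, 1 <= r0 &
  forall u r, ball u -> r0 <= r -> `|u r| <= e.
Proof.
move=> e0; have wt := omega_gt0 htheta.
(* Chosen so that [K * d^(1/q) = e / 2]. *)
pose d := (e / (2 * K)) `^ q; have d0 : 0 < d by rewrite powR_gt0// divr_gt0// mulr_gt0.
pose A := omega theta * ((e / 2) `^ p * d).
have A0 : 0 < A.
  by apply: mulr_gt0 => //; apply: mulr_gt0 => //; apply: powR_gt0; rewrite divr_gt0.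
exists (Num.max 1 (2 / A)); first by rewrite le_max lexx.
move=> u r bu; rewrite ge_max => /andP[r1 rA].
rewrite leNgt; apply/negP => er; have r0 : 0 < r by lra.
have lb x : r < x -> x < (1 + d) * r -> e / 2 <= `|u x|.
  move=> rx xd; have := ball_modulus bu r0 rx.
  have xr : 0 < x / r by rewrite divr_gt0// (lt_trans r0).
  have lnd : ln (x / r) <= d.
    have -> : x / r = 1 + (x / r - 1) by lra.
    have h : x / r - 1 <= d by rewrite lerBlDr addrC ler_pdivrMr// ltW.
    by apply: le_trans h; apply: le_ln1Dx; lra.
  have ln0 : 0 <= ln (x / r) by rewrite ln_ge0// ler_pdivlMr// mul1r ltW.
  have : K * ln (x / r) `^ q^-1 <= e / 2.
    apply: (@le_trans _ _ (K * d `^ q^-1)).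
      rewrite ler_wpM2l ?(ltW K0)//; apply: ge0_ler_powR => //.
      - by rewrite invr_ge0 ltW.
      - by rewrite nnegrE ltW.
    rewrite /d -powRrM mulfV ?gt_eqF// powRr1; last by rewrite divr_ge0 ?mulr_ge0 ?ltW.
    by rewrite le_eqVlt; apply/orP; left; apply/eqP; field; rewrite gt_eqF.
  move=> h1 h2; have : `|u r| <= `|u x| + `|u x - u r|.
    by rewrite distrC -{1}(subrK (u x) (u r)) addrC ler_normD.
  by lra.
have [ac _ mu_ _ _] := (ballP u).1 bu.
have rd : r < (1 + d) * r by rewrite ltr_pMl// ltrDl.
have big : ((A * r)%:E <= energy p theta u)%E.
  rewrite /energy /int_lambda /A -mulrA EFinM; apply: lee_wpmul2l; first by rewrite lee_fin ltW.
  apply: (@le_trans _ _ (\int[mu]_(x in `]r, ((1 + d) * r)%R[) ((e / 2) `^ p)%:E)%E).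
    rewrite integral_cst//= [X in (_ * X)%E](_ : _ = (d * r)%:E).
      by rewrite -EFinM lee_fin mulrA.
    transitivity (mu `]r, ((1 + d) * r)%R[%classic) => //.
    rewrite lebesgue_measure_itv/= lte_fin rd -EFinB; congr EFin; lra.
  have mf : measurable_fun (`]0, +oo[ : set R) (fun x => `|u x| `^ p * x `^ theta).
    apply: measurable_funM (nnmeasurable_powR p mu_).1 _.
    by apply: measurable_funTS; exact: measurable_powR.
  have sub : `]r, ((1 + d) * r)[ `<=` (`]0, +oo[ : set R).
    by move=> x /=; rewrite !in_itv/= andbT => /andP[+ _]; exact: lt_trans.
  apply: (@le_trans _ _ (\int[mu]_(x in `]r, ((1 + d) * r)%R[) (`|u x| `^ p * x `^ theta)%:E)%E).
    apply: ge0_le_integral_EFin => //; first exact: measurable_funS mf.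
    move=> x; rewrite /= in_itv/= => /andP[rx xd].
    rewrite powR_ge0/= -[leLHS]mulr1 ler_pM ?powR_ge0//.
      by apply: ge0_ler_powR; rewrite ?nnegrE ?divr_ge0 ?(ltW e0) ?(ltW p0)//; exact: lb.
    by rewrite -(powRr0 x); apply: ler_powR => //; lra.
  apply: ge0_subset_integral => //; first exact/measurable_EFinP.
  by move=> x _; rewrite lee_fin mulr_ge0 ?powR_ge0.
have := le_trans big (ball_energy bu); rewrite lee_fin.
have : 2 <= A * r by move: rA; rewrite ler_pdivrMr// mulrC.
by lra.
Qed.

(** Either [h x >= 1] and [1 + x <= (1 + h) x], or [x <= h^-1]. A factor close to 1 is bought at the
    price of an additive constant. *)
Lemma powR_add1_le h x : 0 < h -> 0 <= x ->
  (1 + x) `^ q <= (1 + h) `^ q * x `^ q + (1 + h^-1) `^ q.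
Proof.
move=> h0 x0; case: (leP 1 (h * x)) => hx.
  apply: ler_wpDr; first exact: powR_ge0.
  rewrite -powRM//; last by lra.
  by apply: ge0_ler_powR; rewrite ?nnegrE ?(ltW q0)//; nra.
apply: ler_wpDl; first by rewrite mulr_ge0 ?powR_ge0.
have xh : x <= h^-1 by rewrite -[h^-1]mul1r ler_pdivlMr// mulrC ltW.
have hV : 0 < h^-1 by rewrite invr_gt0.
by apply: ge0_ler_powR; rewrite ?nnegrE ?(ltW q0)//; lra.
Qed.

(* [sigma K^q < theta + 1] is the definition of subcriticality, and the slack
   absorbs the additive constant [u r1]. *)
Lemma ball_exponent_bound sigma : 0 < sigma -> sigma < Defs.mu (p - 1) theta ->
  exists kappa C, [/\ kappa < theta + 1, 0 <= C &
    forall u r1 r, ball u -> `|u r1| <= 1 -> 0 < r -> r < r1 ->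
      sigma * `|u r| `^ q <= kappa * ln (r1 / r) + C].
Proof.
move=> s0 smu; have Kq : K `^ q = (omega (p - 1) `^ (p - 1)^-1)^-1.
  rewrite -powRrM -(powR_inv1 (ltW wa)) -powRrM -powRN; congr (_ `^ _).
  by field; rewrite !gt_eqF.
have wp : 0 < omega (p - 1) `^ (p - 1)^-1 by rewrite powR_gt0.
have sK : sigma * K `^ q < theta + 1 by rewrite Kq ltr_pdivrMr.
have sK0 : 0 < sigma * K `^ q by rewrite mulr_gt0// powR_gt0.
pose kappa := (theta + 1 + sigma * K `^ q) / 2.
have k1 : kappa < theta + 1 by rewrite /kappa; lra.
have k2 : 1 < kappa / (sigma * K `^ q) by rewrite ltr_pdivlMr// mul1r /kappa; lra.
(* [h] solves [sigma (1 + h)^q K^q = kappa], where [kappa] is the midpoint between [sigma K^q] and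
   [theta + 1]. *)
pose h := (kappa / (sigma * K `^ q)) `^ q^-1 - 1.
have h0 : 0 < h.
  rewrite subr_gt0 [ltLHS](_ : 1 = 1 `^ q^-1); last by rewrite powR1.
  apply: gt0_ltr_powR; rewrite ?nnegrE ?invr_gt0//.
  by lra.
have hE : sigma * ((1 + h) `^ q * K `^ q) = kappa.
  rewrite /h addrC subrK -powRrM mulVf ?gt_eqF// powRr1; last by lra.
  by field; rewrite !gt_eqF// powR_gt0.
exists kappa, (sigma * (1 + h^-1) `^ q); split => //.
  by rewrite mulr_ge0 ?powR_ge0 ?ltW.
move=> u r1 r bu u1 r0 rr1.
have ln0 : 0 <= ln (r1 / r) by rewrite ln_ge0// ler_pdivlMr// mul1r ltW.
have x0 : 0 <= K * ln (r1 / r) `^ q^-1 by rewrite mulr_ge0 ?powR_ge0.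
have ub : `|u r| <= 1 + K * ln (r1 / r) `^ q^-1.
  have := ball_modulus bu r0 rr1; have : `|u r| <= `|u r1| + `|u r1 - u r|.
    by rewrite distrC -{1}(subrK (u r1) (u r)) addrC ler_normD.
  by lra.
have : `|u r| `^ q <= (1 + K * ln (r1 / r) `^ q^-1) `^ q.
  by apply: ge0_ler_powR; rewrite ?nnegrE ?(ltW q0)//; lra.
move=> /le_trans/(_ (powR_add1_le h0 x0)) H.
apply: le_trans (ler_wpM2l (ltW s0) H) _.
rewrite mulrDr lerD2r powRM ?powR_ge0// -(powRrM (ln _)) mulVf ?gt_eqF// powRr1//.
rewrite [leLHS](_ : _ = sigma * ((1 + h) `^ q * K `^ q) * ln (r1 / r)).
  by rewrite hE.
by ring.
Qed.

(** Below [r1], [H] is a constant times [r^(-kappa)], and [theta - kappa > -1]. *)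
Lemma dominating_integrable kappa C r1 : kappa < theta + 1 -> 0 < r1 ->
  let H r := if r < r1 then expR (kappa * ln (r1 / r) + C) else 0 in
  nnmeasurable H /\ (int_lambda theta H < +oo)%E.
Proof.
move=> kt r10 H.
pose H' r := expR C * r1 `^ kappa * (r `^ (- kappa)).
have HE r : 0 < r -> H r = if r < r1 then H' r else 0.
  move=> r0; rewrite /H /H'; case: ifPn => // _.
  rewrite addrC expRD -mulrA; congr (_ * _).
  have rr : 0 < r1 / r by rewrite divr_gt0.
  have := @powRM R r1 r^-1 kappa; rewrite invr_ge0 (ltW r0) (ltW r10) => /(_ isT isT).
  rewrite -[r^-1]powR_inv1 ?(ltW r0)// -powRrM mulN1r => <-.
  by rewrite powR_inv1 ?(ltW r0)// /powR gt_eqF// mulrC.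
have nH' : nnmeasurable (fun r => if r < r1 then H' r else 0).
  apply: nnmeasurable_patch; split; last first.
    by move=> r _; rewrite !mulr_ge0 ?powR_ge0 ?expR_ge0.
  by apply: measurable_funTS; apply: measurable_funM => //; exact: measurable_powR.
have nH : nnmeasurable H.
  split; last by move=> r r0; rewrite HE//; exact: nH'.2.
  apply: eq_measurable_fun nH'.1 => r; rewrite inE/= in_itv/= andbT => r0.
  by rewrite HE.
split => //; rewrite (eq_int_lambda theta HE) int_lambdaE//.
pose M := expR C * r1 `^ kappa * omega theta.
have wt := omega_gt0 htheta.
have M0 : 0 <= M.
  by apply: mulr_ge0; [apply: mulr_ge0; [exact: expR_ge0|exact: powR_ge0]|exact: ltW].
have -> : (\int[mu]_(r in `]0%R, +oo[) ((if r < r1 then H' r else 0) * (omega theta * r `^ theta))%:E =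
    \int[mu]_(r in `]0%R, r1[) (M * r `^ (theta - kappa))%:E)%E.
  rewrite integral_mkcond [RHS]integral_mkcond; apply: eq_integral => r _.
  rewrite !patchE; case: (ltP 0 r) => r0; last first.
    by rewrite !memNset//= in_itv/= ltNge r0.
  rewrite mem_set/=; last by rewrite in_itv/= r0.
  case: (ltP r r1) => rr1; last by rewrite memNset ?mul0r//= in_itv/= r0 ltNge rr1.
  rewrite mem_set/=; last by rewrite in_itv/= r0.
  congr EFin; rewrite /H' /M powRD; last by apply/implyP => _; rewrite gt_eqF.
  by ring.
under eq_integral do rewrite EFinM.
rewrite ge0_integralZl//; last 2 first.
- by apply/measurable_EFinP; apply: measurable_funTS; exact: measurable_powR.
- by move=> r _; rewrite lee_fin powR_ge0.
apply: lte_mul_pinfty; [by rewrite lee_fin|by []|].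
by apply: integral_powR_lty => //; lra.
Qed.

End UniformBounds.

(** * Leading term and excess of the functional *)

Section Functional.
Context {R : realType}.
Variables (p theta : R) (k : nat).
Hypotheses (hp : 2 <= p) (htheta : 0 <= theta) (hk : k%:R = p - 1).
Implicit Types (e r s x t : R) (u : R -> R).

Local Notation q := (p / (p - 1)).
Local Notation ball := (unit_ball p (p - 1) theta).

Let p0 : 0 < p. Proof. exact: lt_le_trans hp. Qed.
Let p10 : 0 < p - 1. Proof. by rewrite subr_gt0; apply: lt_le_trans hp; rewrite ltr1n. Qed.
Let q0 : 0 < q. Proof. by rewrite divr_gt0. Qed.

Definition excess s u := int_lambda theta (fun r => exp_tail k.+1 (s * `|u r| `^ q)).

Lemma nnmeasurable_exp_tail m s u : 0 <= s -> measurable_fun (`]0, +oo[ : set R) u ->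
  nnmeasurable (fun r => exp_tail m (s * `|u r| `^ q)).
Proof.
move=> s0 mu_; split; last by move=> r _; rewrite exp_tail_ge0// mulr_ge0 ?powR_ge0.
apply: (@measurableT_comp _ _ _ _ _ _ (exp_tail m)).
  apply: continuous_measurable_fun; exact: exp_tail_continuous.
by apply: measurable_funM => //; exact: (nnmeasurable_powR q mu_).1.
Qed.

(** Integrality of [p] enters here: [q k = p] turns the first term of the series into the integrand
    of the energy. *)
Lemma powR_conj_expn x : (`|x| `^ q) ^+ k = `|x| `^ p.
Proof.
by rewrite -powR_mulrn ?powR_ge0// -powRrM hk divfK// gt_eqF.
Qed.

Lemma TM_functional_split s u : 0 <= s -> measurable_fun (`]0, +oo[ : set R) u ->
  TM_functional p theta s u =
  ((s ^+ k / k`!%:R)%:E * energy p theta u + excess s u)%E.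
Proof.
move=> s0 mu_; rewrite /TM_functional.
rewrite (@eq_int_lambda _ _ _ (fun r => s ^+ k / k`!%:R * `|u r| `^ p +
    exp_tail k.+1 (s * `|u r| `^ q))); last first.
  move=> r _; rewrite (phi_exp_tail _ hk) exp_tailS exprMn powR_conj_expn.
  by congr (_ + _); rewrite mulrAC.
have sk : 0 <= s ^+ k / k`!%:R by apply: divr_ge0 => //; exact: exprn_ge0.
have nJ := nnmeasurable_powR p mu_.
have nE := nnmeasurable_exp_tail k.+1 s0 mu_.
by rewrite (int_lambdaD htheta (nnmeasurableZ sk nJ) nE) (int_lambdaZ htheta sk nJ).
Qed.

Lemma excess_ge0 s u : 0 <= s -> (0 <= excess s u)%E.
Proof.
by move=> s0; apply: int_lambda_ge0 => // r _; rewrite exp_tail_ge0// mulr_ge0 ?powR_ge0.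
Qed.

(** Of the [k + m] factors [|x|^q], [k] of them give [|x|^p] and the other [m] are bounded by [e^q].
    With [m = 0] this controls the functional at infinity, with [m = 1] it makes the excess there
    small. *)
Lemma exp_tail_small_le m s e x : 0 <= s -> `|x| <= e -> e <= 1 ->
  exp_tail (k + m) (s * `|x| `^ q) <=
  s ^+ (k + m) * expR s * (e `^ q) ^+ m * `|x| `^ p.
Proof.
move=> s0 xe e1; have e0 : 0 <= e by exact: le_trans xe.
have xq0 := powR_ge0 `|x| q.
have xqe : `|x| `^ q <= e `^ q by apply: ge0_ler_powR; rewrite ?nnegrE ?(ltW q0).
have eq1 : e `^ q <= 1.
  rewrite [leRHS](_ : 1 = 1 `^ q); last by rewrite powR1.
  by apply: ge0_ler_powR; rewrite ?nnegrE ?(ltW q0).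
apply: le_trans (exp_tail_le _ (mulr_ge0 s0 xq0)) _.
rewrite exprMn (exprD (`|x| `^ q)) powR_conj_expn -!mulrA ler_wpM2l ?exprn_ge0//.
rewrite mulrCA [leRHS]mulrC -!mulrA mulrC -!mulrA [leRHS]mulrC -!mulrA.
rewrite [leLHS](_ : _ = `|x| `^ p * ((`|x| `^ q) ^+ m * expR (s * `|x| `^ q))); last by ring.
rewrite [leRHS](_ : _ = `|x| `^ p * ((e `^ q) ^+ m * expR s)); last by ring.
rewrite ler_wpM2l ?powR_ge0// ler_pM ?exprn_ge0 ?expR_ge0//.
  by apply: lerXn2r; rewrite ?nnegrE ?powR_ge0.
by rewrite ler_expR ler_piMr// (le_trans xqe).
Qed.

(** Below [r1] the integrand is dominated by the integrable [H]; beyond [r1], where [|u| <= 1], by a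
    multiple of [|u|^p]. *)
Lemma TM_functional_bounded s : 0 < s -> s < Defs.mu (p - 1) theta ->
  exists B : R, forall u, ball u -> (TM_functional p theta s u <= B%:E)%E.
Proof.
move=> s0 smu.
have [kappa [C [kt C0 expb]]] := ball_exponent_bound hp htheta s0 smu.
have [r1 r11 dec] := ball_decay hp htheta ltr01.
have r10 : 0 < r1 by lra.
have /= [nH HB] := dominating_integrable htheta C kt r10.
set H := (fun r => _) in nH HB.
have Hge0 := int_lambda_ge0 htheta nH.2.
have c0 : 0 <= s ^+ k * expR s by rewrite mulr_ge0 ?exprn_ge0 ?expR_ge0 ?ltW.
exists (fine (int_lambda theta H) + s ^+ k * expR s) => u bu.
have [ac _ mu_ _ _] := (ballP hp htheta u).1 bu.
rewrite EFinD fineK ?ge0_fin_numE//.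
rewrite /TM_functional (@eq_int_lambda _ _ _ (fun r => exp_tail k (s * `|u r| `^ q))); last first.
  by move=> r _; exact: phi_exp_tail.
apply: (@le_trans _ _ (int_lambda theta (fun r => H r + s ^+ k * expR s * `|u r| `^ p))).
  apply: le_int_lambda => //.
  - exact: nnmeasurable_exp_tail (ltW s0) mu_.
  - by apply: nnmeasurableD => //; apply: nnmeasurableZ => //; exact: nnmeasurable_powR.
  move=> r r0; case: (ltP r r1) => rr1.
    rewrite /H rr1; apply: ler_wpDr; first by rewrite mulr_ge0 ?powR_ge0.
    apply: le_trans (exp_tail_le_expR _ _) _; first by rewrite mulr_ge0 ?powR_ge0 ?ltW.
    by rewrite ler_expR; apply: expb => //; exact: dec.
  apply: ler_wpDl; first exact: nH.2.
  have := @exp_tail_small_le 0 s 1 (u r) (ltW s0) (dec _ _ bu rr1) (lexx _).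
  by rewrite addn0 expr0 mulr1.
have nJ := nnmeasurable_powR p mu_.
rewrite (int_lambdaD htheta nH (nnmeasurableZ c0 nJ)) (int_lambdaZ htheta c0 nJ).
apply: leeD => //.
by rewrite -[leRHS]mule1; apply: lee_wpmul2l; [rewrite lee_fin|exact: ball_energy].
Qed.

Lemma TMC_ge s u : ball u -> (TM_functional p theta s u <= TMC p (p - 1) theta s)%E.
Proof. by move=> bu; apply: ereal_sup_ubound; exists u. Qed.

Lemma TMC_fin s : 0 < s -> s < Defs.mu (p - 1) theta -> (TMC p (p - 1) theta s < +oo)%E.
Proof.
move=> s0 smu; have [B HB] := TM_functional_bounded s0 smu.
apply: le_lt_trans (ltry B); apply: ge_ereal_sup => _ [u bu <-]; exact: HB.
Qed.

(** Both integrands vanish exactly where [u] does. *)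
Lemma excess_eq0 s u : 0 < s -> measurable_fun (`]0, +oo[ : set R) u ->
  (excess s u = 0 <-> energy p theta u = 0)%E.
Proof.
move=> s0 mu_; have ne := nnmeasurable_exp_tail k.+1 (ltW s0) mu_.
have nJ := nnmeasurable_powR p mu_.
split; apply: int_lambda_eq0 => //= r r0.
  case: (eqVneq (u r) 0) => [->|ur]; first by move=> _; rewrite normr0 powR0 ?gt_eqF.
  by move=> /eqP; rewrite gt_eqF// exp_tail_gt0// mulr_gt0// powR_gt0// normr_gt0.
by move=> /powR_eq0_eq0 ->; rewrite powR0 ?mulr0 ?exp_tail0// gt_eqF.
Qed.

(** The excess starts at degree [k.+1], one more than the leading term; this extra factor is the
    source of strict monotonicity. *)
Lemma excess_scale s t u : 0 < s -> s <= t -> measurable_fun (`]0, +oo[ : set R) u ->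
  (((t / s) ^+ k.+1)%:E * excess s u <= excess t u)%E.
Proof.
move=> s0 st mu_; have t0 : 0 < t by exact: lt_le_trans st.
have ts : 1 <= t / s by rewrite ler_pdivlMr// mul1r.
have ts0 : 0 <= (t / s) ^+ k.+1 by rewrite exprn_ge0// divr_ge0 ?ltW.
rewrite /excess -int_lambdaZ//; last exact: nnmeasurable_exp_tail (ltW s0) _.
apply: le_int_lambda => //.
- by apply: nnmeasurableZ => //; exact: nnmeasurable_exp_tail (ltW s0) _.
- exact: nnmeasurable_exp_tail (ltW t0) _.
- move=> r _; apply: le_trans (exp_tail_scale _ ts _) _.
    by rewrite mulr_ge0 ?powR_ge0 ?ltW.
  by rewrite mulrA divfK// gt_eqF.
Qed.

End Functional.

(** * Dilations and test functions *)

Section Dilation.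
Context {R : realType}.
Implicit Types (p theta l r s x : R) (u : R -> R).

Lemma is_derive_dilation u l x d : is_derive (l * x) 1 u d ->
  is_derive x 1 (fun r => u (l * r)) (l * d).
Proof.
move=> du; rewrite mulrC.
apply: (@is_derive1_comp R u (fun r => l * r) x d l).
have -> : l = l *: 1 by rewrite /GRing.scale/= mulr1.
have -> : (fun r => l *: (1 : R) * r) = l \*: id :> (R -> R).
  by apply/funext => r; rewrite /GRing.scale/= mulr1.
exact: is_deriveZ.
Qed.

(** If [u] is not derivable at [l * x], its dilation is not derivable at [x], as dilating back by
    [l^-1] shows; both sides are then the default 0. *)
Lemma derive1_dilation u l x : 0 < l ->
  derive1 (fun r => u (l * r)) x = l * derive1 u (l * x).
Proof.
move=> l0; have [du|ndu] := pselect (derivable u (l * x) 1).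
  have /is_derive_dilation[_] : is_derive (l * x) 1 u (derive1 u (l * x)).
    by rewrite derive1E; exact: derivableP.
  by rewrite -derive1E.
have ndv : ~ derivable (fun r => u (l * r)) x 1.
  move=> dv; apply: ndu.
  have dv' : is_derive (l^-1 * (l * x)) 1 (fun r => u (l * r)) ('D_1 (fun r => u (l * r)) x).
    by rewrite mulKf ?gt_eqF//; exact: derivableP.
  have [+ _] := is_derive_dilation dv'.
  have -> : (fun r => u (l * (l^-1 * r))) = u; last exact.
  by apply/funext => r; rewrite mulVKf// gt_eqF.
by rewrite (derive1_nderivable ndu) (derive1_nderivable ndv) mulr0.
Qed.

Lemma energy_dilation p theta l u : 0 <= theta -> 0 < l ->
  measurable_fun (`]0, +oo[ : set R) u ->
  energy p theta (fun r => u (l * r)) =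
  ((l `^ (- (theta + 1)))%:E * energy p theta u)%E.
Proof.
by move=> t0 l0 mu_; rewrite -int_lambda_dilation//; exact: nnmeasurable_powR.
Qed.

Lemma measurable_fun_dilation l u : 0 < l -> measurable_fun (`]0, +oo[ : set R) u ->
  measurable_fun (`]0, +oo[ : set R) (fun r => u (l * r)).
Proof.
move=> l0 mu_.
apply: (@measurable_comp _ _ _ _ _ _ (`]0, +oo[ : set R) u (`]0, +oo[ : set R) (fun r => l * r)) => //.
- by move=> _ [r + <-]; rewrite /= !in_itv/= !andbT => r0; exact: mulr_gt0.
- exact: measurable_funM.
Qed.

(** The chain rule gives [l^p] and the measure gives [l^(-(alpha + 1))]; they cancel because
    [alpha = p - 1]. *)
Lemma energy_derive1_dilation p l u : 1 < p -> 0 < l ->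
  measurable_fun (`]0, +oo[ : set R) (derive1 u) ->
  energy p (p - 1) (derive1 (fun r => u (l * r))) = energy p (p - 1) (derive1 u).
Proof.
move=> p1 l0 mu'; have p10 : 0 <= p - 1 by lra.
rewrite {1}/energy (@eq_int_lambda _ _ _
    (fun r => l `^ p * `|derive1 u (l * r)| `^ p)); last first.
  by move=> r _; rewrite derive1_dilation// normrM (gtr0_norm l0) powRM// ltW.
rewrite int_lambdaZ ?powR_ge0//; last first.
  by apply: nnmeasurable_powR; exact: measurable_fun_dilation.
transitivity ((l `^ p)%:E * energy p (p - 1) (fun r => (derive1 u (l * r))%R))%E => //.
rewrite (energy_dilation p p10 l0 mu').
rewrite muleA -EFinM -powRD; last by apply/implyP => _; rewrite gt_eqF.
by rewrite (_ : p + - (p - 1 + 1) = 0) ?powRr0 ?mul1e//; lra.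
Qed.

Lemma loc_ac_dilation l u : 0 < l -> loc_abs_continuous u ->
  loc_abs_continuous (fun r => u (l * r)).
Proof.
move=> l0 ac a b a0 ab e e0.
have [||d d0 H] := ac (l * a) (l * b) _ _ e e0; [exact: mulr_gt0|by rewrite ler_pM2l|].
exists (d / l); first exact: divr_gt0.
move=> n s r sr dis sm; apply: (H n (fun i => l * s i) (fun i => l * r i)).
- by move=> i; rewrite !ler_pM2l.
- move=> i j _ _ [x []] /=; rewrite !in_itv/= => /andP[x1 x2] /andP[x3 x4].
  apply: dis => //; exists (x / l); split; rewrite /= in_itv/=;
    by rewrite ltr_pdivlMr// ltr_pdivrMr// ![_ * l]mulrC ?x1 ?x2 ?x3 ?x4.
- under eq_bigr do rewrite -mulrBr; rewrite -mulr_sumr mulrC -ltr_pdivlMr//.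
Qed.

Lemma cvg_dilation l u : 0 < l -> u r @[r --> +oo] --> 0 ->
  (fun r => u (l * r)) r @[r --> +oo] --> 0.
Proof.
move=> l0 u0; apply: (cvg_comp (fun r => l * r) u _ u0).
by apply: gt0_cvgMry => //; exact: cvg_id.
Qed.

End Dilation.

(** * Dilated exponentials as test functions *)

Section TestFunctions.
Context {R : realType}.
Implicit Types (p theta a c l r s x tau : R) (u : R -> R).

Local Notation mu := (@lebesgue_measure R).

(** For [a >= 1] the integrand is at most [expR (- r)], whose integral is a multiple of
    [Gamma (theta + 1)]; positivity follows since the two functions have the same (empty) zero
    set. *)
Lemma exp_moment theta a : 0 <= theta -> 1 <= a ->
  exists2 M : R, 0 < M & int_lambda theta (fun r => expR (- r) `^ a) = M%:E.
Proof.
move=> t0 a1; have wt := omega_gt0 t0.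
have nE : nnmeasurable (fun r : R => expR (- r)).
  split; last by move=> r _; exact: expR_ge0.
  by apply: measurableT_comp => //; exact: measurableT_comp.
have nEa : nnmeasurable (fun r : R => expR (- r) `^ a).
  split; last by move=> r _; exact: powR_ge0.
  apply: (@measurableT_comp _ _ _ _ _ _ (fun x : R => x `^ a)); first exact: measurable_powR.
  exact: nE.1.
have t10 : 0 < theta + 1 by lra.
have I1 : (int_lambda theta (fun r => expR (- r)) =
    (omega theta)%:E * \int[mu]_(t in `]0%R, +oo[) (t `^ (theta + 1 - 1) * expR (- t))%:E)%E.
  rewrite /int_lambda; congr (_ * _)%E; apply: eq_integral => r _.
  by rewrite addrK mulrC.
have Ifin : (int_lambda theta (fun r => expR (- r)) < +oo)%E.
  rewrite I1; apply: lte_mul_pinfty; [by rewrite lee_fin ltW|by []|].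
  exact: Gamma_integral_lty.
have Ipos : int_lambda theta (fun r => expR (- r)) != 0%E.
  rewrite I1 mule_eq0 negb_or eqe gt_eqF//=.
  by have := Gamma_gt0 t10; rewrite /Gamma /Rintegral; case: eqP => // ->; rewrite /= ltxx.
have fin : (int_lambda theta (fun r => (expR (- r) `^ a)%R) < +oo)%E.
  apply: le_lt_trans Ifin; apply: le_int_lambda => // r r0.
  by apply: ge1r_powR => //; rewrite expR_gt0/= expR_le1 oppr_le0 ltW.
have ge0 := int_lambda_ge0 t0 nEa.2.
exists (fine (int_lambda theta (fun r => (expR (- r) `^ a)%R))); last first.
  by rewrite fineK// ge0_fin_numE.
apply: fine_gt0; rewrite fin andbT lt_neqAle ge0 andbT eq_sym.
apply/eqP => I0; move/eqP: Ipos; apply; apply: int_lambda_eq0 I0 => //.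
by move=> r _ /powR_eq0_eq0 ->.
Qed.

Lemma is_derive_expRN c x : is_derive x 1 (fun r => c * expR (- r)) (- (c * expR (- x))).
Proof.
have d1 : is_derive x 1 (fun r : R => expR (- r)) (expR (- x) * - 1).
  have dN : is_derive x 1 (fun r : R => - r) (- 1) := is_deriveN (is_derive_id x (1 : R)).
  exact: (@is_derive1_comp R expR (fun r => - r) x _ _ (is_derive_expR (- x)) dN).
have -> : (fun r => c * expR (- r)) = c \*: (fun r => expR (- r)) :> (R -> R) by [].
have -> : - (c * expR (- x)) = c *: (expR (- x) * - 1).
  by rewrite /GRing.scale/= mulrN1 mulrN.
exact: is_deriveZ.
Qed.

Lemma lipschitz_loc_ac L u : 0 < L ->
  (forall x y, 0 < x -> x <= y -> `|u y - u x| <= L * (y - x)) ->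
  loc_abs_continuous u.
Proof.
move=> L0 lip a b a0 ab e e0; exists (e / L); first exact: divr_gt0.
move=> n l r lr _ sm; apply: (@le_lt_trans _ _ (L * \sum_(i < n) (r i - l i))).
  rewrite mulr_sumr; apply: ler_sum => i _; have [h1 [h2 h3]] := lr i.
  by apply: lip => //; exact: lt_le_trans h1.
by rewrite mulrC -ltr_pdivlMr.
Qed.

Lemma expRN_lip x y : 0 < x -> x <= y -> `|expR (- y) - expR (- x)| <= y - x.
Proof.
move=> x0 xy; have h1 : expR (- y) <= expR (- x) by rewrite ler_expR lerN2.
rewrite distrC ger0_norm ?subr_ge0//.
have -> : expR (- y) = expR (- x) * expR (- (y - x)).
  by rewrite -expRD; congr expR; lra.
have := expR_ge1Dx (- (y - x)); have : expR (- x) <= 1 by rewrite expR_le1; lra.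
have := expR_gt0 (- x); nra.
Qed.

Variables (p theta : R) (k : nat).
Hypotheses (hp : 2 <= p) (htheta : 0 <= theta) (hk : k%:R = p - 1).
Local Notation q := (p / (p - 1)).
Local Notation ball := (unit_ball p (p - 1) theta).

(* [u r = c exp (- l r)] with [c] and [l] fixed by the two energies [tau] and
   [1 - tau]; the excess only loses the factor [c^q], of order
   [tau^(1/(p-1))]. *)
Lemma test_function s : 0 < s -> exists2 M : R, 0 < M &
  forall tau, 0 < tau < 1 -> exists2 u, ball u &
    energy p theta u = (1 - tau)%:E /\
    ((M * tau `^ (p - 1)^-1 * (1 - tau))%:E <= excess p theta k s u)%E.
Proof.
move=> s0; have p2 := hp; have t0 := htheta.
have p0 : 0 < p by lra. have p10 : 0 < p - 1 by lra.
have q0 : 0 < q by rewrite divr_gt0.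
have qk : q * k.+1%:R = q * p by rewrite -addn1 natrD hk subrK.
have qE : q * p = p + q by field; rewrite gt_eqF.
have p1 : 1 <= p by lra.
have qp1 : 1 <= q * p by rewrite qE; lra.
have [A A0 AE] := exp_moment t0 p1.
have [B B0 BE] := exp_moment (ltW p10) p1.
have [C C0 CE] := exp_moment t0 qp1.
(* The first term of the excess has exponent [q p = p + q] in [u]. Up to its coefficient it
   integrates to [c^p c^q C l^(-(theta + 1))], with [c^p A l^(-(theta + 1)) = 1 - tau] and
   [c^q = (tau / B)^(1/(p - 1))]. *)
pose M := s ^+ k.+1 / k.+1`!%:R * (C / (A * B `^ (p - 1)^-1)).
have sk0 : 0 < s ^+ k.+1 / k.+1`!%:R by rewrite divr_gt0 ?exprn_gt0// ltr0n fact_gt0.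
have Bp0 : 0 < B `^ (p - 1)^-1 by rewrite powR_gt0.
exists M.
  by apply: mulr_gt0 => //; apply: divr_gt0 => //; exact: mulr_gt0.
move=> tau /andP[tau0 tau1].
pose c := (tau / B) `^ p^-1; have tB0 : 0 < tau / B by rewrite divr_gt0.
have c0 : 0 < c by rewrite powR_gt0.
have cp : c `^ p = tau / B by rewrite /c -powRrM mulVf ?gt_eqF// powRr1// ltW.
(* The dilation by [l] multiplies the energy [c^p A] of [w] by [1 / y], which brings it to
   [1 - tau]. *)
pose y := tau / B * A / (1 - tau); have y0 : 0 < y.
  by rewrite /y; apply: divr_gt0; [apply: mulr_gt0|lra].
pose l := y `^ (theta + 1)^-1; have l0 : 0 < l by rewrite powR_gt0.
have t10 : 0 < theta + 1 by lra.
have lt1 : l `^ (- (theta + 1)) = (1 - tau) / (tau / B * A).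
  by rewrite powRN /l -powRrM mulVf ?gt_eqF// powRr1 ?(ltW y0)// /y invf_div.
pose w r := c * expR (- r).
have dw x : is_derive x 1 w (- (c * expR (- x))) by exact: is_derive_expRN.
have dwE : derive1 w = (fun r => - (c * expR (- r))).
  by apply/funext => x; rewrite derive1E; have [_ ->] := dw x.
have mE : measurable_fun (`]0, +oo[ : set R) (fun r : R => expR (- r)).
  by apply: measurableT_comp => //; exact: measurableT_comp.
have mw : measurable_fun (`]0, +oo[ : set R) w by exact: measurable_funM.
have mw' : measurable_fun (`]0, +oo[ : set R) (derive1 w).
  by rewrite dwE; exact: measurableT_comp.
have nEa a : nnmeasurable (fun r : R => expR (- r) `^ a).
  split; last by move=> r _; exact: powR_ge0.
  by apply: (@measurableT_comp _ _ _ _ _ _ (fun x : R => x `^ a)); first exact: measurable_powR.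
have ac_w : loc_abs_continuous w.
  apply: (lipschitz_loc_ac c0) => x z x0 xz.
  by rewrite /w -mulrBr normrM (gtr0_norm c0) ler_pM2l// expRN_lip.
have w_oo : w r @[r --> +oo] --> 0.
  rewrite -(mulr0 c); apply: cvgMr.
  exact: cvgr_expR.
have wn r a : `|w r| `^ a = c `^ a * expR (- r) `^ a.
  by rewrite /w ger0_norm ?mulr_ge0 ?expR_ge0 ?(ltW c0)// powRM ?expR_ge0 ?(ltW c0).
have Jw : energy p theta w = (c `^ p * A)%:E.
  rewrite /energy (eq_int_lambda _ (fun r _ => wn r p)) int_lambdaZ ?powR_ge0//.
  by rewrite AE.
have Dw : energy p (p - 1) (derive1 w) = tau%:E.
  rewrite /energy (@eq_int_lambda _ _ _ (fun r => c `^ p * expR (- r) `^ p)); last first.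
    by move=> r _; rewrite dwE normrN; exact: wn.
  rewrite int_lambdaZ ?powR_ge0 ?(ltW p10)// BE -EFinM cp.
  by rewrite divfK// gt_eqF.
exists (fun r => w (l * r)).
  apply/(ballP hp htheta); split.
  - exact: loc_ac_dilation.
  - exact: cvg_dilation.
  - exact: measurable_fun_dilation.
  - rewrite (_ : derive1 _ = fun r => l * derive1 w (l * r)).
      by apply: measurable_funM => //; exact: measurable_fun_dilation.
    by apply/funext => r; exact: derive1_dilation.
  - have p_gt1 : 1 < p by rewrite -subr_gt0.
    rewrite (energy_dilation p t0 l0 mw) (energy_derive1_dilation p_gt1 l0 mw').
    rewrite Jw Dw lt1 cp -EFinM -EFinD lee_fin divfK; last by rewrite gt_eqF// mulr_gt0.
    by rewrite subrK.
split.
  rewrite (energy_dilation p t0 l0 mw) Jw lt1 cp -EFinM divfK//.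
  by rewrite gt_eqF// mulr_gt0.
have nx := nnmeasurable_exp_tail p k.+1 (ltW s0) (measurable_fun_dilation l0 mw).
have nw : nnmeasurable (fun r => `|w r| `^ (q * p)) by exact: nnmeasurable_powR.
have sk := ltW sk0.
apply: (@le_trans _ _ (int_lambda theta
    (fun r => (s ^+ k.+1 / k.+1`!%:R * `|w (l * r)| `^ (q * p))%R))); last first.
  apply: le_int_lambda => //.
    exact: nnmeasurableZ sk (nnmeasurable_dilation l0 nw).
  move=> r _; apply: le_trans (exp_tail_ge _ _); last by rewrite mulr_ge0 ?powR_ge0 ?ltW.
  by rewrite exprMn -(powR_mulrn _ (powR_ge0 _ _)) -powRrM qk mulrAC.
rewrite (int_lambdaZ t0 sk (nnmeasurable_dilation l0 nw)) (int_lambda_dilation t0 l0 nw).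
rewrite (eq_int_lambda _ (fun r _ => wn r (q * p))) int_lambdaZ ?powR_ge0// CE.
rewrite -!EFinM lee_fin lt1 le_eqVlt; apply/orP; left; apply/eqP.
have -> : c `^ (q * p) = tau / B * (tau `^ (p - 1)^-1 / B `^ (p - 1)^-1).
  rewrite qE powRD; last by apply/implyP => _; rewrite gt_eqF.
  rewrite cp; congr (_ * _); rewrite /c -powRrM.
  rewrite (_ : p^-1 * q = (p - 1)^-1); last by field; rewrite !gt_eqF.
  rewrite powRM ?invr_ge0 ?(ltW tau0) ?(ltW B0)//.
  by rewrite -(powR_inv1 (ltW B0)) -powRrM mulN1r powRN.
by rewrite /M; field; rewrite !gt_eqF//; lra.
Qed.

End TestFunctions.

(** * Compactness of the unit ball *)

Section EquicontinuousSequences.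
Context {R : realType}.
Implicit Types (r s e d : R).

(** The values lie in a compact segment, and a cluster point of an ultrafilter is a limit. *)
Lemma ultra_bounded_cvg (U : set_system nat) (g : nat -> R) (M : R) : UltraFilter U ->
  (forall n, `|g n| <= M) -> exists x : R, g @ U --> x.
Proof.
move=> UU gM.
have FF : ProperFilter (g @ U) by exact: fmap_proper_filter.
have [|x [_ xcl]] := @segment_compact R (- M) M (g @ U) FF.
  apply: nearW => n /=; rewrite in_itv/= -ler_norml; exact: gM.
exists x => V Vx.
have [//|UnV] := @in_ultra_setVsetC _ U (g @^-1` V) UU.
have [y [/= yV yV']] := xcl (~` V) V UnV Vx.
by [].
Qed.

Lemma filter_forall_lt (T : Type) (F : set_system T) {FF : Filter F}
  (A : nat -> set T) (N : nat) : (forall i, F (A i)) -> F [set t | forall i, (i < N)%N -> A i t].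
Proof.
move=> FA; elim: N => [|N ih]; first by apply: filterS (@filterT _ F FF).
apply: filterS (filterI ih (FA N)) => t [h1 h2] i.
by rewrite ltnS leq_eqVlt => /predU1P[->//|]; exact: h1.
Qed.

(* An ultrafilter provides the limit at every point at once; a genuine
   subsequence is recovered by matching it on the grids [i / m], and
   equicontinuity transfers the convergence to the other points. *)
Lemma equicontinuous_subsequence (f_ : nat -> R -> R) (a_ : nat -> R) :
  (forall r, 0 < r -> exists M : R, forall n, `|f_ n r| <= M) ->
  (forall n, `|a_ n| <= 1) ->
  (forall r e, 0 < r -> 0 < e -> exists2 d, 0 < d &
    forall n s, r < s < r + d -> `|f_ n s - f_ n r| <= e) ->
  exists n_ : nat -> nat, exists u : R -> R, exists a : R,
  [/\ forall m, (m <= n_ m)%N,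
      forall r, 0 < r -> f_ (n_ m) r @[m --> \oo] --> u r &
      a_ (n_ m) @[m --> \oo] --> a].
Proof.
move=> bnd a1 equi.
have [U [UU ooU]] := @ultraFilterLemma nat \oo _.
have PU : ProperFilter U by exact: ultra_proper.
have FU : Filter U by exact: PU.
have [a Ua] := ultra_bounded_cvg UU a1.
have uex (r : R) : exists y : R, 0 < r -> (fun n => f_ n r) @ U --> y.
  have [r0|r0] := ltP 0 r; last by exists 0.
  have [M HM] := bnd r r0; have [x Hx] := ultra_bounded_cvg UU HM.
  by exists x.
have [u Hu] := choice uex.
(* Positive nodes of mesh [1 / (m + 1)]; those with [i < (m + 1)^2] reach up to [m + 1]. *)
pose grid (m i : nat) : R := i.+1%:R / m.+1%:R.
have grid0 m i : 0 < grid m i by rewrite divr_gt0.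
have ball_U (g : nat -> R) (y e : R) : 0 < e -> g @ U --> y -> U [set n | `|g n - y| < e].
  move=> e0 /cvgrPdist_lt/(_ _ e0); apply: filterS => n /=; by rewrite distrC.
have nex (m : nat) : exists n, [/\ (m <= n)%N, `|a_ n - a| < m.+1%:R^-1 &
    forall i, (i < m.+1 * m.+1)%N -> `|f_ n (grid m i) - u (grid m i)| < m.+1%:R^-1].
  have m0 : 0 < m.+1%:R^-1 :> R by rewrite invr_gt0.
  have U1 : U [set n | (m <= n)%N] by apply: ooU; exact: nbhs_infty_ge.
  have U2 := ball_U _ _ _ m0 Ua.
  have U3 := @filter_forall_lt _ U FU _ (m.+1 * m.+1)
    (fun i => ball_U _ _ _ m0 (Hu (grid m i) (grid0 m i))).
  have [n [h1 [h2 h3]]] := filter_ex (filterI U1 (filterI U2 U3)).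
  by exists n.
have [n_ Hn] := choice nex.
exists n_, u, a; split.
- by move=> m; have [] := Hn m.
- move=> r r0; apply/cvgrPdist_lt => e e0.
  have e40 : 0 < e / 4 by rewrite divr_gt0.
  have [d d0 Hd] := equi r (e / 4) r0 e40.
  have ud s : r < s < r + d -> `|u s - u r| <= e / 4.
    move=> rs; have /andP[rs1 _] := rs.
    have s0 : 0 < s by exact: lt_trans rs1.
    have cv : (fun n => `|f_ n s - f_ n r|) @ U --> `|u s - u r|.
      by apply: cvg_norm; apply: cvgB; exact: Hu.
    rewrite -(cvg_lim _ cv)//; apply: limr_le; first by apply/cvg_ex; eexists; exact: cv.
    by apply: nearW => n; exact: Hd.
  near=> m.
  have md : m.+1%:R^-1 < d by near: m; exact: near_infty_natSinv_lt (PosNum d0).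
  have me : m.+1%:R^-1 < e / 4 by near: m; exact: near_infty_natSinv_lt (PosNum e40).
  have mr : r < m.+1%:R.
    apply: (@lt_le_trans _ _ m%:R); last by rewrite ler_nat.
    by near: m; exact: nbhs_infty_gtr.
  have [_ _ Hm] := Hn m.
  (* Because of the shift in [grid], the node of index [i] is the first one strictly to the right of
     [r], the side on which equicontinuity is assumed. *)
  pose i := Num.truncn (r * m.+1%:R).
  have rm0 : 0 <= r * m.+1%:R by rewrite mulr_ge0// ltW.
  have /andP[i1 i2] := truncn_itv rm0; rewrite -/i in i1 i2.
  have im : (i < m.+1 * m.+1)%N.
    rewrite -(ltr_nat R) natrM; apply: le_lt_trans i1 _.
    by rewrite ltr_pM2r.
  have rg : r < grid m i < r + d.
    rewrite /grid ltr_pdivlMr// i2/= -(natr1 i) mulrDl mul1r.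
    have : i%:R / m.+1%:R <= r by rewrite ler_pdivrMr.
    by move=> h; exact: ler_ltD h md.
  have h1 := Hd (n_ m) _ rg; have h2 := lt_trans (Hm i im) me; have h3 := ud _ rg.
  move: h1 h2 h3; rewrite !ler_norml !ltr_norml => /andP[? ?] /andP[? ?] /andP[? ?].
  by apply/andP; split; lra.
- apply/cvgrPdist_lt => e e0; near=> m; have [_ h _] := Hn m.
  rewrite distrC; apply: lt_trans h _.
  by near: m; exact: near_infty_natSinv_lt (PosNum e0).
Unshelve. all: by end_near. Qed.

End EquicontinuousSequences.

Section ContinuityLemmas.
Context {R : realType}.

Lemma normr_powR_continuous (p : R) : 0 < p -> continuous (fun x : R => `|x| `^ p).
Proof.
move=> p0 x; have [->|x0] := eqVneq x 0; last first.
  apply: (@continuous_comp _ _ _ (@Num.Def.normr R R) (fun y => y `^ p)).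
    exact: norm_continuous.
  by apply: powR_continuous_gt0; rewrite normr_gt0.
apply/cvgrPdist_lt => e e0; rewrite normr0 powR0 ?gt_eqF//.
have d0 : 0 < e `^ p^-1 by rewrite powR_gt0.
near=> y; rewrite sub0r normrN ger0_norm ?powR_ge0//.
have : `|y| < e `^ p^-1.
  by rewrite -[y]subr0 distrC; near: y; apply/nbhs_ballP; exists (e `^ p^-1).
move=> /(gt0_ltr_powR p0); rewrite !nnegrE normr_ge0 powR_ge0 => /(_ isT isT).
by rewrite -powRrM mulVf ?gt_eqF// powRr1// ltW.
Unshelve. all: by end_near. Qed.

Lemma cvg_sum_ord n (f : 'I_n -> nat -> R) (x : 'I_n -> R) :
  (forall i, f i m @[m --> \oo] --> x i) ->
  (\sum_(i < n) f i m) @[m --> \oo] --> \sum_(i < n) x i.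
Proof.
move=> fx; have -> : (fun m => \sum_(i < n) f i m) = \sum_(i < n) f i.
  by apply/funext => m; rewrite fct_sumE.
apply: (big_ind2 (fun (F : nat -> R) (y : R) => F @ \oo --> y)) => //.
  exact: cvg_cst.
by move=> F y G z Fy Gz; exact: cvgD.
Qed.

End ContinuityLemmas.

(** * Limits of sequences in the unit ball *)

Section Compactness.
Context {R : realType}.
Variables (p theta : R).
Hypotheses (hp : 2 <= p) (htheta : 0 <= theta).
Implicit Types (e r s : R) (u : R -> R).

Local Notation q := (p / (p - 1)).
Local Notation ball := (unit_ball p (p - 1) theta).
Local Notation K := ((omega (p - 1))^-1 `^ p^-1).

Let p0 : 0 < p. Proof. exact: lt_le_trans hp. Qed.
Let p10 : 0 < p - 1. Proof. by rewrite subr_gt0; apply: lt_le_trans hp; rewrite ltr1n. Qed.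
Let p1 : 1 < p. Proof. by rewrite -subr_gt0. Qed.
Let q0 : 0 < q. Proof. by rewrite divr_gt0. Qed.
Let pq : p^-1 + q^-1 = 1. Proof. by field; rewrite !gt_eqF. Qed.
Let wa : 0 < omega (p - 1). Proof. by apply: omega_gt0; exact: ltW. Qed.
Let K0 : 0 < K. Proof. by rewrite powR_gt0// invr_gt0. Qed.

Lemma ball_pointwise_bounded r : 0 < r ->
  exists M : R, forall u, ball u -> `|u r| <= M.
Proof.
move=> r0; have [r1 r11 dec] := ball_decay hp htheta ltr01.
case: (leP r1 r) => rr1; first by exists 1 => u bu; exact: dec.
exists (1 + K * ln (r1 / r) `^ q^-1) => u bu.
have := ball_modulus hp htheta bu r0 rr1; have := dec u r1 bu (lexx _).
have : `|u r| <= `|u r1| + `|u r1 - u r|.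
  by rewrite distrC -{1}(subrK (u r1) (u r)) addrC ler_normD.
by lra.
Qed.

Lemma ln_div_le r s : 0 < r -> r <= s -> ln (s / r) <= (s - r) / r.
Proof.
move=> r0 rs; have -> : s / r = 1 + (s - r) / r by field; rewrite gt_eqF.
apply: le_ln1Dx; apply: (@lt_le_trans _ _ 0); first by lra.
by rewrite divr_ge0 ?subr_ge0// ltW.
Qed.

Lemma ball_equicontinuous r e : 0 < r -> 0 < e -> exists2 d, 0 < d &
  forall u s, ball u -> r < s < r + d -> `|u s - u r| <= e.
Proof.
move=> r0 e0; have eK0 : 0 < e / K by rewrite divr_gt0.
exists (r * (e / K) `^ q); first by rewrite mulr_gt0// powR_gt0.
move=> u s bu /andP[rs sd]; apply: le_trans (ball_modulus hp htheta bu r0 rs) _.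
rewrite -ler_pdivlMl// [leRHS]mulrC.
have ln0 : 0 <= ln (s / r) by rewrite ln_ge0// ler_pdivlMr// mul1r ltW.
have lnle : ln (s / r) <= (e / K) `^ q.
  apply: le_trans (ln_div_le r0 (ltW rs)) _.
  by rewrite ler_pdivrMr// mulrC; lra.
have : ln (s / r) `^ q^-1 <= ((e / K) `^ q) `^ q^-1.
  by apply: ge0_ler_powR; rewrite ?nnegrE ?invr_ge0 ?(ltW q0) ?powR_ge0.
by rewrite -powRrM mulfV ?gt_eqF// powRr1 ?(ltW eK0).
Qed.

Section Limit.
Variables (v_ : nat -> R -> R) (u : R -> R) (a : R).
Hypotheses (vball : forall m, ball (v_ m))
  (vu : forall r, 0 < r -> v_ m r @[m --> \oo] --> u r)
  (va : fine (energy p theta (v_ m)) @[m --> \oo] --> a).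

(** The constants of [ac_sum_bound] do not depend on [m], so one modulus serves all [v_ m], and
    finite sums pass to the limit. *)
Lemma limit_loc_ac : loc_abs_continuous u.
Proof.
move=> x y x0 xy e e0.
(* [c] makes the energy term equal to [e / 4]; a small total length then makes the logarithmic term
   at most [e / 4]. The resulting [e / 2] leaves room for a strict inequality after the limit. *)
pose c := (e / 4 * p * omega (p - 1)) `^ p^-1.
have e4 : 0 < e / 4 by rewrite divr_gt0.
have epw : 0 < e / 4 * p * omega (p - 1) by apply: mulr_gt0 => //; exact: mulr_gt0.
have c0 : 0 < c by exact: powR_gt0.
have cE : c `^ p / p * (1 / omega (p - 1)) = e / 4.
  rewrite /c -powRrM mulVf ?gt_eqF// powRr1 ?(ltW epw)//.
  by field; rewrite !gt_eqF.
pose C := c `^ (- q) / q; have C0 : 0 < C by rewrite divr_gt0// powR_gt0.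
exists (e / 4 * x / C); first by apply: divr_gt0 => //; exact: mulr_gt0.
move=> n l r lr dis sm.
have lr' i : 0 < l i /\ l i <= r i.
  by have [h1 [h2 _]] := lr i; split => //; exact: lt_le_trans h1.
have bound m : \sum_(i < n) `|v_ m (r i) - v_ m (l i)| <= e / 2.
  have [ac _ _ mu' _] := (ballP hp htheta (v_ m)).1 (vball m).
  have := ac_sum_bound hp pq q0 c0 ac mu' (ball_energy_derive1 hp htheta (vball m)) lr' dis.
  rewrite cE -/C => /le_trans; apply.
  have : C * \sum_(i < n) ln (r i / l i) <= C * (\sum_(i < n) (r i - l i) / x).
    rewrite ler_pM2l//; apply: ler_sum => i _.
    have [h1 [h2 h3]] := lr i; have [li0 _] := lr' i.
    apply: le_trans (ln_div_le li0 h2) _.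
    by rewrite ler_wpM2l ?subr_ge0// lef_pV2.
  have : C * (\sum_(i < n) (r i - l i) / x) <= e / 4.
    by rewrite -mulr_suml mulrA ler_pdivrMr// mulrC -ler_pdivlMr// ltW.
  by lra.
apply: (@le_lt_trans _ _ (e / 2)); last by lra.
have cv : (\sum_(i < n) `|v_ m (r i) - v_ m (l i)|) @[m --> \oo] -->
    \sum_(i < n) `|u (r i) - u (l i)|.
  apply: cvg_sum_ord => i; apply: cvg_norm; have [li0 lri] := lr' i.
  by apply: cvgB; apply: vu => //; exact: lt_le_trans lri.
rewrite -(cvg_lim _ cv)//; apply: limr_le; first by apply/cvg_ex; eexists; exact: cv.
exact: nearW.
Qed.

Lemma limit_cvg0 : u r @[r --> +oo] --> 0.
Proof.
apply/cvgrPdist_le => e e0; have [r0 r01 dec] := ball_decay hp htheta e0.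
near=> r; rewrite sub0r normrN.
have rr : r0 <= r by near: r; apply: nbhs_pinfty_ge; exact: num_real.
have cv : `|v_ m r| @[m --> \oo] --> `|u r|.
  by apply: cvg_norm; apply: vu; lra.
rewrite -(cvg_lim _ cv)//; apply: limr_le; first by apply/cvg_ex; eexists; exact: cv.
by apply: nearW => m; exact: dec.
Unshelve. all: by end_near. Qed.

Lemma limit_measurable : measurable_fun (`]0, +oo[ : set R) u.
Proof.
apply: (@measurable_fun_cvg _ _ _ _ v_).
  by move=> m; have [] := (ballP hp htheta (v_ m)).1 (vball m).
by move=> r; rewrite /= in_itv/= andbT; exact: vu.
Qed.

Lemma limit_measurable_derive1 : measurable_fun (`]0, +oo[ : set R) (derive1 u).
Proof.
apply: continuous_measurable_derive1 => x x0.
exact: loc_ac_continuous limit_loc_ac x0.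
Qed.

Let Jfin m : energy p theta (v_ m) \is a fin_num.
Proof.
rewrite ge0_fin_numE ?energy_ge0//.
exact: le_lt_trans (ball_energy hp htheta (vball m)) (ltry _).
Qed.

Lemma limit_energy : (energy p theta u <= a%:E)%E.
Proof.
apply: (int_lambda_fatou htheta (f_ := fun m r => `|v_ m r| `^ p)
  (f := fun r => `|u r| `^ p) _ _ _).2 => [m|r r0|e e0].
- apply: nnmeasurable_powR.
  by have [] := (ballP hp htheta (v_ m)).1 (vball m).
- apply: (cvg_comp (fun n => v_ n r) (fun x : R => `|x| `^ p)); first exact: vu.
  exact: normr_powR_continuous.
- near=> m; rewrite -[X in (X <= _)%E](fineK (Jfin m)) lee_fin.
  have : `|a - fine (energy p theta (v_ m))| < e.
    by near: m; move/cvgrPdist_lt : va; exact.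
  by rewrite ltr_norml => /andP[]; lra.
Unshelve. all: by end_near. Qed.

Let Dfin m : energy p (p - 1) (derive1 (v_ m)) \is a fin_num.
Proof.
rewrite ge0_fin_numE ?energy_ge0 ?(ltW p10)//.
exact: le_lt_trans (ball_energy_derive1 hp htheta (vball m)) (ltry _).
Qed.

Let JD m : fine (energy p (p - 1) (derive1 (v_ m))) <= 1 - fine (energy p theta (v_ m)).
Proof.
have [_ _ _ _] := (ballP hp htheta (v_ m)).1 (vball m).
rewrite -[X in (X + _ <= _)%E](fineK (Jfin m)) -[X in (_ + X <= _)%E](fineK (Dfin m)).
by rewrite -EFinD lee_fin lerBrDl.
Qed.

(** A slope involves only two values of the function, so it converges pointwise, unlike the
    derivative. The energies of the slopes are at most [1 - J] for [v_ m], which tends to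
    [1 - a]. *)
Lemma limit_energy_slope h : 0 < h ->
  nnmeasurable (fun r => `|slope u h r| `^ p) /\
  (int_lambda (p - 1) (fun r => (`|slope u h r| `^ p)%R) <= (1 - a)%:E)%E.
Proof.
move=> h0.
have sl m : nnmeasurable (fun r => `|slope (v_ m) h r| `^ p) /\
    (int_lambda (p - 1) (fun r => (`|slope (v_ m) h r| `^ p)%R) <=
     (fine (energy p (p - 1) (derive1 (v_ m))))%:E)%E.
  have [ac _ _ mu' _] := (ballP hp htheta (v_ m)).1 (vball m).
  by apply: energy_slope_le pq h0 ac mu' _ => //; rewrite fineK.
apply: (int_lambda_fatou (ltW p10) (f_ := fun m r => `|slope (v_ m) h r| `^ p)
  (f := fun r => `|slope u h r| `^ p)).
- by move=> m; have [] := sl m.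
- move=> r r0; apply: (cvg_comp (fun n => slope (v_ n) h r) (fun x : R => `|x| `^ p));
    last exact: normr_powR_continuous.
  apply: cvgM; last exact: cvg_cst.
  by apply: cvgB; apply: vu => //; exact: addr_gt0.
- move=> e e0; near=> m; apply: le_trans (sl m).2 _; rewrite lee_fin.
  apply: le_trans (JD m) _.
  have : `|a - fine (energy p theta (v_ m))| < e.
    by near: m; move/cvgrPdist_lt : va; exact.
  by rewrite ltr_norml => /andP[]; lra.
Unshelve. all: by end_near. Qed.

(* Where [u] is not derivable [derive1 u] vanishes, so truncating the slopes by
   [|derive1 u|] makes them converge everywhere. *)
Lemma limit_energy_derive1 : (energy p (p - 1) (derive1 u) <= (1 - a)%:E)%E.
Proof.
have nd := nnmeasurable_powR p limit_measurable_derive1.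
pose f_ (m : nat) r := Num.min (`|slope u m.+1%:R^-1 r| `^ p) (`|derive1 u r| `^ p).
have h0 (m : nat) : 0 < m.+1%:R^-1 :> R by rewrite invr_gt0.
have nf m : nnmeasurable (f_ m).
  split; last by move=> r _; rewrite le_min !powR_ge0.
  apply: measurable_minr; last exact: nd.1.
  exact: (limit_energy_slope (h0 m)).1.1.
apply: (int_lambda_fatou (ltW p10) (f_ := f_) (f := fun r => `|derive1 u r| `^ p) _ _ _).2
  => // [r r0|e e0].
  have [du|ndu] := pselect (derivable u r 1).
    pose c := `|derive1 u r| `^ p.
    have cmin : Num.min y c @[y --> c] --> c.
      rewrite -[X in _ --> X](minxx c).
      apply: (@continuous_min _ _ id (cst c)); [exact: cvg_id|exact: cst_continuous].
    apply: (cvg_comp (fun n => `|slope u n.+1%:R^-1 r| `^ p) (fun y : R => Num.min y c) _ cmin).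
    apply: (cvg_comp (fun n => slope u n.+1%:R^-1 r) (fun x : R => `|x| `^ p)).
      exact: derivable_slope_seq.
    exact: normr_powR_continuous.
  have -> : (fun m => f_ m r) = cst 0.
    apply/funext => m; rewrite /f_ (derive1_nderivable ndu) normr0 powR0 ?gt_eqF//.
    by rewrite min_r ?powR_ge0.
  by rewrite (derive1_nderivable ndu) normr0 powR0 ?gt_eqF//; exact: cvg_cst.
apply: nearW => m; have [nsl ssl] := limit_energy_slope (h0 m).
apply: (@le_trans _ _ (1 - a)%:E); last by rewrite lee_fin lerDl ltW.
apply: le_trans ssl; apply: le_int_lambda => //; first exact: ltW.
by move=> r _; rewrite /f_ ge_min lexx.
Qed.

End Limit.

(** The separate bounds [a] and [1 - a] say more than membership in the ball: they leave room to
    raise the energy of [u] up to [a]. *)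
Lemma ball_compact (u_ : nat -> R -> R) : (forall n, ball (u_ n)) ->
  exists n_ : nat -> nat, exists u : R -> R, exists a : R,
  [/\ forall m, (m <= n_ m)%N,
      forall r, 0 < r -> u_ (n_ m) r @[m --> \oo] --> u r,
      fine (energy p theta (u_ (n_ m))) @[m --> \oo] --> a &
      [/\ loc_abs_continuous u, u r @[r --> +oo] --> 0,
        measurable_fun (`]0, +oo[ : set R) u,
        measurable_fun (`]0, +oo[ : set R) (derive1 u) &
        (energy p theta u <= a%:E /\ energy p (p - 1) (derive1 u) <= (1 - a)%:E)%E]].
Proof.
move=> bu.
have J1 n : `|fine (energy p theta (u_ n))| <= 1.
  have J0 : (0 <= energy p theta (u_ n))%E by exact: energy_ge0.
  have J1 := ball_energy hp htheta (bu n).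
  rewrite ger0_norm ?fine_ge0// -lee_fin fineK// ge0_fin_numE//.
  exact: le_lt_trans J1 (ltry _).
have [r r0|r e r0 e0|n_ [u [a [nm cu ca]]]] :=
  @equicontinuous_subsequence R u_ (fun n => fine (energy p theta (u_ n))) _ J1 _.
- by have [M HM] := ball_pointwise_bounded r0; exists M => n; exact: HM.
- have [d d0 Hd] := ball_equicontinuous r0 e0.
  by exists d => // n s; exact: Hd.
exists n_, u, a; split => //.
have vb m : ball (u_ (n_ m)) by exact: bu.
split.
- exact: limit_loc_ac vb cu.
- exact: limit_cvg0 vb cu.
- exact: limit_measurable vb cu.
- exact: limit_measurable_derive1 vb cu.
- by split; [exact: limit_energy vb cu ca|exact: limit_energy_derive1 vb cu ca].
Qed.

End Compactness.

(** * Existence of maximizers and the threshold *)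

Section Attainment.
Context {R : realType}.
Variables (p theta : R) (k : nat).
Hypotheses (hp : 2 <= p) (htheta : 0 <= theta) (hk : k%:R = p - 1).
Implicit Types (c e r s x : R) (u : R -> R).

Local Notation q := (p / (p - 1)).
Local Notation ball := (unit_ball p (p - 1) theta).
Local Notation excess := (excess p theta k).

Let p0 : 0 < p. Proof. exact: lt_le_trans hp. Qed.
Let p10 : 0 < p - 1. Proof. by rewrite subr_gt0; apply: lt_le_trans hp; rewrite ltr1n. Qed.
Let q0 : 0 < q. Proof. by rewrite divr_gt0. Qed.
Let t10 : 0 < theta + 1. Proof. by rewrite ltr_wpDl. Qed.

(** Below [r1] the excess converges by domination; beyond [r1] it is at most [c1 * d^q] times an
    energy bounded by 1. *)
Lemma excess_limsup s (v_ : nat -> R -> R) u e : 0 < s -> s < Defs.mu (p - 1) theta ->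
  (forall m, ball (v_ m)) ->
  (forall r, 0 < r -> v_ m r @[m --> \oo] --> u r) ->
  measurable_fun (`]0, +oo[ : set R) u ->
  (excess s u < +oo)%E -> 0 < e ->
  \forall m \near \oo, (excess s (v_ m) <= (fine (excess s u) + e)%:E)%E.
Proof.
move=> s0 smu vb vu mu_ Efin e0.
pose c1 := s ^+ k.+1 * expR s.
have c10 : 0 < c1 by rewrite mulr_gt0 ?exprn_gt0 ?expR_gt0.
have ec0 : 0 < e / 2 / c1 by rewrite !divr_gt0.
(* Small enough for [c1 * d^q <= e / 2], and at most 1 as [exp_tail_small_le] and the exponent bound
   at [r1] require. *)
pose d := Num.min 1 ((e / 2 / c1) `^ q^-1).
have d0 : 0 < d by rewrite lt_min ltr01 powR_gt0.
have d1 : d <= 1 by rewrite ge_min lexx.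
have dq : c1 * d `^ q <= e / 2.
  rewrite -ler_pdivlMl// [leRHS]mulrC.
  have : d `^ q <= ((e / 2 / c1) `^ q^-1) `^ q.
    by apply: ge0_ler_powR; rewrite ?nnegrE ?powR_ge0 ?(ltW q0) ?(ltW d0) ?ge_min ?lexx ?orbT.
  by rewrite -powRrM mulVf ?gt_eqF// powRr1 ?(ltW ec0).
have [r1 r11 dec] := ball_decay hp htheta d0.
have r10 : 0 < r1 by lra.
have [kappa [C [kt C0 expb]]] := ball_exponent_bound hp htheta s0 smu.
have /= [nH HB] := dominating_integrable htheta C kt r10.
set H := (fun r => _) in nH HB.
have mv m : measurable_fun (`]0, +oo[ : set R) (v_ m).
  by have [] := (ballP hp htheta (v_ m)).1 (vb m).
pose f (w : R -> R) (r : R) := exp_tail k.+1 (s * `|w r| `^ q).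
pose g (w : R -> R) (r : R) := if r < r1 then f w r else 0.
have nf w : measurable_fun (`]0, +oo[ : set R) w -> nnmeasurable (f w).
  exact: nnmeasurable_exp_tail (ltW s0).
have ng w : measurable_fun (`]0, +oo[ : set R) w -> nnmeasurable (g w).
  by move=> mw; apply: nnmeasurable_patch; exact: nf.
have f0 w r : 0 <= f w r by rewrite exp_tail_ge0// mulr_ge0 ?powR_ge0 ?ltW.
have cv : int_lambda theta (g (v_ m)) @[m --> \oo] --> int_lambda theta (g u).
  apply: (@int_lambda_dominated _ _ htheta (fun m => g (v_ m)) (g u) H) => //.
  - by move=> m; exact: ng.
  - move=> r r0; rewrite /g; case: ifPn => _; last exact: cvg_cst.
    apply: (cvg_comp (fun m => s * `|v_ m r| `^ q) (exp_tail k.+1)); last exact: exp_tail_continuous.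
    apply: cvgMr; apply: (cvg_comp (fun m => v_ m r) (fun x : R => `|x| `^ q)); first exact: vu.
    exact: normr_powR_continuous.
  - move=> m r r0; rewrite /g /H; case: ifPn => // rr1.
    apply: le_trans (exp_tail_le_expR _ _) _; first by rewrite mulr_ge0 ?powR_ge0 ?ltW.
    rewrite ler_expR; apply: expb => //.
    by apply: le_trans d1; exact: dec.
have gu : (int_lambda theta (g u) <= excess s u)%E.
  apply: le_int_lambda => //; [exact: ng|exact: nf|].
  by move=> r _; rewrite /g; case: ifPn => // _; exact: f0.
have gu0 : (0 <= int_lambda theta (g u))%E by apply: int_lambda_ge0 => //; have [] := ng _ mu_.
have gfin : int_lambda theta (g u) \is a fin_num.
  by rewrite ge0_fin_numE//; exact: le_lt_trans gu Efin.
have Ef : excess s u \is a fin_num by rewrite ge0_fin_numE// excess_ge0// ltW.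
have e20 : 0 < e / 2 by rewrite divr_gt0.
move: cv; rewrite -(fineK gfin) => /fine_cvgP[finm cvm].
have gle : fine (int_lambda theta (g u)) <= fine (excess s u) by exact: fine_le.
near=> m.
have fm : int_lambda theta (g (v_ m)) \is a fin_num by near: m.
have lim : `|fine (int_lambda theta (g u)) - fine (int_lambda theta (g (v_ m)))| < e / 2.
  by near: m; move/cvgrPdist_lt : cvm; exact.
have nJ : nnmeasurable (fun r => `|v_ m r| `^ p) by exact: nnmeasurable_powR.
have cd0 : 0 <= c1 * d `^ q by rewrite mulr_ge0 ?powR_ge0 ?ltW.
apply: (@le_trans _ _ (int_lambda theta (fun r => g (v_ m) r + c1 * d `^ q * `|v_ m r| `^ p))).
  apply: le_int_lambda => //; first exact: nf.
    by apply: nnmeasurableD; [exact: ng|exact: nnmeasurableZ].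
  move=> r r0; rewrite /g; case: ltP => rr1.
    by rewrite lerDl mulr_ge0 // powR_ge0.
  rewrite add0r; have := @exp_tail_small_le _ p k hp hk 1 s d (v_ m r) (ltW s0) (dec _ _ (vb m) rr1) d1.
  by rewrite addn1 expr1.
rewrite (int_lambdaD htheta (ng _ (mv m)) (nnmeasurableZ cd0 nJ)) (int_lambdaZ htheta cd0 nJ).
apply: (@le_trans _ _ (int_lambda theta (g (v_ m)) + (c1 * d `^ q)%:E * 1%:E)%E).
  apply: leeD; first exact: lexx.
  apply: lee_wpmul2l; first by rewrite lee_fin.
  exact: (ball_energy hp htheta (vb m)).
rewrite -(fineK fm) mule1 -EFinD lee_fin.
have : fine (int_lambda theta (g (v_ m))) <= fine (excess s u) + e / 2.
  apply: le_trans (lerD gle (lexx _)); rewrite -lerBlDl.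
  by apply: le_trans (ltW lim); rewrite distrC ler_norm.
by move=> /lerD/(_ dq)/le_trans; apply; rewrite -addrA -splitr.
Unshelve. all: by end_near. Qed.

(* A maximizing sequence can only lose energy at infinity: if [a] is the limit
   of the energies [J] and [b = J u], then [T <= (s^k / k!) a + excess u].
   Unless [u = 0], the dilation that raises [J u] from [b] to [a] keeps
   [energy (derive1 u) <= 1 - a], so it stays in the ball, and does not decrease
   the excess. *)
Lemma TMC_attained_of_gt s : 0 < s -> s < Defs.mu (p - 1) theta ->
  ((s ^+ k / k`!%:R)%:E < TMC p (p - 1) theta s)%E ->
  TMC_attained p (p - 1) theta s.
Proof.
move=> s0 smu gtT; have sle := ltW s0.
set c := s ^+ k / k`!%:R in gtT.
have c0 : 0 < c by rewrite divr_gt0 ?exprn_gt0// ltr0n fact_gt0.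
have Toof := TMC_fin hp htheta hk s0 smu.
have TMle := @TMC_ge _ p theta s; rewrite /TMC_attained.
have Tgt x : (x%:E < TMC p (p - 1) theta s)%E ->
    exists u, ball u /\ (x%:E < TM_functional p theta s u)%E.
  by move=> /ereal_sup_gt[_ [u bu <-] ?]; exists u.
move: (TMC _ _ _ _) => T in gtT Toof TMle Tgt *.
have Tfin : T \is a fin_num.
  rewrite ge0_fin_numE; first exact: Toof.
  by apply: le_trans (ltW gtT); rewrite lee_fin ltW.
have split_ u : measurable_fun (`]0, +oo[ : set R) u ->
    TM_functional p theta s u = (c%:E * energy p theta u + excess s u)%E.
  by move=> mu_; exact: TM_functional_split.
have uex (n : nat) : exists u, ball u /\ ((fine T - n.+1%:R^-1)%:E < TM_functional p theta s u)%E.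
  have n0 : 0 < n.+1%:R^-1 :> R by rewrite invr_gt0.
  by apply: Tgt; rewrite -[ltRHS](fineK Tfin) lte_fin ltrBlDr ltrDl.
have [u_ Hu] := choice uex.
have bu n : ball (u_ n) by have [] := Hu n.
have [n_ [u [a [nm cu ca [ac u0 mu_ mu' [Jua Dua]]]]]] := ball_compact hp htheta bu.
have J0 := energy_ge0 p u htheta.
have D0 : (0 <= energy p (p - 1) (derive1 u))%E by apply: energy_ge0; exact: ltW.
have ub : ball u.
  apply/ballP => //; split => //; apply: le_trans (leeD Jua Dua) _.
  by rewrite -EFinD lee_fin addrC subrK.
have a1 : a <= 1 by have := le_trans D0 Dua; rewrite lee_fin subr_ge0.
have a0 : 0 <= a by have := le_trans J0 Jua; rewrite lee_fin.
have E0 := excess_ge0 p k htheta u sle.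
have Jf : energy p theta u \is a fin_num.
  by rewrite (ge0_fin_numE J0); exact: le_lt_trans Jua (ltry _).
have Eoo : (excess s u < +oo)%E.
  have := le_lt_trans (TMle _ ub) Toof.
  rewrite split_//; apply: le_lt_trans.
  by apply: leeDr; apply: mule_ge0; [rewrite lee_fin (ltW c0)|exact: J0].
have Ef : excess s u \is a fin_num by rewrite (ge0_fin_numE E0); exact: Eoo.
set b := fine (energy p theta u); set G := fine (excess s u).
have bE : energy p theta u = b%:E by rewrite fineK.
have GE : excess s u = G%:E by rewrite fineK.
have ba : b <= a by rewrite -lee_fin -bE.
have G0 : 0 <= G by rewrite -lee_fin -GE.
(* Three errors of size [e / 3] add up: in the excess, in [c] times the energy, and in the distance
   of the functional from the supremum. *)
have TG : fine T <= c * a + G.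
  apply/ler_addgt0Pr => e e0.
  have e30 : 0 < e / 3 by rewrite divr_gt0.
  have e3c0 : 0 < e / 3 / c by rewrite divr_gt0.
  have vb m : ball (u_ (n_ m)) := bu (n_ m).
  have lim := excess_limsup s0 smu vb cu mu_ Eoo e30.
  have H2 : \forall m \near \oo, `|a - fine (energy p theta (u_ (n_ m)))| < e / 3 / c.
    by move/cvgrPdist_lt : ca; exact.
  have H3 : \forall m \near \oo, m.+1%:R^-1 < e / 3.
    exact: near_infty_natSinv_lt (PosNum e30).
  have [m [h1 [h2 h3]]] := filter_ex (filterI lim (filterI H2 H3)).
  have h4 : (n_ m).+1%:R^-1 <= m.+1%:R^-1 :> R by rewrite lef_pV2 ?posrE// ler_nat ltnS.
  have [_] := Hu (n_ m).
  have mun : measurable_fun (`]0, +oo[ : set R) (u_ (n_ m)).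
    by have [] := (ballP hp htheta _).1 (vb m).
  have Jn : energy p theta (u_ (n_ m)) \is a fin_num.
    rewrite (ge0_fin_numE (energy_ge0 _ _ htheta)).
    exact: le_lt_trans (ball_energy hp htheta (vb m)) (ltry _).
  rewrite (split_ _ mun) => TMgt.
  have h5 : fine T - (n_ m).+1%:R^-1 < c * fine (energy p theta (u_ (n_ m))) + (G + e / 3).
    rewrite -lte_fin; apply: (lt_le_trans TMgt).
    by rewrite EFinD (EFinM c) (fineK Jn); apply: leeD; [exact: lexx|exact: h1].
  have h6 : c * fine (energy p theta (u_ (n_ m))) <= c * a + e / 3.
    have : fine (energy p theta (u_ (n_ m))) <= a + e / 3 / c.
      by move: h2; rewrite ltr_norml => /andP[]; lra.
    by rewrite -(ler_pM2l c0) mulrDr [X in _ <= _ + X]mulrC divfK// gt_eqF.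
  by set x := (n_ m).+1%:R^-1 in h4 h5; set y := m.+1%:R^-1 in h3 h4; lra.
have cT : c < fine T by rewrite -lte_fin fineK.
(* Vanishing is excluded here: zero energy forces zero excess, hence [T <= c * a <= c]. *)
have b0 : 0 < b.
  rewrite lt_neqAle -lee_fin -bE J0 andbT; apply/eqP => b0.
  have : excess s u = 0%E by apply/(excess_eq0 k hp htheta s0 mu_); rewrite bE -b0.
  rewrite GE => -[G0'].
  have : c * a <= c by rewrite ger_pMr.
  by lra.
have a00 : 0 < a by exact: lt_le_trans ba.
pose l := (b / a) `^ (theta + 1)^-1.
have l0 : 0 < l by rewrite powR_gt0// divr_gt0.
have lE : l `^ (- (theta + 1)) = a / b.
  by rewrite powRN /l -powRrM mulVf ?gt_eqF// powRr1 ?divr_ge0 ?ltW// invf_div.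
pose v r := u (l * r).
have mv : measurable_fun (`]0, +oo[ : set R) v by exact: measurable_fun_dilation.
have Jv : energy p theta v = a%:E.
  by rewrite /v energy_dilation// bE lE -EFinM divfK// gt_eqF.
have bv : ball v.
  apply/ballP => //; split => //.
  - exact: loc_ac_dilation.
  - exact: cvg_dilation.
  - rewrite (_ : derive1 v = fun r => l * derive1 u (l * r)).
      by apply: measurable_funM => //; exact: measurable_fun_dilation.
    by apply/funext => r; exact: derive1_dilation.
  - rewrite Jv energy_derive1_dilation//; last by rewrite -subr_gt0.
    apply: le_trans (leeD (lexx _) Dua) _.
    by rewrite -EFinD lee_fin addrC subrK.
exists v; split; [exact: bv.1|exact: bv.2|].
apply/eqP; rewrite eq_le; apply/andP; split; first exact: TMle bv.
rewrite (split_ _ mv) Jv.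
have -> : excess s v = ((a / b) * G)%:E.
  rewrite -lE EFinM -GE -int_lambda_dilation//.
  exact: nnmeasurable_exp_tail.
rewrite -(fineK Tfin) -EFinM -EFinD lee_fin; apply: le_trans TG _.
by rewrite lerD2l ler_peMl// ler_pdivlMr// mul1r.
Qed.

End Attainment.

(** * Monotonicity in [sigma] and the threshold *)

Section Threshold.
Context {R : realType}.
Variables (p theta : R) (k : nat).
Hypotheses (hp : 2 <= p) (htheta : 0 <= theta) (hk : k%:R = p - 1).
Implicit Types (r s t x : R) (u : R -> R).

Local Notation q := (p / (p - 1)).
Local Notation ball := (unit_ball p (p - 1) theta).
Local Notation excess := (excess p theta k).
Local Notation muc := (Defs.mu (p - 1) theta).
Local Notation T := (TMC p (p - 1) theta).
Local Notation leading s := (s ^+ k / k`!%:R).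

Lemma leading_gt0 s : 0 < s -> 0 < leading s.
Proof. by move=> s0; rewrite divr_gt0 ?exprn_gt0// ltr0n fact_gt0. Qed.

Lemma leading_scale s t : s != 0 -> (t / s) ^+ k * leading s = leading t.
Proof. by move=> s0; rewrite mulrA -exprMn divfK. Qed.

Lemma ball_split s u : 0 < s -> s < muc -> ball u -> exists J G : R,
  [/\ energy p theta u = J%:E, excess s u = G%:E, 0 <= J <= 1, 0 <= G &
      TM_functional p theta s u = (leading s * J + G)%:E].
Proof.
move=> s0 smu bu; have [_ _ mu_ _ _] := (ballP hp htheta u).1 bu.
have J0 := energy_ge0 p u htheta; have J1 := ball_energy hp htheta bu.
have E0 := excess_ge0 p k htheta u (ltW s0).
have Jf : energy p theta u \is a fin_num.
  by rewrite (ge0_fin_numE J0); exact: le_lt_trans J1 (ltry _).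
have split_ := TM_functional_split hp htheta hk (ltW s0) mu_.
have Eoo : (excess s u < +oo)%E.
  have := le_lt_trans (TMC_ge s bu) (TMC_fin hp htheta hk s0 smu).
  rewrite split_; apply: le_lt_trans.
  by apply: leeDr; apply: mule_ge0; [rewrite lee_fin ltW// leading_gt0|exact: J0].
have Ef : excess s u \is a fin_num by rewrite (ge0_fin_numE E0); exact: Eoo.
rewrite split_ -(fineK Jf) -(fineK Ef).
exists (fine (energy p theta u)), (fine (excess s u)); split => //.
- by rewrite -!lee_fin (fineK Jf) J0.
- by rewrite -lee_fin (fineK Ef).
Qed.

(** As [tau] tends to 0, the test functions have energy [1 - tau] and a nonnegative excess. *)
Lemma leading_le_TMC s : 0 < s -> s < muc -> ((leading s)%:E <= T s)%E.
Proof.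
move=> s0 smu; have c0 := leading_gt0 s0.
have [M M0 test] := test_function hp htheta hk s0.
have lb tau : 0 < tau < 1 -> ((leading s * (1 - tau))%:E <= T s)%E.
  move=> tau01; have [u bu [Ju _]] := test _ tau01.
  apply: le_trans (TMC_ge s bu).
  have [J [G [JE _ _ G0 ->]]] := ball_split s0 smu bu.
  by move: JE; rewrite Ju => -[<-]; rewrite lee_fin lerDl.
apply/lee_addgt0Pr => e e0.
pose tau := Num.min 2^-1 (e / leading s).
have tau01 : 0 < tau < 1.
  by rewrite lt_min invr_gt0 ltr0n divr_gt0//= gt_min; apply/orP; left; lra.
apply: le_trans (leeD (lb _ tau01) (lexx _)); rewrite -EFinD lee_fin mulrBr mulr1 -addrA lerDl addrC subr_ge0.
by rewrite mulrC -ler_pdivlMr// ge_min lexx orbT.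
Qed.

(** Passing from [s] to [t], a maximizer for [s] gains exactly [(t / s)^k] in its leading term and
    at least [(t / s)^(k+1)] in its excess. The excess is positive: otherwise [u] has zero energy,
    and its functional would be 0, below [leading s]. *)
Lemma TMC_attained_scale s t : 0 < s -> s < t -> t < muc ->
  TMC_attained p (p - 1) theta s -> (((t / s) ^+ k)%:E * T s < T t)%E.
Proof.
move=> s0 st tmu [u [Xu Nu Tu]].
have bu : ball u by split.
have smu := lt_trans st tmu; have t0 := lt_trans s0 st.
have [_ _ mu_ _ _] := (ballP hp htheta u).1 bu.
have [J [G [JE GE J01 G0 TE]]] := ball_split s0 smu bu.
have [J' [G' [JE' GE' _ _ TE']]] := ball_split t0 tmu bu.
have := leading_le_TMC s0 smu; have := TMC_ge t bu.
have := excess_scale p k htheta s0 (ltW st) mu_.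
have Ggt : G = 0 -> J = 0.
  move=> G00; have := (excess_eq0 k hp htheta s0 mu_).1.
  by rewrite GE JE G00 => /(_ erefl) [].
rewrite GE GE' TE' -Tu TE; move: JE'; rewrite JE => -[<-].
rewrite -EFinM !lee_fin => scale le_t le_s; apply: lt_le_trans le_t; rewrite lte_fin.
have {}G0 : 0 < G.
  rewrite lt_neqAle G0 andbT; apply/eqP => G00; move: le_s.
  by rewrite -G00 Ggt// mulr0 addr0 leNgt leading_gt0.
rewrite mulrDr mulrA leading_scale ?gt_eqF// ltrD2l; apply: lt_le_trans scale.
rewrite ltr_pM2r// exprS ltr_pMl ?exprn_gt0 ?divr_gt0//.
by rewrite ltr_pdivlMr// mul1r.
Qed.

Lemma leading_lt_TMC_attained s t : 0 < s -> s < t -> t < muc ->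
  TMC_attained p (p - 1) theta s -> ((leading t)%:E < T t)%E.
Proof.
move=> s0 st tmu att; have smu := lt_trans st tmu.
apply: le_lt_trans (TMC_attained_scale s0 st tmu att).
rewrite -(@leading_scale s t) ?gt_eqF// EFinM lee_wpmul2l//.
  by rewrite lee_fin exprn_ge0// divr_ge0 ?ltW// (lt_trans s0).
exact: leading_le_TMC.
Qed.

(** For a fixed [u] the functional is left continuous in [s], so a function that beats [leading s]
    still does so slightly below. This settles the endpoint [sigma_star], where attainment is not
    known. *)
Lemma leading_lt_TMC_left s : 0 < s -> s < muc -> ((leading s)%:E < T s)%E ->
  exists2 r, 0 < r < s & ((leading r)%:E < T r)%E.
Proof.
move=> s0 smu /ereal_sup_gt[_ [u bu <-]].
have [_ _ mu_ _ _] := (ballP hp htheta u).1 bu.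
have [J [G [JE GE _ G0 ->]]] := ball_split s0 smu bu; rewrite lte_fin => gt.
(* At least [s / 2], hence positive, and below [s]. *)
pose s_ n := s - s / 2 * harmonic n.
have s_s n : 0 < s_ n < s.
  rewrite /s_ /harmonic /= gtrBl mulr_gt0 ?divr_gt0 ?invr_gt0// andbT subr_gt0.
  apply: (@le_lt_trans _ _ (s / 2)); last by rewrite ltr_pdivrMr// ltr_pMr// ltr1n.
  by rewrite ger_pMr ?divr_gt0// invf_le1// ler1n.
have s_cvg : s_ n @[n --> \oo] --> s.
  rewrite -[X in _ --> X]subr0; apply: cvgB; first exact: cvg_cst.
  rewrite -[X in _ --> X](mulr0 (s / 2)); apply: cvgMr; exact: cvg_harmonic.
have c_cvg : leading (s_ n) @[n --> \oo] --> leading s.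
  apply: cvgMl; apply: (cvg_comp s_ (fun x : R => x ^+ k)); first exact: s_cvg.
  exact: exprn_continuous.
have E_cvg : excess (s_ n) u @[n --> \oo] --> excess s u.
  apply: (@int_lambda_dominated _ _ htheta _ _ (fun r => exp_tail k.+1 (s * `|u r| `^ q))).
  - by move=> n; apply: nnmeasurable_exp_tail => //; apply: ltW; case/andP: (s_s n).
  - by apply: nnmeasurable_exp_tail => //; exact: ltW.
  - move=> r r0; apply: (cvg_comp (fun n => s_ n * `|u r| `^ q) (exp_tail k.+1)).
      by apply: cvgMl; exact: s_cvg.
    exact: exp_tail_continuous.
  - move=> n r r0; have /andP[sn0 sns] := s_s n.
    have l1 : 1 <= s / s_ n by rewrite ler_pdivlMr// mul1r ltW.
    have sx0 : 0 <= s_ n * `|u r| `^ q by rewrite mulr_ge0 ?powR_ge0 ?ltW.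
    have := exp_tail_scale k.+1 l1 sx0; rewrite mulrA divfK ?gt_eqF//.
    apply: le_trans; rewrite ler_peMl ?exp_tail_ge0//.
    by rewrite exprn_ege1.
  - by have := ltry G; rewrite -GE.
move: E_cvg; rewrite GE => /fine_cvgP[_ E_cvg].
have d_cvg : leading (s_ n) * J + fine (excess (s_ n) u) - leading (s_ n) @[n --> \oo]
    --> leading s * J + G - leading s.
  by apply: cvgB => //; apply: cvgD => //; exact: cvgMl.
have d0 : 0 < leading s * J + G - leading s by rewrite subr_gt0.
have [n dn] := filter_ex (cvgr_gt _ d_cvg _ d0).
have /andP[sn0 sns] := s_s n.
exists (s_ n) => //.
apply: lt_le_trans (TMC_ge _ bu).
have [J' [G' [JE' GE' _ _ ->]]] := ball_split sn0 (lt_trans sns smu) bu.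
move: JE' dn; rewrite JE GE' => -[<-] /=.
by rewrite subr_gt0 lte_fin.
Qed.

(** [p > 2] makes [b = 1 - (p - 1)^-1] positive; so [tau^b] is small with [tau], and the loss
    [leading s * tau] falls below the gain of order [tau^(1 - b)]. *)
Lemma leading_lt_TMC_gt2 s : 2 < p -> 0 < s -> s < muc -> ((leading s)%:E < T s)%E.
Proof.
move=> p2 s0 smu; have c0 := leading_gt0 s0.
have [M M0 test] := test_function hp htheta hk s0.
pose a := (p - 1)^-1; pose b := 1 - a.
have b0 : 0 < b by rewrite subr_gt0 invf_lt1; lra.
(* The second entry gives [leading s * x^b <= M / 4]; the first gives [1 - x >= 1 / 2], which is
   more than [1 / 4]. *)
pose x := Num.min 2^-1 ((M / 2 / (2 * leading s)) `^ b^-1).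
have y0 : 0 < M / 2 / (2 * leading s) by rewrite !divr_gt0// mulr_gt0.
have x0 : 0 < x by rewrite lt_min invr_gt0 ltr0n powR_gt0.
have xh : x <= 2^-1 by rewrite ge_min lexx.
have xb : x `^ b <= M / 2 / (2 * leading s).
  have : x `^ b <= ((M / 2 / (2 * leading s)) `^ b^-1) `^ b.
    by apply: ge0_ler_powR; rewrite ?nnegrE ?powR_ge0 ?(ltW b0) ?(ltW x0) ?ge_min ?lexx ?orbT.
  by rewrite -powRrM mulVf ?gt_eqF// powRr1 ?(ltW y0).
have x01 : 0 < x < 1 by rewrite x0; lra.
have [u bu [Ju Eu]] := test _ x01.
apply: lt_le_trans (TMC_ge s bu).
have [J [G [JE GE _ G0 ->]]] := ball_split s0 smu bu.
move: JE Eu; rewrite Ju GE => -[<-]; rewrite lee_fin lte_fin => le_G.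
have xE : x = x `^ a * x `^ b.
  rewrite -powRD; last by rewrite (gt_eqF x0) implybT.
  by rewrite addrC /b subrK powRr1// ltW.
have xa0 : 0 < x `^ a by rewrite powR_gt0.
have h1 : leading s * x < M * x `^ a * (1 - x).
  apply: (@le_lt_trans _ _ (M / 4 * x `^ a)).
    rewrite [X in _ * X]xE mulrCA mulrC ler_pM2r//.
    apply: le_trans (ler_wpM2l (ltW c0) xb) _.
    have : leading s != 0 by rewrite gt_eqF.
    by move: (leading s) => c cn0; rewrite le_eqVlt; apply/orP; left; apply/eqP; field.
  by rewrite [ltRHS]mulrAC ltr_pM2r// ltr_pM2l//; lra.
by rewrite mulrBr mulr1; move: h1 le_G; set y := _ * x; set z := M * _ * _; lra.
Qed.

(** The test function shows that the ball is nonempty; the supremum of the empty set would be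
    [-oo]. *)
Lemma TMC0 : T 0 = 0%E.
Proof.
have k0 : (0 < k)%N.
  by rewrite -(ltr_nat R) hk subr_gt0; apply: lt_le_trans hp; rewrite ltr1n.
have TM0 u : TM_functional p theta 0 u = 0%E.
  rewrite /TM_functional (@eq_int_lambda _ _ _ (cst 0)).
    by rewrite /int_lambda; under eq_integral do rewrite /= mul0r; rewrite integral0 mule0.
  by move=> r _; rewrite mul0r (phi_exp_tail _ hk) -(prednK k0) exp_tail0.
have [M M0 test] := test_function hp htheta hk ltr01.
have h01 : 0 < (2^-1 : R) < 1 by apply/andP; split; lra.
have [u bu _] := test _ h01.
apply/eqP; rewrite eq_le; apply/andP; split.
  by apply: ge_ereal_sup => _ [v _ <-]; rewrite TM0.
by rewrite -(TM0 u); exact: TMC_ge.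
Qed.

End Threshold.

Theorem theorem1p5 (R : realType) (p alpha theta : R) (k0 : nat)
  (hp : 2 <= p) (halpha : alpha = p - 1) (htheta : 0 <= theta)
  (hk0 : p - 1 <= k0%:R /\ forall j : nat, p - 1 <= j%:R -> (k0 <= j)%N)
  (hk0p : k0%:R = p - 1)
  (hsigma : (sigma_star p alpha theta < (mu alpha theta)%:E)%E) :
  (* (i) *)
  (forall s : R, (sigma_star p alpha theta < s%:E)%E -> s < mu alpha theta ->
     TMC_attained p alpha theta s) /\
  (* (ii) *)
  ((forall s : R, (sigma_star p alpha theta < s%:E)%E -> s < mu alpha theta ->
      TMC p alpha theta s \is a fin_num) /\
   (forall s t : R, (sigma_star p alpha theta < s%:E)%E -> s < t ->
      t < mu alpha theta ->
      nu p alpha theta k0 s < nu p alpha theta k0 t) /\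
   TMC p alpha theta 0 = 0%E /\
   (forall s : R, 0 <= s -> (s%:E <= sigma_star p alpha theta)%E ->
      TMC p alpha theta s = (s `^ (p - 1) / k0`!%:R)%:E) /\
   (forall s : R, (sigma_star p alpha theta < s%:E)%E -> s < mu alpha theta ->
      ((s `^ (p - 1) / k0`!%:R)%:E < TMC p alpha theta s)%E) /\
   sigma_star p alpha theta =
     ereal_inf [set s%:E | s in
       [set s : R | 0 < s < mu alpha theta /\
          ((s `^ (p - 1) / k0`!%:R)%:E < TMC p alpha theta s)%E]]) /\
  (* (iii) *)
  (2 < p ->
     sigma_star p alpha theta = 0%E /\
     forall s : R, 0 < s -> s < mu alpha theta ->
       TMC_attained p alpha theta s).
Proof.
subst alpha; clear hk0.
have p10 : 0 < p - 1 by rewrite subr_gt0; apply: lt_le_trans hp; rewrite ltr1n.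
set sg := sigma_star p (p - 1) theta in hsigma *.
set m := Defs.mu (p - 1) theta in hsigma *.
have powE s : 0 <= s -> s `^ (p - 1) = s ^+ k0 by move=> s0; rewrite -hk0p powR_mulrn.
have sg_ge0 : (0 <= sg)%E.
  by apply: le_ereal_inf_tmp => _ [s [/andP[s0 _] _] <-]; rewrite lee_fin ltW.
have sg_le s : 0 < s -> s < m -> TMC_attained p (p - 1) theta s -> (sg <= s%:E)%E.
  by move=> s0 sm att; apply: ereal_inf_lbound; exists s => //; split => //; apply/andP.
have pos s : (sg < s%:E)%E -> 0 < s.
  by move=> /(le_lt_trans sg_ge0); rewrite lte_fin.
(* The infimum provides an [r < s] at which the supremum is attained, and attainment at [r] gives
   strict inequality at every larger value. *)
have above s : (sg < s%:E)%E -> s < m -> ((s ^+ k0 / k0`!%:R)%:E < TMC p (p - 1) theta s)%E.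
  move=> /ereal_inf_lt[_ [r [/andP[r0 rm] att] <-]]; rewrite lte_fin => rs sm.
  exact: leading_lt_TMC_attained rs sm att.
have attained s : (sg < s%:E)%E -> s < m -> TMC_attained p (p - 1) theta s.
  by move=> sgs sm; apply: TMC_attained_of_gt (above _ sgs sm) => //; exact: pos.
have fin s : 0 < s -> s < m -> TMC p (p - 1) theta s \is a fin_num.
  move=> s0 sm; rewrite ge0_fin_numE; first exact: (TMC_fin hp htheta hk0p s0 sm).
  apply: le_trans (leading_le_TMC hp htheta hk0p s0 sm).
  by rewrite lee_fin ltW// leading_gt0.
(* Strict inequality at [s] would move to some [r < s], and the supremum would then be attained
   below [sg]. *)
have not_gt s : 0 < s -> (s%:E <= sg)%E ->
    ~ ((s ^+ k0 / k0`!%:R)%:E < TMC p (p - 1) theta s)%E.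
  move=> s0 ssg gts; have sm : s < m by rewrite -lte_fin; exact: le_lt_trans hsigma.
  have [r /andP[r0 rs] gtr] := leading_lt_TMC_left hp htheta hk0p s0 sm gts.
  have rm := lt_trans rs sm.
  have := sg_le r r0 rm (TMC_attained_of_gt hp htheta hk0p r0 rm gtr).
  by move=> /(le_trans ssg); rewrite lee_fin leNgt rs.
split; first exact: attained.
split.
  split; first by move=> s sgs sm; apply: fin => //; exact: pos.
  split.
    move=> s t sgs st tm; have s0 := pos _ sgs; have sm := lt_trans st tm.
    have t0 := lt_trans s0 st; have st0 : 0 < (t / s) ^+ k0 by rewrite exprn_gt0// divr_gt0.
    have f0 : 0 < k0`!%:R :> R by rewrite ltr0n fact_gt0.
    (* Dividing by [t ^+ k0] turns the comparison of the two suprema into that of [nu]. *)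
    have scale (x y : R) : (t / s) ^+ k0 * x < y ->
        k0`!%:R / s ^+ k0 * x < k0`!%:R / t ^+ k0 * y.
      move=> xy; rewrite -!mulrA (ltr_pM2l f0) ltr_pdivlMl ?exprn_gt0// mulrA.
      by apply: le_lt_trans xy; rewrite expr_div_n.
    have := TMC_attained_scale hp htheta hk0p s0 st tm (attained _ sgs sm).
    rewrite -(fineK (fin _ s0 sm)) -(fineK (fin _ t0 tm)) -EFinM lte_fin => /scale.
    by rewrite /nu !powE ?(ltW s0) ?(ltW t0).
  split; first exact: (TMC0 hp htheta hk0p).
  split.
    move=> s; rewrite le_eqVlt => /predU1P[<- _|s0 ssg].
      rewrite (TMC0 hp htheta hk0p) powR0 ?gt_eqF// mul0r; reflexivity.
    have sm : s < m by rewrite -lte_fin; exact: le_lt_trans hsigma.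
    rewrite powE ?(ltW s0)//; apply/eqP; rewrite eq_le leNgt; apply/andP; split.
      by apply/negP; exact: not_gt.
    exact: leading_le_TMC.
  split; first by move=> s sgs sm; rewrite powE ?(ltW (pos _ sgs))//; exact: above.
  apply/eqP; rewrite eq_le; apply/andP; split.
    apply: le_ereal_inf_tmp => _ [s [/andP[s0 sm] gts] <-]; rewrite powE ?(ltW s0)// in gts.
    by rewrite leNgt; apply/negP => ssg; exact: (not_gt s s0 (ltW ssg) gts).
  (* Attainment at [r] gives strict inequality only for [t > r], so [r] is approached by such
     [t]. *)
  apply: le_ereal_inf_tmp => _ [r [/andP[r0 rm] att] <-]; rewrite -/m in rm.
  apply/lee_addgt0Pr => e e0; pose t := Num.min (r + e) ((r + m) / 2).
  have rt : r < t by rewrite lt_min; apply/andP; split; lra.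
  have tm : t < m by rewrite gt_min; apply/orP; right; lra.
  have t0 := lt_trans r0 rt.
  apply: (@le_trans _ _ t%:E); last by rewrite -EFinD lee_fin ge_min lexx.
  apply: ereal_inf_lbound; exists t => //; split; first exact/andP.
  rewrite powE ?(ltW t0)//.
  exact: (leading_lt_TMC_attained hp htheta hk0p r0 rt tm att).
move=> p2.
have all s : 0 < s -> s < m -> TMC_attained p (p - 1) theta s.
  move=> s0 sm; apply: (TMC_attained_of_gt hp htheta hk0p s0 sm).
  exact: leading_lt_TMC_gt2.
split; last exact: all.
have m0 : 0 < m by rewrite -lte_fin; exact: le_lt_trans hsigma.
apply/eqP; rewrite eq_le sg_ge0 andbT; apply/lee_addgt0Pr => e e0; rewrite add0e.
pose s := Num.min e (m / 2).
have s0 : 0 < s by rewrite lt_min e0 divr_gt0.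
have sm : s < m by rewrite gt_min; apply/orP; right; lra.
by apply: le_trans (sg_le _ s0 sm (all _ s0 sm)) _; rewrite lee_fin ge_min lexx.
Qed.
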